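(* For $N\ge1$ let $-1=\xi_0<\dots<\xi_N=1$ be the $N+1$ Gauss--Lobatto points, $h_i=\xi_{i+1}-\xi_i$, and for integrable $f$ on $[-1,1]$ set $S_i(f)=\int_{\xi_i}^{\xi_{i+1}}f(x)\,dx$, $0\le i\le N-1$. Let $(f_0,\dots,f_{N-1})\in\mathbb{R}^N$. Let $\widehat u_N$ be the unique polynomial of degree at most $N-1$ with $S_i(\widehat u_N)=f_i$ for all $i$, and let $\widehat u_h$ be the piecewise constant function equal to $h_i^{-1}f_i$ on $[\xi_i,\xi_{i+1}]$ (so $S_i(\widehat u_h)=f_i$). Then, with constants independent of $N$ and of the data, $$\|\widehat u_N\|_0^2\approx\|\widehat u_h\|_0^2,\qquad \|(1-x)^{1/2}\widehat u_N\|_0^2\approx\|(1-x)^{1/2}\widehat u_h\|_0^2 .$$ Furthermore, let $\widehat z_N$ be the unique polynomial in $(1-x)\mathbb{P}^{N-1}$ with $S_i(\widehat z_N)=f_i$ for all $i$, and let $\widehat z_h$ be the function with $S_i(\widehat z_h)=f_i$ for all $i$ that is constant on each of the first $N-1$ subcells $[\xi_i,\xi_{i+1}]$, $i<N-1$, and is a multiple of $(1-x)$ on the last subcell $[\xi_{N-1},\xi_N]$. Then, with constants independent of $N$ and of the data, $$\|(1-x)^{-1/2}\widehat z_N\|_0^2\approx\|(1-x)^{-1/2}\widehat z_h\|_0^2 .$$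
   Context: $\|\cdot\|_0$ is the $L^2(-1,1)$ norm; $\mathbb{P}^{n}$ is the space of univariate polynomials of degree at most $n$. $a\approx b$ means $C^{-1}b\le a\le Cb$ with $C>0$ independent of $N$ (and of the data). The Gauss--Lobatto points are the roots of $(1-x^2)P_N'(x)$, with $P_N$ the Legendre polynomial of degree $N$. *)

(* Defs.v *)
From HB Require Import structures.
From mathcomp Require Import all_boot all_order all_algebra.
From mathcomp Require Import all_classical all_reals all_analysis.

Set Implicit Arguments.
Unset Strict Implicit.
Unset Printing Implicit Defensive.
Import Order.TTheory GRing.Theory Num.Theory.
Import numFieldNormedType.Exports.
Local Open Scope classical_set_scope.
Local Open Scope ring_scope.

(* Rodrigues' formula, normalised so that P_n(1) = 1. *)
Definition legendre (R : realType) (n : nat) : {poly R} :=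
  (2 ^+ n * n`!%:R)^-1 *: (('X^2 - 1) ^+ n)^`(n).

(* xi lists, in increasing order, exactly the roots of (1 - x^2) P_N'(x). *)
Definition gauss_lobatto (R : realType) (N : nat) (xi : N.+1.-tuple R) : Prop :=
  [/\ sorted <%R xi, xi`_0 = -1, xi`_N = 1 &
      forall x : R, (x \in xi) = root ((1 - 'X^2) * (legendre R N)^`()) x].

Definition cell_integral (R : realType) (xi : seq R) (i : nat) (f : R -> R) : R :=
  \int[@lebesgue_measure R]_(x in `[xi`_i, xi`_i.+1]) f x.

(* The norm of L^2(-1,1); only the values of f on ]-1, 1[ matter. *)
Definition L2norm (R : realType) (f : R -> R) : \bar R :=
  ('N[@lebesgue_measure R]_(2%:E)[EFin \o (f \_ `]-1, 1[)%R])%E.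

Definition two_sided_bound (R : realType) (C : R) (a b : \bar R) : Prop :=
  ((C^-1)%:E * b <= a)%E /\ (a <= C%:E * b)%E.

Definition is_uN (R : realType) (N : nat) (xi : seq R) (f : 'I_N -> R)
    (p : {poly R}) : Prop :=
  (size p <= N)%N /\ forall i : 'I_N, cell_integral xi i (horner p) = f i.

(* Adjacent closed cells share a node, where a piecewise constant function
   would be over-determined; its values at the nodes are left unconstrained. *)
Definition is_uh (R : realType) (N : nat) (xi : seq R) (f : 'I_N -> R)
    (u : R -> R) : Prop :=
  forall (i : 'I_N) (x : R), xi`_i < x < xi`_i.+1 ->
    u x = (xi`_i.+1 - xi`_i)^-1 * f i.

Definition is_zN (R : realType) (N : nat) (xi : seq R) (f : 'I_N -> R)
    (p : {poly R}) : Prop :=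
  (exists2 q : {poly R}, (size q <= N)%N & p = (1 - 'X) * q) /\
  forall i : 'I_N, cell_integral xi i (horner p) = f i.

(* As for is_uh, the values at the nodes are left unconstrained. *)
Definition is_zh (R : realType) (N : nat) (xi : seq R) (f : 'I_N -> R)
    (z : R -> R) : Prop :=
  [/\ forall i : nat, (i < N.-1)%N ->
        exists c : R, forall x : R, xi`_i < x < xi`_i.+1 -> z x = c,
      exists c : R, forall x : R, xi`_N.-1 < x < xi`_N -> z x = c * (1 - x) &
      forall i : 'I_N, cell_integral xi i z = f i].

(* Main.v *)
Require Import Defs.
From HB Require Import structures.
From mathcomp Require Import all_boot all_order all_algebra.
From mathcomp Require Import all_classical all_reals all_analysis.
From mathcomp Require Import ring lra zify.
From mathcomp Require Import polyrcf polyorder measurable_realfun pi_irrational.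

Set Implicit Arguments.
Unset Strict Implicit.
Unset Printing Implicit Defensive.
Import Order.TTheory GRing.Theory Num.Theory.
Local Open Scope ring_scope.

(* The cell integrals of [V q] are the increments of its primitive between nodes.
   For [V] the weight [W = 1] or [W = 1 - x], that primitive is, after
   subtraction of an orthogonal projection, of the form [- W (1 - x^2) y'], where
   [q = A y] for the Jacobi operator [A] of weight [W].
   Since [A] has spectrum at most [N(N+1)] on polynomials of degree less than [N]
   and at least [N(N+1)] on their orthogonal complement, the norm of [q] is
   controlled by [N(N+1)] times the energy of [y]. The latter is the integral of
   a polynomial of degree at most [2N - 1], computed exactly by Gauss-Lobatto
   quadrature from the nodal values, and each nodal term is bounded by local
   energies because the weights satisfy [w_i <= C h_i] and
   [N^2 w_i h_i <= C (1 - xi_i^2)]: the weights are estimated by a Sonin type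
   monotonicity argument for [P_N], the cell widths by comparing
   [(1 - x^2) P_N'] with explicit test functions through a Wronskian.
   Hence [|q|_W <= C |v|_W] for every polynomial [v] whose weighted cell
   integrals are those of [q]; letting [v] tend to a step function in [L^2] gives
   the upper bound, and Cauchy-Schwarz on each cell the lower one.
   For plain integrals in the norm of weight [1 - x], the primitive is written
   [(1 + x) r], and [r] is measured with the weight [1 + x]; as [1 / (1 - x)] is
   not integrable, the integral over the last cell is estimated separately, by
   an inverse inequality. *)

(** * Integrals of polynomials *)

Section PolyIntegral.
Variable R : rcfType.
Implicit Types (p q r W : {poly R}) (a b c t x y : R).

(** The statement compares a polynomial with a step function, but the core estimate is between two
    polynomials [q] and [v] with equal cell integrals: this keeps it algebraic and postpones
    Lebesgue integrals to the end. The constant is independent of [N] because [n = N(N+1)] enters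
    twice and cancels. Let [r] be the orthogonal projection of [v] on degrees below [N]. Subtracting
    [r] from both [q] and [v] keeps their cell integrals equal and leaves [d] of degree below [N]
    and [e] orthogonal to those degrees. The energy of the potential [y] of [d], times [n], bounds
    [|d|^2] from above; that of the potential [k] of [e], times [n], is bounded by [|e|^2]. The two
    potentials are tied only by the equality of [W (1 - x^2) y'] and [W (1 - x^2) k'] at the nodes.
    Orthogonality to constants is also what makes these primitives vanish at both ends. Between the
    nodes [k] is controlled only through its energies. Each nodal value therefore has to be sampled
    inside one cell, and quadrature weights and cell widths have to match node by node, uniformly up
    to the endpoints. *)

Definition hE := (hornerD, hornerN, hornerM, hornerC, hornerX, horner_exp).

Definition prim p : {poly R} :=
  \poly_(i < (size p).+1) (p`_i.-1 / i%:R *+ (i != 0)).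

Lemma deriv_prim p : (prim p)^`() = p.
Proof.
apply/polyP => i; rewrite coef_deriv coef_poly ltnS mulr1n /=.
case: ltnP => [_|le_p_i]; last by rewrite mul0rn nth_default.
by rewrite -[LHS]mulr_natr divfK ?pnatr_eq0.
Qed.

Lemma size_prim p : (size (prim p) <= (size p).+1)%N.
Proof. exact: size_poly. Qed.

(* The integral of [p] over [a, b], through an explicit primitive. *)
Definition pint a b p : R := (prim p).[b] - (prim p).[a].

Lemma deriv0_const p : p^`() = 0 -> p = (p`_0)%:P.
Proof.
move=> p'0; apply/polyP => -[|i]; rewrite coefC //=.
move/polyP/(_ i)/eqP: p'0; rewrite coef_deriv coef0 -mulr_natr mulf_eq0.
by rewrite pnatr_eq0 orbF => /eqP.
Qed.

Lemma pint_deriv a b p : pint a b p^`() = p.[b] - p.[a].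
Proof.
rewrite /pint; set q := prim _.
have: (q - p)^`() = 0 by rewrite derivB deriv_prim subrr.
move/deriv0_const => h.
have -> : q = p + ((q - p)`_0)%:P by rewrite -h addrC subrK.
rewrite !hE; ring.
Qed.

Lemma pintE a b p q : q^`() = p -> pint a b p = q.[b] - q.[a].
Proof. by move=> <-; exact: pint_deriv. Qed.

Lemma pintD a b p q : pint a b (p + q) = pint a b p + pint a b q.
Proof.
rewrite (@pintE _ _ _ (prim p + prim q)) ?derivD ?deriv_prim //.
rewrite /pint !hE; ring.
Qed.

Lemma pintZ a b c p : pint a b (c%:P * p) = c * pint a b p.
Proof.
rewrite (@pintE _ _ _ (c%:P * prim p)) ?derivM ?deriv_prim ?derivC ?mul0r ?add0r //.
rewrite /pint !hE; ring.
Qed.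

Lemma pintN a b p : pint a b (- p) = - pint a b p.
Proof. by rewrite -mulN1r -polyCN pintZ mulN1r. Qed.

Lemma pintB a b p q : pint a b (p - q) = pint a b p - pint a b q.
Proof. by rewrite pintD pintN. Qed.

Lemma pint0 a b : pint a b 0 = 0.
Proof. by rewrite -(mul0r 0) -polyC0 pintZ mul0r. Qed.

Lemma pint_sum a b (I : Type) (r : seq I) (P : pred I) (F : I -> {poly R}) :
  pint a b (\sum_(i <- r | P i) F i) = \sum_(i <- r | P i) pint a b (F i).
Proof. by apply: (big_morph (pint a b)) => [p q|]; rewrite ?pintD ?pint0. Qed.

Lemma pint_cat b a c p : pint a b p + pint b c p = pint a c p.
Proof. rewrite /pint; ring. Qed.

Lemma pintxx a p : pint a a p = 0.
Proof. by rewrite /pint subrr. Qed.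

(** The only analytic fact behind [pint]: sign, monotonicity and Cauchy-Schwarz all come from it, so
    no measure theory enters the polynomial estimates. *)
Lemma pint_mvt a b p : a < b ->
  exists c, a < c < b /\ pint a b p = p.[c] * (b - a).
Proof.
move=> /(poly_mvt (prim p))[c]; rewrite in_itv /= deriv_prim => h1 h2.
by exists c.
Qed.

Lemma pint_ge0 a b p : a <= b -> (forall x, a <= x <= b -> 0 <= p.[x]) ->
  0 <= pint a b p.
Proof.
rewrite le_eqVlt => /predU1P[-> _|ltab h]; first by rewrite pintxx.
have [c [/andP[ac cb] ->]] := pint_mvt p ltab.
by apply: mulr_ge0; [apply: h; rewrite !ltW | rewrite subr_ge0 ltW].
Qed.

Lemma pint_le a b p q : a <= b -> (forall x, a <= x <= b -> p.[x] <= q.[x]) ->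
  pint a b p <= pint a b q.
Proof.
move=> ab h; rewrite -subr_ge0 -pintB pint_ge0 // => x /h.
by rewrite !hE subr_ge0.
Qed.

Lemma pint_const a b c : pint a b c%:P = c * (b - a).
Proof.
rewrite (@pintE _ _ _ (c%:P * 'X)) ?derivM ?derivC ?derivX ?mul0r ?mulr1 ?add0r //.
by rewrite !hE; ring.
Qed.

Lemma pint_sub a b c e p : a <= c -> c <= e -> e <= b ->
  (forall x, a <= x <= b -> 0 <= p.[x]) -> pint c e p <= pint a b p.
Proof.
move=> ac ce eb h; rewrite -(pint_cat c a b) -(pint_cat e c b).
have h1 : 0 <= pint a c p.
  by apply: pint_ge0 => // x /andP[? xc]; apply: h; apply/andP; split; lra.
have h2 : 0 <= pint e b p.
  by apply: pint_ge0 => // x /andP[? xc]; apply: h; apply/andP; split; lra.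
lra.
Qed.

Lemma discr_le (A B C : R) : (forall t, 0 <= A * t ^+ 2 - 2 * B * t + C) ->
  B ^+ 2 <= A * C.
Proof.
move=> h; have hC := h 0; have [A0|A0] := eqVneq A 0.
  have [->|B0] := eqVneq B 0; first by rewrite A0; lra.
  (* For [A = 0] the form is affine in [t]; at this point its value is [-1]. *)
  have := h ((C + 1) / (2 * B)).
  have -> : A * ((C + 1) / (2 * B)) ^+ 2 - 2 * B * ((C + 1) / (2 * B)) + C = -1.
    by rewrite A0; field.
  lra.
have A_gt0 : 0 < A.
  rewrite lt0r A0 /=; have h1 := h 1; have h2 := h (-1).
  rewrite leNgt; apply/negP => Alt0.
  have hs : forall s, 0 <= A * s ^+ 2 + C.
    by move=> s; have := h s; have := h (- s); nra.
  have := hs (C / A - 1).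
  have -> : A * (C / A - 1) ^+ 2 + C = A + C ^+ 2 / A - C by field.
  have : C ^+ 2 / A <= 0 by rewrite mulr_ge0_le0 ?sqr_ge0 // invr_le0 ltW.
  lra.
have := h (B / A).
have -> : A * (B / A) ^+ 2 - 2 * B * (B / A) + C = (A * C - B ^+ 2) / A by field.
by rewrite pmulr_lge0 ?invr_gt0 // subr_ge0.
Qed.

Lemma pint_CS a b W p q : a <= b -> (forall x, a <= x <= b -> 0 <= W.[x]) ->
  pint a b (W * p * q) ^+ 2 <= pint a b (W * p ^+ 2) * pint a b (W * q ^+ 2).
Proof.
move=> ab hW; apply: discr_le => t.
have -> : pint a b (W * p ^+ 2) * t ^+ 2 - 2 * pint a b (W * p * q) * t
    + pint a b (W * q ^+ 2) = pint a b (W * (t%:P * p - q) ^+ 2).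
  have -> : W * (t%:P * p - q) ^+ 2 = (t ^+ 2)%:P * (W * p ^+ 2)
     - (2 * t)%:P * (W * p * q) + W * q ^+ 2.
    by rewrite polyC_exp polyCM; ring.
  by rewrite pintD pintB !pintZ; ring.
apply: pint_ge0 => // x /hW Wx; rewrite !hE.
by rewrite mulr_ge0 // sqr_ge0.
Qed.

Lemma pint_CS1 a b p q : a <= b ->
  pint a b (p * q) ^+ 2 <= pint a b (p ^+ 2) * pint a b (q ^+ 2).
Proof.
move=> ab; have := @pint_CS a b 1 p q ab; rewrite !mul1r; apply.
by move=> x _; rewrite hornerE.
Qed.

End PolyIntegral.

(** * Jacobi operators *)

Section Jacobi.
Variable R : rcfType.
Implicit Types (p q r s t : {poly R}).
Variables (W : {poly R}) (al be : R).
Hypothesis W_ge0 : forall x, -1 <= x <= 1 -> 0 <= W.[x].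
Hypothesis W_deriv : W^`() * (1 - 'X ^+ 2) = - (W * (al%:P + be%:P * 'X)).

Definition ip p q : R := pint (-1) 1 (W * p * q).
(** This is [- W^-1 (W (1 - X^2) q')'], freed of the division by the Pearson equation [W_deriv]. The
    weight [(1 - x)^a (1 + x)^b] corresponds to [al = a - b] and [be = a + b]. *)
Definition jacobi_op q : {poly R} :=
  - ((1 - 'X ^+ 2) * q^`()^`()) + (al%:P + (be + 2)%:P * 'X) * q^`().
Definition jacobi_energy q r : R := pint (-1) 1 (W * (1 - 'X ^+ 2) * q^`() * r^`()).
Definition jacobi_eig (k : nat) : R := k%:R * (k%:R + 1 + be).

Local Notation A := jacobi_op.
Local Notation B := jacobi_energy.
Local Notation lam := jacobi_eig.

Lemma lerN11 : (-1 : R) <= 1. Proof. lra. Qed.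

Lemma ipC p q : ip p q = ip q p.
Proof. by rewrite /ip; congr pint; ring. Qed.
Lemma ipDl p q r : ip (p + q) r = ip p r + ip q r.
Proof. by rewrite /ip -pintD; congr pint; ring. Qed.
Lemma ipBl p q r : ip (p - q) r = ip p r - ip q r.
Proof. by rewrite /ip -pintB; congr pint; ring. Qed.
Lemma ipZl c p r : ip (c%:P * p) r = c * ip p r.
Proof. by rewrite /ip -pintZ; congr pint; ring. Qed.
Lemma ipDr p q r : ip r (p + q) = ip r p + ip r q.
Proof. by rewrite !(ipC r) ipDl. Qed.
Lemma ipBr p q r : ip r (p - q) = ip r p - ip r q.
Proof. by rewrite !(ipC r) ipBl. Qed.
Lemma ipZr c p r : ip r (c%:P * p) = c * ip r p.
Proof. by rewrite !(ipC r) ipZl. Qed.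

Lemma ip_ge0 p : 0 <= ip p p.
Proof.
rewrite /ip; apply: pint_ge0 lerN11 _ => x /W_ge0 Wx.
by rewrite !hE -mulrA mulr_ge0 // -expr2 sqr_ge0.
Qed.

Lemma ip_CS p q : ip p q ^+ 2 <= ip p p * ip q q.
Proof. by rewrite /ip -!(mulrA W) -!expr2 mulrA; apply: pint_CS lerN11 W_ge0. Qed.

Lemma ip_eq0 p q : ip p p = 0 -> ip p q = 0.
Proof.
move=> p0; have := ip_CS p q; rewrite p0 mul0r => h.
by apply/eqP; rewrite -sqrf_eq0 eq_le h sqr_ge0.
Qed.

Lemma ip_sum_le p q : ip (p + q) (p + q) <= 2 * ip p p + 2 * ip q q.
Proof.
have := ip_ge0 (p - q); rewrite !(ipBl, ipBr, ipDl, ipDr) (ipC q p); lra.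
Qed.

Lemma deriv_energy q : (W * (1 - 'X ^+ 2) * q^`())^`() = - (W * A q).
Proof.
rewrite /A derivM derivM; move: W_deriv => ->.
rewrite derivB derivC derivXn /= expr1 polyCD; ring.
Qed.

Lemma energyE q r : ip (A q) r = B q r.
Proof.
rewrite /ip /B; have := pint_deriv (-1) 1 (W * (1 - 'X ^+ 2) * q^`() * r).
rewrite derivM deriv_energy pintD !hE => h.
have {h} : pint (-1) 1 (- (W * A q) * r) +
  pint (-1) 1 (W * (1 - 'X^2) * q^`() * r^`()) = 0 by rewrite h; ring.
have -> : - (W * A q) * r = - (W * A q * r) by ring.
rewrite pintN; lra.
Qed.

Lemma energyC q r : B q r = B r q.
Proof. by rewrite /B; congr pint; ring. Qed.

Lemma jacobi_op_sym q r : ip (A q) r = ip q (A r).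
Proof. by rewrite energyE energyC -energyE ipC. Qed.

Lemma jacobi_opD q r : A (q + r) = A q + A r.
Proof. rewrite /A !derivD; ring. Qed.
Lemma jacobi_opB q r : A (q - r) = A q - A r.
Proof. rewrite /A !derivB; ring. Qed.

Lemma energy_ge0 q : 0 <= B q q.
Proof.
rewrite /B; apply: pint_ge0 lerN11 _ => x hx; have Wx := W_ge0 hx.
rewrite !hE -mulrA -expr2 mulr_ge0 ?sqr_ge0 // mulr_ge0 //; nra.
Qed.

(** Triangularity in the monomial basis: the coefficient of degree [m] gets multiplied by [lam m].
    Together with symmetry, this replaces a basis of Jacobi polynomials. *)
Lemma jacobi_op_lead m q : (size q <= m.+1)%N ->
  (size (A q - (lam m)%:P * q)%R <= m)%N.
Proof.
move=> sq; apply/leq_sizeP => i mi.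
have q0 : forall j, (m < j)%N -> q`_j = 0.
  by move=> j mj; rewrite nth_default // (leq_trans sq).
have -> : A q - (lam m)%:P * q = - q^`()^`() + 'X^2 * q^`()^`()
   + al%:P * q^`() + (be + 2)%:P * ('X * q^`()) - (lam m)%:P * q.
  rewrite /A; ring.
rewrite !(coefD, coefN, coefCM, coefXnM, coefXM, coef_deriv).
rewrite ?(q0 i.+1) // ?(q0 i.+2) ?ltnS ?(leq_trans mi) //.
rewrite /lam; case: i mi => [|[|i]] mi /=.
- have -> : m = 0%N by lia.
  by ring.
- have [m0|->] : m = 0%N \/ m = 1%N by lia.
    by rewrite (q0 1%N) m0 // ?mul0rn; ring.
  by rewrite ?mul0rn ?mulr1n; ring.
rewrite !subn2 /=; have [->|mlt] := eqVneq m i.+2.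
  have h2 x : x *+ i.+2 = x * (i%:R + 2) :> R by rewrite -[LHS]mulr_natr -?natr1; ring.
  have h1 x : x *+ i.+1 = x * (i%:R + 1) :> R by rewrite -[LHS]mulr_natr -?natr1; ring.
  by rewrite !h2 h1 -!natr1 mul0rn; ring.
by rewrite q0 ?ltn_neqAle ?mlt // ?mul0rn; ring.
Qed.

Lemma jacobi_op_size N q : (size q <= N)%N -> (size (A q) <= N)%N.
Proof.
case: N => [|m] sq.
  move: sq; rewrite leqn0 size_poly_eq0 => /eqP ->.
  by rewrite /A !deriv0 !mulr0 oppr0 addr0 size_poly0.
have := jacobi_op_lead sq => h.
have -> : A q = (A q - (lam m)%:P * q) + (lam m)%:P * q by rewrite subrK.
apply: (leq_trans (size_polyD _ _)); rewrite geq_max (leq_trans h) ?leqnSn //=.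
by rewrite mul_polyC (leq_trans (size_scale_leq _ _)).
Qed.

Definition orth N (e : {poly R}) := forall t, (size t <= N)%N -> ip e t = 0.

Lemma ip_proj N p : exists2 r : {poly R}, (size r <= N)%N & orth N (p - r).
Proof.
elim: N p => [|N IH] p.
  exists 0; rewrite ?size_poly0 // => t.
  by rewrite leqn0 size_poly_eq0 => /eqP ->; rewrite /ip mulr0 pint0.
have [s ss os] := IH 'X^N; have [r0 sr0 or0] := IH p.
pose e := 'X^N - s; pose c := ip (p - r0) e / ip e e.
have se : (size e <= N.+1)%N.
  by rewrite (leq_trans (size_polyD _ _)) // geq_max size_polyXn leqnn size_polyN ltnW.
have eN : e`_N = 1 by rewrite coefB coefXn eqxx nth_default // subr0.
exists (r0 + c%:P * e).
  rewrite (leq_trans (size_polyD _ _)) // geq_max ltnW //=.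
  by rewrite mul_polyC (leq_trans (size_scale_leq _ _)).
move=> t st; have -> : t = (t - (t`_N)%:P * e) + (t`_N)%:P * e by rewrite subrK.
set t' := t - _.
have st' : (size t' <= N)%N.
  apply/leq_sizeP => i Ni; rewrite coefB coefCM.
  have [->|ne] := eqVneq i N; first by rewrite eN mulr1 subrr.
  have Nlt : (N < i)%N by rewrite ltn_neqAle eq_sym ne.
  by rewrite (nth_default _ (leq_trans st Nlt)) (nth_default _ (leq_trans se Nlt)) mulr0 subr0.
rewrite opprD addrA ipDr ipZr !ipBl !ipZl -!ipBl or0 // os // mulr0 subr0 add0r.
suff -> : ip (p - r0) e - c * ip e e = 0 by rewrite mulr0.
(* [W] is only known to be nonnegative, so [ip e e = 0] is not excluded; Cauchy-Schwarz then makes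
   [e] orthogonal to everything. *)
have [e0|e0] := eqVneq (ip e e) 0; first by rewrite e0 mulr0 ipC ip_eq0 // subrr.
by rewrite /c divfK // subrr.
Qed.

Lemma orthB N e f : orth N e -> orth N f -> orth N (e - f).
Proof. by move=> he hf t st; rewrite ipBl he // hf // subrr. Qed.

Lemma orthW M N e : (N <= M)%N -> orth M e -> orth N e.
Proof. by move=> NM he t st; apply: he; apply: leq_trans NM. Qed.

Lemma orth_op N e : orth N e -> orth N (A e).
Proof. by move=> he t st; rewrite jacobi_op_sym he // jacobi_op_size. Qed.

(** [e] is the part of [q] orthogonal to degrees below [m]. By triangularity [A e - lam m e] has
    degree below [m], hence is orthogonal to [e]; [A] preserves orthogonality, so the cross terms
    vanish. Induction on this splitting gives both spectral bounds. *)
Lemma energy_split m q : (size q <= m.+1)%N -> exists e r : {poly R},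
  [/\ q = e + r, (size r <= m)%N, orth m e, ip q q = ip e e + ip r r &
      B q q = lam m * ip e e + B r r].
Proof.
move=> sq; have [r sr oe] := ip_proj m q.
have se : (size (q - r)%R <= m.+1)%N.
  by rewrite (leq_trans (size_polyD _ _)) // geq_max sq size_polyN ltnW.
have [e qr] : exists e, e = q - r by exists (q - r).
rewrite -qr in oe se; have -> : q = e + r by rewrite qr subrK.
exists e, r; split=> //; first by rewrite !ipDl !ipDr (ipC r e) !(oe r sr); ring.
rewrite -!energyE jacobi_opD (ipDl (A e)) !(ipDr e r) (jacobi_op_sym r e) (ipC r (A e)).
rewrite (orth_op oe sr); have h := oe _ (jacobi_op_lead se).
by move: h; rewrite ipBr ipZr (ipC e (A e)); lra.
Qed.

Hypothesis be_ge0 : 0 <= be.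

Lemma jacobi_eig_le k m : (k <= m)%N -> lam k <= lam m.
Proof.
move=> km; have h : (k%:R : R) <= m%:R by rewrite ler_nat.
have h0 := ler0n R k; rewrite -subr_ge0 /lam.
have -> : m%:R * (m%:R + 1 + be) - k%:R * (k%:R + 1 + be) =
  (m%:R - k%:R) * (m%:R + k%:R + 1 + be) by ring.
by apply: mulr_ge0; [lra | move: be_ge0; lra].
Qed.

Lemma jacobi_eig_ge0 k : 0 <= lam k.
Proof. by have := jacobi_eig_le (leq0n k); rewrite {1}/lam mul0r. Qed.

Lemma energy_le m q : (size q <= m.+1)%N -> B q q <= lam m * ip q q.
Proof.
elim: m q => [|m IH] q sq; have [e [r [-> sr oe -> ->]]] := energy_split sq.
  move: sr; rewrite leqn0 size_poly_eq0 => /eqP ->.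
  by rewrite /B deriv0 !mulr0 pint0 /ip !mulr0 pint0; lra.
have := IH _ sr; have := ip_ge0 e; have := ip_ge0 r.
have := jacobi_eig_le (leqnSn m); nra.
Qed.

Lemma energy_ge N q : orth N q -> lam N * ip q q <= B q q.
Proof.
elim: {q}(size q) {-2}q (leqnn (size q)) => [|m IH] q sq oq.
  move: sq; rewrite leqn0 size_poly_eq0 => /eqP ->.
  by rewrite /B deriv0 !mulr0 pint0 /ip !mulr0 pint0; lra.
have [mN|Nm] := ltnP m N.
  by rewrite oq ?mulr0 ?energy_ge0 // (leq_trans sq).
have [e [r [qer sr oe -> ->]]] := energy_split sq.
have or : orth N r.
  have -> : r = q - e by rewrite qer addrC addKr.
  by apply: orthB oq _; apply: orthW oe.
have := IH _ sr or; have := ip_ge0 e.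
have := jacobi_eig_le Nm; nra.
Qed.

(** [|A q|^2 = B(q, A q)], whose square is at most [B(q, q) lam m |A q|^2] by Cauchy-Schwarz for [B]
    and [energy_le] applied to [A q]. *)
Lemma op_norm_le m q : (size q <= m.+1)%N -> ip (A q) (A q) <= lam m * B q q.
Proof.
move=> sq; have sA := jacobi_op_size sq.
have hA : ip (A q) (A q) = B q (A q) by rewrite energyE.
have hB := energy_le sA.
have cs : B q (A q) ^+ 2 <= B q q * B (A q) (A q).
  rewrite /B -!(mulrA (W * _)) -!expr2 mulrA; apply: pint_CS lerN11 _ => x hx.
  by have := W_ge0 hx => ?; rewrite !hE mulr_ge0 //; nra.
have := ip_ge0 (A q); have := energy_ge0 q; have := energy_ge0 (A q).
move: hB cs; rewrite -hA; set a := ip _ _; set b := B q q; set c := B (A q) _.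
have := jacobi_eig_ge0 m; set l := lam m => l0 hB cs c0 b0 a0.
have [->|an0] := eqVneq a 0; first by rewrite mulr_ge0.
have : a * a <= (l * b) * a by nra.
by rewrite ler_pM2r // lt0r an0.
Qed.

(** The orthogonality is assumed of [A y], not of [y]. Removing from [y] its projection on degrees
    below [N] does not change the energy, and the rest [e] satisfies [lam N |e|^2 <= B(e, e)].
    Cauchy-Schwarz on [B(y, y) = ip (A y) e] concludes. *)
Lemma energy_orth_le N y : orth N (A y) -> lam N * B y y <= ip (A y) (A y).
Proof.
move=> oA; have [r sr oe] := ip_proj N y; pose e := y - r.
have Byr : B y r = 0 by rewrite -energyE oA.
have Ber : B e r = 0 by rewrite energyC -energyE ipC; apply: oe; apply: jacobi_op_size.
have Bee : B e e = B y y.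
  have Brr : B r r = 0.
    by move: Ber; rewrite /e -energyE jacobi_opB ipBl !energyE Byr; lra.
  rewrite /e -!energyE jacobi_opB !ipBl !ipBr !energyE Byr Brr (energyC r y) Byr; ring.
have h1 : B y y = ip (A y) e by rewrite /e ipBr !energyE Byr subr0.
have cs := ip_CS (A y) e; rewrite -h1 in cs.
have := energy_ge oe; rewrite -/e Bee => h2.
have := ip_ge0 e; have := ip_ge0 (A y); have := energy_ge0 y.
move: cs h2; have := jacobi_eig_ge0 N; set l := lam N.
set b := B y y; set c := ip e e; set a := ip (A y) _ => l0 cs h2 b0 a0 c0.
have [->|bn0] := eqVneq b 0; first by rewrite mulr0.
have : (l * b) * b <= a * b by nra.
by rewrite ler_pM2r // lt0r bn0.
Qed.

End Jacobi.

(** * Legendre polynomials *)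

Section Legendre.
Variable R : realType.
Implicit Types (p q r s t g : {poly R}).

Lemma derivn_XsubC_expM k c g :
  ((('X - c%:P) ^+ k * g)^`(k)).[c] = k`!%:R * g.[c].
Proof.
elim: k g => [|k IH] g; first by rewrite expr0 mul1r derivn0 fact0 mul1r.
rewrite derivSn derivM deriv_exp derivXsubC mul1r /=.
have -> : ('X - c%:P) ^+ k *+ k.+1 * g + ('X - c%:P) ^+ k.+1 * g^`() =
   ('X - c%:P) ^+ k * (g *+ k.+1 + ('X - c%:P) * g^`()).
  by rewrite exprS; ring.
rewrite IH hornerD hornerMn hornerM hornerXsubC subrr mul0r addr0 factS natrM.
by ring.
Qed.

Definition rodrigues N : {poly R} := ('X^2 - 1) ^+ N.

(** The derivative of order [k + 1] of [(X^2 - 1) f' = 2 N X f], where [f = (X^2 - 1)^N]; [k = N]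
    gives Legendre's equation. *)
Lemma rodrigues_ode N k :
  ('X^2 - 1) * (rodrigues N)^`(k.+2) =
  ((2 * N%:R - 2 * k.+1%:R)%:P * 'X) * (rodrigues N)^`(k.+1)
  + ((k%:R + 1) * (2 * N%:R - k%:R))%:P * (rodrigues N)^`(k).
Proof.
elim: k => [|k IH].
  rewrite derivn0 derivn1 derivSn derivn1 /rodrigues.
  have h : ('X^2 - 1) * (('X^2 - 1) ^+ N)^`() = (2 * N%:R)%:P * 'X * ('X^2 - 1 : {poly R}) ^+ N.
    case: N => [|N]; first by rewrite !expr0 derivC mulr0 mulr0 mul0r mul0r.
    rewrite deriv_exp derivB derivC derivXn subr0 /= [X in _ = _ * X]exprS expr1.
    set f := _ ^+ N.
    rewrite polyCM !rmorph_nat.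
    ring.
  move: (congr1 (@deriv R) h); rewrite !derivM !derivC mul0r add0r derivX.
  rewrite derivB derivC derivXn subr0 /= expr1.
  set f := (_ ^+ N)^`()^`(); set f1 := (_ ^+ N)^`(); set f0 := _ ^+ N => e.
  have -> : ('X^2 - 1) * f = 'X *+ 2 * f1 + ('X^2 - 1) * f - 'X *+ 2 * f1 by ring.
  by rewrite e !(polyCM, polyCB, polyCD, rmorph1, rmorph0, rmorph_nat, rmorphMn) /=; ring.
move: (congr1 (@deriv R) IH); rewrite !(derivM, derivD, derivB, derivC, derivX).
rewrite -!derivnS.
set f3 := _^`(k.+3); set f2 := _^`(k.+2); set f1 := _^`(k.+1) => e.
have d1 : (-1 : {poly R})^`() = 0 by rewrite derivN derivC oppr0.
rewrite d1 in e.
have -> : ('X^2 - 1) * f3 =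
  (1 * 'X + 'X * 1 + 0) * f2 + ('X^2 - 1) * f3 - 2%:R * 'X * f2 by ring.
rewrite e -!natr1 !(polyCM, polyCB, polyCD, rmorph1, rmorph_nat) /=; ring.
Qed.

Local Notation P N := (legendre R N).

Lemma legendre_const_neq0 N : (2 ^+ N * N`!%:R : R) != 0.
Proof. by rewrite mulf_neq0 ?expf_neq0 ?pnatr_eq0 -?lt0n ?fact_gt0. Qed.

Lemma derivZ_C c p : (c%:P * p)^`() = c%:P * p^`() :> {poly R}.
Proof. by rewrite derivM derivC mul0r add0r. Qed.

Lemma legendre_ode N :
  ((1 - 'X^2) * (P N)^`())^`() = - (N%:R * (N%:R + 1))%:P * P N.
Proof.
rewrite /legendre -mul_polyC derivZ_C -derivnS.
have := rodrigues_ode N N; rewrite -/(rodrigues N).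
set f := rodrigues N; set c := (_ ^-1)%:P => h.
have -> : ((1 - 'X^2) * (c * f^`(N.+1)))^`() =
   - c * (('X^2 - 1) * f^`(N.+2) + 2%:P * 'X * f^`(N.+1)).
  have d1 : (1 : {poly R})^`() = 0 by rewrite derivC.
  rewrite !(derivM, derivD, derivN, derivC, derivX, d1) -derivnS.
  by rewrite rmorph_nat; ring.
rewrite h -natr1 !(polyCM, polyCB, polyCD, rmorph1, rmorph_nat) /=; ring.
Qed.

Lemma legendre_1 N : (P N).[1] = 1.
Proof.
rewrite /legendre hornerZ.
have -> : ('X^2 - 1 : {poly R}) ^+ N = ('X - 1%:P) ^+ N * ('X + 1) ^+ N.
  by rewrite -exprMn; congr (_ ^+ _); rewrite rmorph1; ring.
rewrite derivn_XsubC_expM horner_exp hornerD hornerX hornerC.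
by rewrite (_ : 1 + 1 = 2) // mulrC [_ * 2 ^+ _]mulrC mulfV // legendre_const_neq0.
Qed.

Lemma derivn_compN p k : (p \Po (- 'X))^`(k) = ((-1) ^+ k)%:P * (p^`(k) \Po (- 'X)).
Proof.
elim: k => [|k IH]; first by rewrite !derivn0 expr0 mul1r.
rewrite !derivnS IH derivM derivC mul0r add0r deriv_comp derivN derivX exprS.
by rewrite polyCM polyCN; ring.
Qed.

Lemma legendre_parity N : P N \Po (- 'X) = ((-1) ^+ N)%:P * P N.
Proof.
rewrite /legendre linearZ /= -scalerAr; congr (_ *: _).
have := derivn_compN (('X^2 - 1) ^+ N) N.
have -> : (('X^2 - 1) ^+ N \Po (- 'X)) = ('X^2 - 1) ^+ N :> {poly R}.
  rewrite rmorphXn /= rmorphB /= rmorphXn /= comp_polyX.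
  by rewrite rmorph1 sqrrN.
move=> e; rewrite [in RHS]e mulrA -polyCM -exprMn mulrNN mulr1 expr1n mul1r //.
Qed.

Lemma legendre_m1 N : (P N).[-1] = (-1) ^+ N.
Proof.
have := congr1 (fun p => p.[1]) (legendre_parity N).
by rewrite /= horner_comp hornerM hornerC legendre_1 mulr1 hornerN hornerX.
Qed.

Lemma size_legendre N : (size (P N) <= N.+1)%N.
Proof.
rewrite /legendre (leq_trans (size_scale_leq _ _)) //.
have sz : forall k p, (size p^`(k) <= size p - k)%N.
  elim=> [|k IH] p; first by rewrite subn0.
  rewrite derivnS; have := IH p.
  have [->|n0] := eqVneq p^`(k) 0; first by rewrite deriv0 size_poly0.
  move=> h; rewrite subnS; have := leq_trans (lt_size_deriv n0) h.
  by case: (_ - _)%N.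
apply: leq_trans (sz _ _) _.
suff : (size (('X^2 - 1 : {poly R}) ^+ N) <= (2 * N).+1)%N.
  by move=> h; rewrite leq_subLR (leq_trans h) // mul2n -addnn addnS.
apply: leq_trans (size_poly_exp_leq _ _) _.
have : (size ('X^2 - 1 : {poly R})%R <= 3)%N.
  by rewrite (leq_trans (size_polyD _ _)) // geq_max size_polyXn size_polyN size_poly1.
by move=> h; rewrite ltnS leq_mul2r -subn1 leq_subLR h orbT.
Qed.

(** [P N] is an eigenvector of a symmetric operator for [N(N+1)], which differs from [m(m+1)] for
    [m < N]; triangularity turns this into orthogonality, one degree at a time. *)
Lemma legendre_orth N r : (size r <= N)%N -> pint (-1) 1 (P N * r) = 0.
Proof.
have W0 x : -1 <= x <= 1 -> 0 <= (1 : {poly R}).[x] by rewrite hornerC.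
have W1 : (1 : {poly R})^`() * (1 - 'X ^+ 2) = - (1 * (0%:P + 0%:P * 'X)).
  by rewrite derivC !rmorph0; ring.
have AP : jacobi_op 0 0 (P N) = (N%:R * (N%:R + 1))%:P * P N.
  have := deriv_energy W1 (P N); rewrite !mul1r legendre_ode mulNr.
  by move/oppr_inj.
suff h m : (m <= N)%N -> forall r, (size r <= m)%N -> ip 1 (P N) r = 0.
  by move=> sr; have := h N (leqnn N) r sr; rewrite /ip mul1r.
elim: m => [|m IH] mN {}r sr.
  by move: sr; rewrite leqn0 size_poly_eq0 => /eqP ->; rewrite /ip mulr0 pint0.
have := IH (ltnW mN) _ (jacobi_op_lead 0 0 sr).
rewrite ipBr ipZr -(jacobi_op_sym W1) AP ipZl -mulrBl => /eqP.
rewrite mulf_eq0 => /orP[|/eqP //].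
have mN' : (m%:R : R) + 1 <= N%:R by rewrite natr1 ler_nat.
have m0 := ler0n R m.
by rewrite /jacobi_eig; move/eqP; nra.
Qed.
End Legendre.

(** * Gauss-Lobatto nodes *)

Lemma pint_parts (R : rcfType) (a b : R) (f g : {poly R}) :
  pint a b (f * g^`()) = f.[b] * g.[b] - f.[a] * g.[a] - pint a b (f^`() * g).
Proof.
have := pint_deriv a b (f * g); rewrite derivM pintD !hE => h.
by rewrite -h; ring.
Qed.

Section Lobatto.
Variables (R : realType) (N : nat) (xi : N.+1.-tuple R).
Hypothesis N_gt0 : (0 < N)%N.
Hypothesis hxi : gauss_lobatto xi.
Implicit Types (p q r s t g : {poly R}) (i j : nat).

Local Notation P := (legendre R N).
Definition lobatto_poly : {poly R} := (1 - 'X^2) * P^`().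
Local Notation Phi := lobatto_poly.
Definition lobatto_eig : R := N%:R * (N%:R + 1).
Local Notation n := lobatto_eig.

Lemma N_ge1 : 1 <= N%:R :> R. Proof. by rewrite ler1n. Qed.

Lemma lobatto_eig_ge2 : 2 <= n.
Proof. by rewrite /n; have := N_ge1; nra. Qed.

Lemma lobatto_poly_deriv : Phi^`() = - (n%:P * P).
Proof. by rewrite /Phi legendre_ode -/n mulNr. Qed.

Lemma node_lt i j : (i < j)%N -> (j <= N)%N -> xi`_i < xi`_j.
Proof.
case: hxi => srt _ _ _ ij jN.
by apply: (sorted_ltn_nth lt_trans 0 srt); rewrite ?inE ?size_tuple ?ltnS // (leq_trans (ltnW ij)).
Qed.

Lemma node_le i j : (i <= j)%N -> (j <= N)%N -> xi`_i <= xi`_j.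
Proof.
rewrite leq_eqVlt => /predU1P[-> //|ij jN]; exact/ltW/node_lt.
Qed.

Lemma node0 : xi`_0 = -1. Proof. by case: hxi. Qed.
Lemma nodeN : xi`_N = 1. Proof. by case: hxi. Qed.

Lemma node_ge i : (i <= N)%N -> -1 <= xi`_i.
Proof. by rewrite -node0 => ?; apply: node_le. Qed.

Lemma node_le1 i : (i <= N)%N -> xi`_i <= 1.
Proof. by rewrite -nodeN => ?; apply: node_le. Qed.

Lemma node_gtm1 i : (0 < i <= N)%N -> -1 < xi`_i.
Proof. by case/andP=> ? ?; rewrite -node0; apply: node_lt. Qed.

Lemma node_lt1 i : (i < N)%N -> xi`_i < 1.
Proof. by move=> ?; rewrite -nodeN; apply: node_lt. Qed.

Lemma node_root i : (i <= N)%N -> Phi.[xi`_i] = 0.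
Proof.
move=> iN; case: hxi => _ _ _ /(_ xi`_i); rewrite mem_nth ?size_tuple ?ltnS //.
by move/esym/rootP.
Qed.

Lemma root_node x : Phi.[x] = 0 -> exists2 i, (i <= N)%N & x = xi`_i.
Proof.
move=> hx; case: hxi => _ _ _ /(_ x); move/rootP: hx; rewrite -/Phi => -> /nthP.
by move=> /(_ 0)[i]; rewrite size_tuple ltnS => iN <-; exists i.
Qed.

Lemma node_deriv_root i : (0 < i < N)%N -> P^`().[xi`_i] = 0.
Proof.
move=> /andP[i0 iN]; have := node_root (ltnW iN).
have h1 := node_lt1 iN; have h2 : -1 < xi`_i by apply: node_gtm1; rewrite i0 ltnW.
rewrite /Phi !hE => /eqP; rewrite mulf_eq0 => /orP[|/eqP //] /eqP; nra.
Qed.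

Lemma deriv_neq0_cell i x : (i < N)%N -> xi`_i < x < xi`_i.+1 -> P^`().[x] != 0.
Proof.
move=> iN /andP[ix xi1]; apply/eqP => h.
have [|j jN xj] := @root_node x; first by rewrite /Phi !hE h mulr0.
have [ji|ij] := leqP j i.
  by have := node_le ji (ltnW iN); rewrite -xj leNgt ix.
by have := node_le ij jN; rewrite -xj leNgt xi1.
Qed.

(* [P'] has no zero inside the cell, so the mean value theorem applied to
   [P' ((1 - X^2) psi'' + n psi)], the derivative of the Wronskian of
   [Phi] and [psi], locates a zero of the second factor. *)
Lemma wronskian_cell i psi : (i < N)%N -> psi.[xi`_i] = 0 -> psi.[xi`_i.+1] = 0 ->
  exists2 c, xi`_i < c < xi`_i.+1 &
    (1 - c ^+ 2) * psi^`()^`().[c] + n * psi.[c] = 0.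
Proof.
move=> iN pa pb; have lt_ab := node_lt (ltnSn i) iN.
pose F := P^`() * ((1 - 'X^2) * psi^`()^`() + n%:P * psi).
have dF : (Phi * psi^`() - Phi^`() * psi)^`() = F.
  rewrite derivB (derivM Phi) (derivM Phi^`()) lobatto_poly_deriv derivN derivZ_C.
  rewrite /F /Phi; ring.
have [c [cab]] := pint_mvt F lt_ab.
rewrite (pintE _ _ dF) !hornerD !hornerN !(hornerM Phi) !(hornerM Phi^`()) pa pb.
rewrite !node_root ?(ltnW iN) // !mul0r !mulr0 !subr0 => /esym/eqP.
rewrite mulf_eq0 subr_eq0 (gt_eqF lt_ab).
rewrite orbF hornerM mulf_eq0 (negPf (deriv_neq0_cell iN cab)) !hE /= => /eqP e.
by exists c.
Qed.

(** The test function [(x - a)(b - x)] has constant second derivative. As it is at most a quarter of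
    the squared width, the identity yields lower bounds on the width. *)
Lemma cell_mvt1 i : (i < N)%N -> exists2 c, xi`_i < c < xi`_i.+1 &
  n * ((c - xi`_i) * (xi`_i.+1 - c)) = 2 * (1 - c ^+ 2).
Proof.
move=> iN; pose psi : {poly R} := ('X - (xi`_i)%:P) * ((xi`_i.+1)%:P - 'X).
have [||c cab] := @wronskian_cell i psi iN; rewrite ?hE ?subrr ?mul0r ?mulr0 //.
have -> : psi^`()^`() = - (2%:P).
  by rewrite /psi !(derivM, derivB, derivD, derivN, derivC, derivX) rmorph_nat; ring.
rewrite !hE => e; exists c => //; nra.
Qed.

(** For the square of [t = (x - a)(b - x)] the Wronskian identity is a quadratic equation in [t],
    namely [n t^2 - 12 s t + 2 h^2 s = 0] with [s = 1 - c^2]. Having a real root, it has nonnegative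
    discriminant: this is the origin of [18]. *)
Lemma cell_mvt2 i : (i < N)%N -> exists2 c, xi`_i < c < xi`_i.+1 &
  (xi`_i.+1 - xi`_i) ^+ 2 * n <= 18 * (1 - c ^+ 2).
Proof.
move=> iN; pose t : {poly R} := ('X - (xi`_i)%:P) * ((xi`_i.+1)%:P - 'X).
have [||c cab] := @wronskian_cell i (t ^+ 2) iN.
- by rewrite !hE subrr !mul0r.
- by rewrite !hE subrr !mulr0.
have -> : (t ^+ 2)^`()^`() = 2%:P * ((xi`_i.+1)%:P - (xi`_i)%:P) ^+ 2 - 12%:P * t.
  rewrite /t expr2 !(derivM, derivB, derivD, derivN, derivC, derivX) !rmorph_nat; ring.
have c1 : 0 < 1 - c ^+ 2.
  have := node_ge (ltnW iN); have := node_le1 iN; move/andP: cab; nra.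
rewrite !hE -!expr2; set tc := _ * (_ - c); set h := xi`_i.+1 - xi`_i => e; exists c => //.
have n2 := lobatto_eig_ge2.
have sq : 0 <= (n * tc - 6 * (1 - c ^+ 2)) ^+ 2 by exact: sqr_ge0.
have e2 : 2 * h ^+ 2 * n * (1 - c ^+ 2) <= 36 * (1 - c ^+ 2) ^+ 2.
  have : ((1 - c ^+ 2) * (2 * h ^+ 2 - 12 * tc) + n * tc ^+ 2) * n = 0 by rewrite e mul0r.
  nra.
rewrite -(ler_pM2r c1); nra.
Qed.

Lemma last_cell_ge : 2 <= (1 - xi`_N.-1) * n.
Proof.
have NN : (N.-1 < N)%N by rewrite ltn_predL.
have [c] := cell_mvt1 NN; rewrite prednK // nodeN => /andP[ac c1] e.
have n2 := lobatto_eig_ge2; have [a0|a0] := lerP xi`_N.-1 0; first by nra.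
have c1' : 0 < 1 - c by rewrite subr_gt0.
have : n * (c - xi`_N.-1) = 2 * (1 + c).
  apply: (mulIf (lt0r_neq0 c1')).
  by rewrite -mulrA e; ring.
nra.
Qed.

Lemma last_cell_le : (1 - xi`_N.-1) * n <= 36.
Proof.
have NN : (N.-1 < N)%N by rewrite ltn_predL.
have [c] := cell_mvt2 NN; rewrite prednK // nodeN => /andP[ac c1] e.
have h0 : 0 < 1 - xi`_N.-1 by rewrite subr_gt0 node_lt1.
have m1 := node_ge (ltnW NN).
by rewrite -(ler_pM2l h0); nra.
Qed.

Lemma node_gap1 i : (i < N)%N -> 2 <= (1 - xi`_i) * n.
Proof.
move=> iN; have n2 := lobatto_eig_ge2; apply: le_trans last_cell_ge _.
by rewrite ler_pM2r ?lerD2l ?lerN2 ?node_le //; [lia | lia | lra].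
Qed.

Lemma node_gapm1 i : (0 < i <= N)%N -> 2 <= (1 + xi`_i) * n.
Proof.
move=> /andP[i0 iN]; have n2 := lobatto_eig_ge2.
apply: (@le_trans _ _ ((1 + xi`_1) * n)); last first.
  by rewrite ler_pM2r ?lerD2l ?node_le //; lra.
have [c] := cell_mvt1 N_gt0; rewrite node0 => /andP[ac c1] e.
have [b0|b0] := lerP 0 xi`_1; first by nra.
have c1' : 0 < 1 + c by lra.
have : n * (xi`_1 - c) = 2 * (1 - c).
  by apply: (mulIf (lt0r_neq0 c1')); move: e; nra.
nra.
Qed.

Lemma cell_ratio i : (i.+1 < N)%N -> 1 - xi`_i <= 20 * (1 - xi`_i.+1).
Proof.
move=> iN; have [c /andP[ac cb] e] := cell_mvt2 (ltnW iN).
have gap := node_gap1 iN; have n2 := lobatto_eig_ge2.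
have am1 := node_ge (ltnW (ltnW iN)).
move: ac cb e gap am1; set a := xi`_i; set b := xi`_i.+1 => ac cb e gap am1.
have b1 : 0 < 1 - b by rewrite subr_gt0 node_lt1.
have h1 : (b - a) ^+ 2 * n <= 36 * (1 - a) by nra.
(* With [r = (1 - a) / (1 - b)] this reads [(r - 1)^2 <= 18 r], so [r <= 10 + sqrt 99 < 20]. *)
have h2 : (b - a) ^+ 2 <= 18 * (1 - a) * (1 - b).
  have n0 : 0 < n by lra.
  rewrite -(ler_pM2r n0); apply: le_trans h1 _.
  have : 0 <= 18 * (1 - a) * ((1 - b) * n - 2) by apply: mulr_ge0; lra.
  nra.
have : 0 <= 1 - a by lra.
nra.
Qed.

Lemma cell_le i : (i.+1 < N)%N ->
  (xi`_i.+1 - xi`_i) ^+ 2 * n <= 360 * (1 - xi`_i.+1 ^+ 2).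
Proof.
move=> iN; have [c /andP[ac cb] e] := cell_mvt2 (ltnW iN).
have r := cell_ratio iN; have b1 := node_lt1 iN.
have am1 := node_ge (ltnW (ltnW iN)).
have : (1 - c) * (1 + c) <= (20 * (1 - xi`_i.+1)) * (1 + xi`_i.+1).
  by apply: ler_pM; lra.
by move: e; nra.
Qed.

(** The split compares [1 + x] at the two ends. If it at most doubles, [1 - c^2] is at least half of
    [1 - b^2]. Otherwise, in particular on the first cell where [1 + a = 0], the width exceeds half
    of [1 + b], and the factor [1 + c] is cancelled by means of [c - a <= 1 + c]. *)
Lemma cell_ge i : (i.+1 < N)%N ->
  1 - xi`_i.+1 ^+ 2 <= (xi`_i.+1 - xi`_i) ^+ 2 * n.
Proof.
move=> iN; have [c /andP[ac cb] e] := cell_mvt1 (ltnW iN).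
have am1 := node_ge (ltnW (ltnW iN)); have b1 := node_lt1 iN.
have n2 := lobatto_eig_ge2.
move: ac cb e am1 b1; set a := xi`_i; set b := xi`_i.+1 => ac cb e am1 b1.
have [ab|ab] := lerP (1 + b) (2 * (1 + a)).
  have h1 : (b - a) ^+ 2 * n >= 4 * (n * ((c - a) * (b - c))).
    have : 0 <= n * ((b - c) - (c - a)) ^+ 2 by apply: mulr_ge0; [lra|exact: sqr_ge0].
    nra.
  apply: le_trans h1; rewrite e.
  have : (1 - b) * ((1 + b) / 2) <= (1 - c) * (1 + c) by apply: ler_pM; lra.
  nra.
have c1 : 0 < 1 + c by lra.
have h1 : 2 * (1 - c) <= n * (b - c).
  rewrite -(ler_pM2r c1).
  have : n * (b - c) * (c - a) <= n * (b - c) * (1 + c).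
    by apply: ler_wpM2l; [apply: mulr_ge0; lra | lra].
  nra.
have h2 : 2 * (1 - b) <= n * (b - a) by nra.
have : 0 <= (n * (b - a) - 2 * (1 - b)) * (b - a) by apply: mulr_ge0; lra.
have : 0 <= (1 - b) * (2 * (b - a) - (1 + b)) by apply: mulr_ge0; lra.
nra.
Qed.

Lemma deriv_legendre_opp x : P^`().[- x] = 0 -> P^`().[x] = 0.
Proof.
move=> h; have := congr1 (fun p => p^`().[x]) (legendre_parity R N).
rewrite /= deriv_comp derivN derivX derivZ_C !hE horner_comp hornerN hornerX h mul0r.
by move=> /esym/eqP; rewrite mulf_eq0 signr_eq0 => /eqP.
Qed.

(** The nodes are symmetric: the opposite of a negative last interior node would be a node strictly
    between it and [1]. *)
Lemma last_node_ge0 : (1 < N)%N -> 0 <= xi`_N.-1.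
Proof.
move=> N1; rewrite leNgt; apply/negP => a0.
have h : (0 < N.-1 < N)%N by lia.
have d0 : P^`().[- xi`_N.-1] = 0.
  by apply: deriv_legendre_opp; rewrite opprK node_deriv_root.
have [|j jN xj] := @root_node (- xi`_N.-1); first by rewrite /Phi !hE d0 mulr0.
have [jN1|] := leqP j N.-1.
  by have := node_le jN1 (leq_pred N); rewrite -xj; lra.
rewrite prednK // => Nj; have jN' : j = N by lia.
have : -1 < xi`_N.-1 by apply: node_gtm1; lia.
by move: xj; rewrite jN' nodeN; lra.
Qed.

End Lobatto.

(** * Sonin's bound *)

Section Ratio.
Import numFieldNormedType.Exports.

Lemma poly_ratio_nincr (R : realType) (f g : {poly R}) (x y : R) : x <= y ->
  (forall z, x <= z <= y -> 0 < g.[z]) ->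
  (forall z, x < z < y -> f^`().[z] * g.[z] - f.[z] * g^`().[z] <= 0) ->
  f.[y] * g.[x] <= f.[x] * g.[y].
Proof.
rewrite le_eqVlt => /predU1P[-> //|xy] g0 fg.
have gx : 0 < g.[x] by apply: g0; rewrite lexx ltW.
have gy : 0 < g.[y] by apply: g0; rewrite lexx ltW.
pose h z := f.[z] / g.[z].
pose dh z := (f^`().[z] * g.[z] - f.[z] * g^`().[z]) / g.[z] ^+ 2.
have dH z : x <= z <= y -> is_derive z 1 h (dh z).
  move=> /g0 gz; have gz0 : g.[z] != 0 by rewrite gt_eqF.
  have df : is_derive z 1 (horner f) f^`().[z].
    by rewrite derivE derive1E; apply/derivableP/derivable_horner.
  have dg : is_derive z 1 (horner g) g^`().[z].
    by rewrite derivE derive1E; apply/derivableP/derivable_horner.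
  have dgi : is_derive z 1 (fun t => (horner g t)^-1) (- (g.[z] ^- 2) *: g^`().[z]).
    exact: is_deriveV.
  have dhz : is_derive z 1 h _ := is_deriveM df dgi.
  apply: is_derive_eq dhz _.
  by rewrite /dh /GRing.scale /=; field.
have [||c cxy] := @MVT _ h dh x y xy.
- by move=> z; rewrite in_itv /= => /andP[xz zy]; apply: dH; rewrite !ltW.
- apply: derivable_within_continuous => z; rewrite in_itv /= => /dH.
  by case.
move: cxy; rewrite in_itv /= => cxy e.
have : h y <= h x.
  rewrite -subr_le0 e; apply: mulr_le0_ge0; last by rewrite subr_ge0 ltW.
  by rewrite /dh ler_pdivrMr ?mul0r ?fg // exprn_gt0 // g0 //; move/andP: cxy; lra.
by rewrite /h ler_pdivrMr // mulrAC ler_pdivlMr // mulrC [X in _ <= X]mulrC.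
Qed.

End Ratio.

Section Sonin.
Variables (R : realType) (P : {poly R}) (n : R).
Hypothesis n_ge2 : 2 <= n.
Hypothesis ode : ((1 - 'X^2) * P^`())^`() = - (n%:P * P).
Hypothesis P1 : P.[1] ^+ 2 = 1.

Let n_gt0 : 0 < n. Proof. exact: lt_le_trans n_ge2. Qed.

Lemma ode_expanded : (1 - 'X^2) * P^`()^`() = 2%:P * 'X * P^`() - n%:P * P.
Proof.
have d1 : (1 : {poly R})^`() = 0 by rewrite derivC.
move: ode; rewrite !(derivM, derivB, derivX, d1) => e.
have -> : (1 - 'X^2) * P^`()^`() =
    (0 - (1 * 'X + 'X * 1)) * P^`() + (1 - 'X * 'X) * (P^`())^`() + 2%:P * 'X * P^`().
  by rewrite rmorph_nat; ring.
by rewrite e; ring.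
Qed.

(** [E = n P^2 + (1 - x^2) P'^2] has derivative [2 x P'^2], so on [[0, 1]] it is at most
    [E(1) = n]. *)
Lemma sqr_le1_right x : 0 <= x <= 1 -> P.[x] ^+ 2 <= 1.
Proof.
move=> /andP[x0]; rewrite le_eqVlt => /predU1P[-> |x1]; first by rewrite P1.
pose E := n%:P * P ^+ 2 + (1 - 'X^2) * P^`() ^+ 2.
have dE : E^`() = 2%:P * 'X * P^`() ^+ 2.
  have d1 : (1 : {poly R})^`() = 0 by rewrite derivC.
  rewrite /E !expr2 !(derivM, derivB, derivD, derivX, derivC, d1).
  have -> : (1 - 'X * 'X) * (P^`()^`() * P^`() + P^`() * P^`()^`()) =
     2%:P * P^`() * ((1 - 'X^2) * P^`()^`()) by rewrite rmorph_nat; ring.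
  by rewrite ode_expanded rmorph_nat; ring.
have [c] := poly_mvt E x1; rewrite in_itv /= => /andP[xc c1].
rewrite dE /E !hE -!expr2 P1 => e.
have : 0 <= 2 * c * P^`().[c] ^+ 2 * (1 - x).
  by apply: mulr_ge0; [apply: mulr_ge0; [lra|exact: sqr_ge0]|lra].
rewrite -e => e2; rewrite -(ler_pM2l n_gt0).
have : 0 <= (1 - x ^+ 2) * P^`().[x] ^+ 2 by apply: mulr_ge0; [nra|exact: sqr_ge0].
nra.
Qed.

Lemma deriv_sqr_le_right x : 0 <= x < 1 -> P^`().[x] ^+ 2 <= n ^+ 2.
Proof.
move=> /andP[x0 x1]; have [c] := poly_mvt ((1 - 'X^2) * P^`()) x1.
rewrite in_itv /= ode => /andP[xc c1]; rewrite !hE => e.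
have c2 : P.[c] ^+ 2 <= 1 by apply: sqr_le1_right; lra.
have {}e : (1 + x) * P^`().[x] = n * P.[c].
  have x1' : 1 - x != 0 by rewrite subr_eq0 gt_eqF.
  by apply: (mulIf x1'); move: e; nra.
have : ((1 + x) * P^`().[x]) ^+ 2 <= n ^+ 2.
  rewrite e exprMn; have : 0 <= n ^+ 2 * (1 - P.[c] ^+ 2).
    by apply: mulr_ge0; [exact: sqr_ge0|lra].
  nra.
have := sqr_ge0 P^`().[x]; nra.
Qed.

(** Since [|P'| <= n] on [[0, 1[], over a distance [1 / (2 n)] the value of [P] moves by at most
    [1 / 2] from [P(1)], which is [1] or [-1]. This point serves as reference for Sonin's function
    instead of [1], where the factor [1 - x^2] vanishes. *)
Lemma sqr_ge_near_right : 4^-1 <= P.[1 - (2 * n)^-1] ^+ 2.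
Proof.
have n2 := n_ge2.
set y := 1 - _.
have d0 : 0 < (2 * n)^-1 by rewrite invr_gt0; lra.
have dn : (2 * n)^-1 * n = 2^-1 by field; lra.
have y0 : 0 <= y by rewrite /y; nra.
have y1 : y < 1 by rewrite /y; lra.
have [c] := poly_mvt P y1; rewrite in_itv /= => /andP[yc c1] e.
have hc : P^`().[c] ^+ 2 <= n ^+ 2 by apply: deriv_sqr_le_right; lra.
have {}e : (P.[1] - P.[y]) ^+ 2 <= 4^-1.
  rewrite e (_ : 1 - y = (2 * n)^-1); last by rewrite /y; ring.
  rewrite exprMn; have : 0 <= (n ^+ 2 - P^`().[c] ^+ 2) * (2 * n)^-1 ^+ 2.
    by apply: mulr_ge0; [lra|exact: sqr_ge0].
  have : n ^+ 2 * (2 * n)^-1 ^+ 2 = 4^-1 by field; lra.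
  lra.
have /eqP : (P.[1] - 1) * (P.[1] + 1) = 0.
  by transitivity (P.[1] ^+ 2 - 1); [ring | rewrite P1 subrr].
rewrite mulf_eq0 => /orP[] /eqP h.
  have Py : 2^-1 <= P.[y].
    have p1 : P.[1] = 1 by lra.
    by rewrite leNgt; apply/negP => lt; rewrite p1 in e; nra.
  nra.
have Py : P.[y] <= - 2^-1.
  have p1 : P.[1] = -1 by lra.
  by rewrite leNgt; apply/negP => lt; rewrite p1 in e; nra.
nra.
Qed.

(* Sonin's function for [v = (sin theta)^(1/2) P(cos theta)], which satisfies
   [v'' + phi v = 0] with [phi = n + 1/4 + 1 / (4 sin^2 theta)]:
   [(v^2 + v'^2 / phi)^2 = (1 - x^2) a^2 / d^2]. *)
Let K := n%:P * P ^+ 2 - 'X * P * P^`() + (1 - 'X^2) * P^`() ^+ 2.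
Let a := (1 - 'X^2) * K + (2^-1)%:P * P ^+ 2.
Let d := (n + 4^-1)%:P * (1 - 'X^2) + (4^-1)%:P.

Lemma sonin_deriv : a^`() = - 'X * K.
Proof.
have n2 := n_ge2.
have d1 : (1 : {poly R})^`() = 0 by rewrite derivC.
rewrite /a /K !expr2 !(derivM, derivB, derivD, derivX, derivC, d1).
have h2 : (2^-1)%:P * 2%:R = 1 :> {poly R}.
  by rewrite -(rmorph_nat polyC) -polyCM mulVf // pnatr_eq0.
set P2 := P^`()^`(); set Q := P^`().
have e : (1 - 'X * 'X) * P2 = 2%:R * 'X * Q - n%:P * P.
  by have := ode_expanded; rewrite expr2 rmorph_nat.
set h := (2^-1)%:P in h2 *; set N := n%:P in e *.
transitivity (- 'X * (N * (P * P) - 'X * P * Q + (1 - 'X * 'X) * (Q * Q))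
   + ((1 - 'X * 'X) * P2 - (2%:R * 'X * Q - N * P)) * (2%:R * (1 - 'X * 'X) * Q - 'X * P)
   + (h * 2%:R - 1) * P * Q); last by rewrite e h2 !subrr !mul0r !addr0.
ring.
Qed.

(** The difference is [sin theta * v'^2] in the variables of Sonin's function. *)
Lemma sonin_ge x : P.[x] ^+ 2 * d.[x] <= a.[x].
Proof.
have := sqr_ge0 ((1 - x ^+ 2) * P^`().[x] - x * P.[x] / 2).
rewrite -(subr_ge0 (_ * _)); congr (0 <= _).
by rewrite /a /d /K !hE; field.
Qed.

Lemma sonin_d_gt0 x : 0 <= x <= 1 -> 0 < d.[x].
Proof.
have n2 := n_ge2.
move=> /andP[x0 x1]; rewrite /d !hE.
have : 0 <= (n + 4^-1) * (1 - x * x) by apply: mulr_ge0; [lra|nra].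
lra.
Qed.

(** Sonin's function is nonincreasing in [x] on [[0, 1[]. At [y = 1 - 1 / (2 n)] its square is at
    least [(1 - y^2) P(y)^4]; at the critical point [x] it is at most [4 (1 - x^2) P(x)^4]. Then
    [128 = 4 * 2 * 16], from [1 - y^2 >= 1 / (2 n)] and [P(y)^4 >= 1 / 16]. *)
Lemma sonin_bound x : 0 <= x <= 1 - (2 * n)^-1 -> P^`().[x] = 0 ->
  1 <= 128 * n * (1 - x ^+ 2) * P.[x] ^+ 4.
Proof.
have n2 := n_ge2.
have d0 : 0 < (2 * n)^-1 by rewrite invr_gt0; lra.
have dn : (2 * n)^-1 * n = 2^-1 by field; lra.
have := sqr_ge_near_right; set y := 1 - _ => Py /andP[x0 xy] Px.
have y1 : y < 1 by rewrite /y; lra.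
have d1 : (1 : {poly R})^`() = 0 by rewrite derivC.
have sq0 z : 0 <= z <= 1 -> 0 < (d ^+ 2).[z].
  by move=> /sonin_d_gt0 ?; rewrite horner_exp exprn_gt0.
have mono : ((1 - 'X^2) * a ^+ 2).[y] * (d ^+ 2).[x] <=
            ((1 - 'X^2) * a ^+ 2).[x] * (d ^+ 2).[y].
  apply: poly_ratio_nincr => // [z /andP[xz zy]|z /andP[xz zy]].
    by apply: sq0; lra.
  have dz : 0 < d.[z] by apply: sonin_d_gt0; lra.
  have az := sonin_ge z.
  have az0 : 0 <= a.[z] by apply: le_trans az; rewrite mulr_ge0 ?sqr_ge0 // ltW.
  have gen1 (p : {poly R}) : ((1 - 'X^2) * p ^+ 2)^`().[z] =
      - (2 * z) * p.[z] ^+ 2 + (1 - z ^+ 2) * (2 * p.[z] * p^`().[z]).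
    by rewrite !expr2 !(derivM, derivB, derivX, d1) !hE ?horner0; ring.
  have gen2 (p : {poly R}) : (p ^+ 2)^`().[z] = 2 * p.[z] * p^`().[z].
    by rewrite !expr2 !derivM !hE; ring.
  have gen3 (p : {poly R}) : ((1 - 'X^2) * p ^+ 2).[z] = (1 - z ^+ 2) * p.[z] ^+ 2.
    by rewrite !hE; ring.
  have dd : d^`().[z] = - (2 * (n + 4^-1) * z).
    by rewrite /d expr2 !(derivM, derivB, derivD, derivX, derivC, d1) !hE ?horner0; ring.
  have da : a^`().[z] = - z * K.[z] by rewrite sonin_deriv hornerM hornerN hornerX.
  have aK : a.[z] = (1 - z ^+ 2) * K.[z] + 2^-1 * P.[z] ^+ 2 by rewrite /a !hE; ring.
  have dE : d.[z] = (n + 4^-1) * (1 - z ^+ 2) + 4^-1 by rewrite /d !hE; ring.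
  rewrite gen1 gen2 gen3 horner_exp dd da.
  move: az az0 dz aK dE; move: a.[z] d.[z] K.[z] P.[z] => A D k p az az0 dz aK dE.
  have -> : (- (2 * z) * A ^+ 2 + (1 - z ^+ 2) * (2 * A * (- z * k))) * D ^+ 2 -
    (1 - z ^+ 2) * A ^+ 2 * (2 * D * - (2 * (n + 4^-1) * z)) =
    - (z * A * D * (A - p ^+ 2 * D)).
    have -> : (1 - z ^+ 2) * (2 * A * (- z * k)) = - (2 * z * A * (A - 2^-1 * p ^+ 2)).
      by rewrite aK; ring.
    have -> : (1 - z ^+ 2) * A ^+ 2 * (2 * D * - (2 * (n + 4^-1) * z)) =
       - (4 * z * A ^+ 2 * D * (D - 4^-1)) by rewrite dE; ring.
    by field.
  by rewrite oppr_le0 !mulr_ge0 ?(ltW dz) ?subr_ge0 //; lra.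
have Px2 : a.[x] <= 2 * P.[x] ^+ 2 * d.[x].
  rewrite /a /d /K !hE Px; have := sqr_ge0 P.[x].
  have -> : 2 * P.[x] ^+ 2 * ((n + 4^-1) * (1 - x ^+ 2) + 4^-1) =
    (1 - x ^+ 2) * n * P.[x] ^+ 2 + 2^-1 * P.[x] ^+ 2
    + (1 - x ^+ 2) * (n + 2^-1) * P.[x] ^+ 2 by field.
  have x2 : 0 <= (1 - x ^+ 2) * (n + 2^-1) * P.[x] ^+ 2.
    by apply: mulr_ge0 (sqr_ge0 _); apply: mulr_ge0; [nra | lra].
  by move: x2; lra.
have y0 : 0 <= y by rewrite (le_trans x0).
have dx : 0 < d.[x] by apply: sonin_d_gt0; lra.
have dy : 0 < d.[y] by apply: sonin_d_gt0; lra.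
have ax0 : 0 <= a.[x].
  by apply: le_trans (sonin_ge x); rewrite mulr_ge0 ?sqr_ge0 // ltW.
have gen3 (p : {poly R}) z : ((1 - 'X^2) * p ^+ 2).[z] = (1 - z ^+ 2) * p.[z] ^+ 2.
  by rewrite !hE; ring.
move: mono (sonin_ge y); rewrite !gen3 !horner_exp => mono ay.
have h1 : (P.[y] ^+ 2 * d.[y]) ^+ 2 <= a.[y] ^+ 2.
  rewrite ler_pXn2r // ?nnegrE ?(le_trans _ ay) // mulr_ge0 ?sqr_ge0 //; exact: ltW.
have h2 : a.[x] ^+ 2 <= (2 * P.[x] ^+ 2 * d.[x]) ^+ 2.
  by rewrite ler_pXn2r // ?nnegrE ?(le_trans _ Px2).
have Sx : 0 <= 1 - x ^+ 2 by nra.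
have Sy : (2 * n)^-1 <= 1 - y ^+ 2 by rewrite /y in y0 y1 *; nra.
have h3 : (1 - y ^+ 2) * (P.[y] ^+ 2 * d.[y]) ^+ 2 * d.[x] ^+ 2 <=
   (1 - x ^+ 2) * (2 * P.[x] ^+ 2 * d.[x]) ^+ 2 * d.[y] ^+ 2.
  apply: (@le_trans _ _ ((1 - y ^+ 2) * a.[y] ^+ 2 * d.[x] ^+ 2)).
    by rewrite ler_wpM2r ?sqr_ge0 // ler_wpM2l //; lra.
  by apply: (le_trans mono); rewrite ler_wpM2r ?sqr_ge0 // ler_wpM2l.
have {}h3 : (1 - y ^+ 2) * P.[y] ^+ 4 <= 4 * (1 - x ^+ 2) * P.[x] ^+ 4.
  have dxy : 0 < d.[x] ^+ 2 * d.[y] ^+ 2 by rewrite mulr_gt0 ?exprn_gt0.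
  by rewrite -(ler_pM2r dxy); move: h3; rewrite !expr2 => h3; apply: le_trans (le_trans _ h3) _;
    rewrite le_eqVlt; apply/orP; left; apply/eqP; ring.
have h4 : (2 * n)^-1 * (4^-1) ^+ 2 <= (1 - y ^+ 2) * P.[y] ^+ 4.
  apply: ler_pM; rewrite ?sqr_ge0 //; first exact: ltW.
  by rewrite (_ : 4 = 2 * 2)%N // exprM ler_pXn2r // nnegrE ?sqr_ge0 ?invr_ge0.
have := le_trans h4 h3 => h5.
have := ler_wpM2l (ltW n_gt0) h5.
have -> : n * ((2 * n)^-1 * 4^-1 ^+ 2) = 32^-1 by field; lra.
nra.
Qed.
End Sonin.

(** * Gauss-Lobatto quadrature *)

Lemma size_mul_lt (R : idomainType) (p q : {poly R}) a b :
  (size p <= a.+1)%N -> (size q <= b)%N -> (size (p * q)%R <= a + b)%N.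
Proof.
move=> sp sq; apply: leq_trans (size_polyMleq _ _) _.
by rewrite -subn1 leq_subLR; lia.
Qed.

Section Quadrature.
Variables (R : realType) (N : nat) (xi : N.+1.-tuple R).
Hypothesis N_gt0 : (0 < N)%N.
Hypothesis hxi : gauss_lobatto xi.
Implicit Types (p q r s t g F : {poly R}) (i j : nat).

Local Notation P := (legendre R N).
Local Notation Phi := (lobatto_poly R N).
Local Notation n := (lobatto_eig R N).
Local Notation I2 := (pint (-1) 1 (P * P)).

Lemma legendre_euler_size : (size ('X * P^`() - (N%:R)%:P * P)%R <= N)%N.
Proof.
apply/leq_sizeP => j Nj; rewrite coefB coefXM coefCM coef_deriv.
case: j Nj => [|j] Nj /=; first by lia.
have [<-|Nj'] := eqVneq N j.+1; first by rewrite -[_ *+ _]mulr_natl subrr.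
by rewrite !nth_default ?mul0rn ?mulr0 ?subr0 // (leq_trans (size_legendre R N)) // ltn_neqAle Nj'.
Qed.

Lemma pint_legendre_sqr : (2 * N%:R + 1) * I2 = 2.
Proof.
have h := legendre_orth legendre_euler_size.
have h2 := pint_parts (-1) 1 ('X * P) P.
rewrite derivM derivX mul1r in h2.
have e1 : P * ('X * P^`() - (N%:R)%:P * P) = 'X * P * P^`() - (N%:R)%:P * (P * P) by ring.
have e2 : (P + 'X * P^`()) * P = P * P + 'X * P * P^`() by ring.
rewrite e1 pintB pintZ in h; rewrite e2 pintD !hE legendre_1 legendre_m1 in h2.
have s2 : (-1) ^+ N * (-1) ^+ N = 1 :> R by rewrite -expr2 sqrr_sign.
move: h2; rewrite -!mulrA s2 !mulrA !mulr1 => h2; lra.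
Qed.

Lemma size_deriv_legendre : (size P^`() <= N)%N.
Proof.
apply/leq_sizeP => j Nj; rewrite coef_deriv nth_default ?mul0rn //.
by apply: leq_trans (size_legendre R N) _; rewrite ltnS.
Qed.

Lemma lobatto_poly_neq0 : Phi != 0.
Proof.
apply/eqP => Phi0; have := lobatto_poly_deriv R N; rewrite Phi0 deriv0.
move/(congr1 (fun p => p.[1])); rewrite !hE legendre_1.
by have := lobatto_eig_ge2 R N_gt0; lra.
Qed.

Lemma node_uniq : uniq xi.
Proof. by case: hxi => srt _ _ _; apply: (sorted_uniq lt_trans ltxx). Qed.

Lemma poly_node_eq0 F : (size F <= N.+1)%N ->
  (forall i, (i <= N)%N -> F.[xi`_i] = 0) -> F = 0.
Proof.
move=> sF hF; apply/eqP/negPn/negP => F0.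
have := max_poly_roots F0 _ node_uniq; rewrite size_tuple ltnNge sF => /(_ _)/negP.
case=> //; apply/allP => x /(nthP 0)[i]; rewrite size_tuple ltnS => iN <-.
by apply/rootP/hF.
Qed.

Lemma size_lobatto_poly : size Phi = N.+2.
Proof.
apply/eqP; rewrite eqn_leq; apply/andP; split.
  rewrite /lobatto_poly; apply: (@size_mul_lt _ _ _ 2 N) size_deriv_legendre.
  by rewrite (leq_trans (size_polyD _ _)) // geq_max size_polyN size_polyXn size_poly1.
rewrite ltnNge; apply/negP => /poly_node_eq0 h.
by have := lobatto_poly_neq0; rewrite h ?eqxx // => i iN; apply: node_root.
Qed.

(** The Lagrange basis polynomial of the nodes, left unnormalised; the division by its value at
    [xi_i] takes place in [om]. *)
Definition lobatto_fun i : {poly R} := Phi %/ ('X - (xi`_i)%:P).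
Local Notation L := lobatto_fun.

Lemma lobatto_funE i : (i <= N)%N -> Phi = L i * ('X - (xi`_i)%:P).
Proof. by move=> iN; rewrite divpK // dvdp_XsubCl; apply/rootP/node_root. Qed.

Lemma size_lobatto_fun i : size (L i) = N.+1.
Proof. by rewrite /L size_divp ?polyXsubC_eq0 // size_XsubC size_lobatto_poly subn1. Qed.

Lemma lobatto_fun_neq i j : (i <= N)%N -> (j <= N)%N -> j != i -> (L i).[xi`_j] = 0.
Proof.
move=> iN jN ij; have := node_root hxi jN; rewrite (lobatto_funE iN) hornerM hornerXsubC.
move/eqP; rewrite mulf_eq0 subr_eq0 nth_uniq ?size_tuple ?node_uniq // (negPf ij) orbF.
by move/eqP.
Qed.

Lemma lobatto_fun_eq i : (i <= N)%N -> (L i).[xi`_i] = - (n * P.[xi`_i]).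
Proof.
move=> iN; have := lobatto_poly_deriv R N.
rewrite {1}(lobatto_funE iN) derivM derivXsubC mulr1.
move/(congr1 (fun p => p.[xi`_i])); rewrite hornerD hornerM hornerXsubC subrr mulr0 add0r => ->.
by rewrite !hE.
Qed.

Lemma lobatto_fun_neq0 i : (i <= N)%N -> (L i).[xi`_i] != 0.
Proof.
move=> iN; apply/eqP => Li0; have := size_lobatto_fun i.
rewrite (@poly_node_eq0 (L i)) ?size_poly0 ?size_lobatto_fun // => j jN.
by have [->//|ji] := eqVneq j i; apply: lobatto_fun_neq.
Qed.

Let om i := pint (-1) 1 (L i) / (L i).[xi`_i].

Lemma interp_quadrature F : (size F <= 2 * N)%N ->
  pint (-1) 1 F = \sum_(0 <= i < N.+1) om i * F.[xi`_i].
Proof.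
move=> sF; rewrite (divp_eq F Phi).
set q := F %/ Phi; set r := F %% Phi.
have sr : (size r <= N.+1)%N by rewrite -ltnS -size_lobatto_poly ltn_modp lobatto_poly_neq0.
have sq : (size q < N)%N.
  rewrite /q size_divp ?lobatto_poly_neq0 // size_lobatto_poly (leq_ltn_trans (leq_sub2r _ sF)) //=.
  by move: N_gt0; lia.
(* [Phi] vanishes at both ends and [Phi' = - n P]: integration by parts leaves [P] against a
   primitive of [q], which has degree below [N]. *)
have qPhi : pint (-1) 1 (q * Phi) = 0.
  have := pint_parts (-1) 1 Phi (prim q); rewrite deriv_prim mulrC => ->.
  rewrite lobatto_poly_deriv mulNr -mulrA pintN pintZ legendre_orth; last first.
    exact: leq_trans (size_prim q) sq.
  by rewrite /lobatto_poly !hE; ring.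
have rE : r = \sum_(0 <= i < N.+1) (r.[xi`_i] / (L i).[xi`_i])%:P * L i.
  apply/eqP; rewrite -subr_eq0; apply/eqP; apply: poly_node_eq0 => [|j jN].
    rewrite (leq_trans (size_polyD _ _)) // geq_max sr size_polyN.
    apply: (leq_trans (size_sum _ _ _)); apply/bigmax_leqP_seq => i _ _.
    by rewrite mul_polyC (leq_trans (size_scale_leq _ _)) // size_lobatto_fun.
  rewrite hornerD hornerN horner_sum (bigD1_seq j) ?iota_uniq ?mem_index_iota //=.
  rewrite big1_seq ?addr0 => [|i /andP[ij]].
    by rewrite hornerM hornerC divfK ?subrr // lobatto_fun_neq0.
  rewrite mem_index_iota ltnS => iN.
  have h : (L i).[xi`_j] = 0 by apply: lobatto_fun_neq; rewrite // eq_sym.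
  by rewrite hornerM h mulr0.
rewrite pintD qPhi add0r {1}rE pint_sum !big_nat; apply: eq_bigr => i iN.
rewrite pintZ hornerD hornerM node_root // mulr0 add0r /om; ring.
Qed.

Lemma quadrature_weight i : (i <= N)%N -> om i * (n * P.[xi`_i] ^+ 2) = 2.
Proof.
move=> iN; have N1 := N_ge1 R N_gt0.
(* The leading terms of the two products cancel, so [F] has degree at most
   [2 N - 1], and it vanishes at every node except [xi_i]. *)
pose F := P * L i - (N%:R^-1)%:P * (Phi * P^`()).
have cL : (L i)`_N = - (P`_N *+ N).
  have e1 : Phi`_N.+1 = (L i)`_N.
    have z : (L i)`_N.+1 = 0 by rewrite nth_default // size_lobatto_fun.
    rewrite (lobatto_funE iN) mulrBr coefB coefMX /= [_ * _%:P]mulrC coefCM.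
    by rewrite z mulr0 subr0.
  rewrite -e1 /lobatto_poly mulrBl mul1r coefB coefXnM !coef_deriv.
  have z : P`_N.+2 = 0 by rewrite nth_default // (leq_trans (size_legendre R N)).
  rewrite z mul0rn.
  have -> : (N.+1 < 2)%N = false by move: N_gt0; lia.
  by rewrite sub0r subn2 /= prednK.
have sL0 : (size (L i + (N%:R)%:P * P)%R <= N)%N.
  apply/leq_sizeP => j Nj; rewrite coefD coefCM.
  have [<-|Nj'] := eqVneq N j; first by rewrite cL -[P`_N *+ N]mulr_natl addNr.
  have Nj2 : (N < j)%N by rewrite ltn_neqAle Nj'.
  by rewrite !nth_default ?mulr0 ?addr0 // ?size_lobatto_fun // (leq_trans (size_legendre R N)).
have sT := legendre_euler_size.
set L0 := L i + _ in sL0; set T := 'X * _ - _ in sT.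
have FE : F = P * (L0 + T) + (N%:R^-1)%:P * ('X * T * P^`()) - (N%:R^-1)%:P * (P^`() * P^`()).
  have NN : (N%:R^-1)%:P * (N%:R)%:P = 1 :> {poly R} by rewrite -polyCM mulVf //; lra.
  rewrite /F /L0 /T /lobatto_poly.
  transitivity (P * L i - (N%:R^-1)%:P * ((1 - 'X^2) * P^`() * P^`())
    + (1 - (N%:R^-1)%:P * (N%:R)%:P) * ('X * P^`() * P)); last by ring.
  by rewrite NN subrr mul0r addr0.
have sP' := size_deriv_legendre.
have sF : (size F <= 2 * N)%N.
  rewrite FE mul2n -addnn !(leq_trans (size_polyD _ _)) // geq_max; apply/andP; split.
    rewrite (leq_trans (size_polyD _ _)) // geq_max; apply/andP; split.
      apply: size_mul_lt (size_legendre R N) _.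
      by rewrite (leq_trans (size_polyD _ _)) // geq_max sL0.
    rewrite mul_polyC (leq_trans (size_scale_leq _ _)) //.
    apply: (@size_mul_lt _ _ _ N N) _ sP'; rewrite -add1n.
    by apply: (@size_mul_lt _ _ _ 1 N) _ sT; rewrite size_polyX.
  rewrite size_polyN mul_polyC (leq_trans (size_scale_leq _ _)) //.
  exact: (size_mul_lt (leqW sP') sP').
have FE2 x : F.[x] = P.[x] * (L i).[x] - N%:R^-1 * (Phi.[x] * P^`().[x]).
  by rewrite /F hornerD hornerN (hornerM P) (hornerM _%:P) (hornerM Phi) hornerC.
have := interp_quadrature sF; rewrite (bigD1_seq i) ?iota_uniq ?mem_index_iota //=.
rewrite big1_seq ?addr0 => [|j /andP[ij]]; last first.
  rewrite mem_index_iota ltnS => jN.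
  have h : (L i).[xi`_j] = 0 by apply: lobatto_fun_neq.
  by rewrite FE2 node_root // h !(mulr0, mul0r) subr0 mulr0.
(* Only the node [xi_i] is left, where [F = - n P^2]; the integral of [F] is
   [- N I2 - (N + 1) I2 = - 2] by [pint_legendre_sqr]. *)
rewrite FE2 node_root // lobatto_fun_eq // mul0r mulr0 subr0.
have hL : pint (-1) 1 (P * L i) = - (N%:R * I2).
  have -> : P * L i = P * L0 - (N%:R)%:P * (P * P) by rewrite /L0; ring.
  by rewrite pintB pintZ legendre_orth // sub0r.
have hPhi : pint (-1) 1 (Phi * P^`()) = n * I2.
  rewrite pint_parts lobatto_poly_deriv mulNr -mulrA pintN pintZ /lobatto_poly !hE; ring.
rewrite /F pintB pintZ hL hPhi => h.
have := pint_legendre_sqr; have -> : n = N%:R * (N%:R + 1) by [].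
have : N%:R^-1 * (n * I2) = (N%:R + 1) * I2 by rewrite /lobatto_eig; field; lra.
move: h; rewrite /lobatto_eig; lra.
Qed.

Definition lobatto_weight i : R := 2 / (n * P.[xi`_i] ^+ 2).
Local Notation w := lobatto_weight.

Lemma lobatto_quadrature F : (size F <= 2 * N)%N ->
  pint (-1) 1 F = \sum_(0 <= i < N.+1) w i * F.[xi`_i].
Proof.
move=> sF; rewrite interp_quadrature // !big_nat; apply: eq_bigr => i /andP[_ iN].
congr (_ * _); have := quadrature_weight iN; rewrite /w => e.
have c0 : n * P.[xi`_i] ^+ 2 != 0.
  by apply/eqP => c0; move: e; rewrite c0 mulr0; lra.
by apply: (mulIf c0); rewrite e divfK.
Qed.

Lemma lobatto_weight_ge0 i : 0 <= w i.
Proof.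
have := lobatto_eig_ge2 R N_gt0 => n2.
by rewrite /w divr_ge0 // mulr_ge0 ?sqr_ge0 //; lra.
Qed.

Lemma lobatto_weight_last : w N = 2 / n.
Proof. by rewrite /w (nodeN hxi) legendre_1 expr1n mulr1. Qed.

(** Negative nodes are reached by applying Sonin's bound to [P(- x)], which solves the same
    equation. Its value at [1] is [1] or [-1], hence the normalisation of the square in the
    hypotheses of that bound. *)
Lemma legendre_node_ge i : (0 < i < N)%N ->
  1 <= 128 * n * (1 - xi`_i ^+ 2) * P.[xi`_i] ^+ 4.
Proof.
move=> /andP[i0 iN]; have n2 := lobatto_eig_ge2 R N_gt0.
have ode := lobatto_poly_deriv R N.
have d0 : (2 * n)^-1 * n = 2^-1 by field; lra.
have P'0 : P^`().[xi`_i] = 0 by apply: node_deriv_root => //; rewrite i0.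
have [x0|x0] := lerP 0 xi`_i.
  apply: sonin_bound => //; first by rewrite legendre_1 expr1n.
  rewrite x0 lerBrDr -lerBrDl -(ler_pM2r (_ : 0 < n)) ?d0; last by lra.
  by have := node_gap1 N_gt0 hxi iN; lra.
pose Q := P \Po (- 'X).
have Qe x : Q.[x] = P.[- x] by rewrite /Q horner_comp hornerN hornerX.
have dQ : Q^`() = - (P^`() \Po (- 'X)) by rewrite /Q deriv_comp derivN derivX; ring.
have odeQ : ((1 - 'X^2) * Q^`())^`() = - (n%:P * Q).
  have -> : (1 - 'X^2) * Q^`() = - (Phi \Po (- 'X)).
    rewrite dQ /lobatto_poly rmorphM rmorphB rmorphXn /= comp_polyX rmorph1 sqrrN; ring.
  by rewrite derivN deriv_comp ode derivN derivX rmorphN rmorphM /= comp_polyC /Q; ring.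
have Q1 : Q.[1] ^+ 2 = 1 by rewrite Qe legendre_m1 sqrr_sign.
have := @sonin_bound _ Q n n2 odeQ Q1 (- xi`_i).
rewrite Qe opprK sqrrN; apply.
  rewrite oppr_ge0 (ltW x0) /= lerBrDr -lerBrDl -(ler_pM2r (_ : 0 < n)) ?d0; last by lra.
  by have := @node_gapm1 _ _ _ N_gt0 hxi i; rewrite i0 ltnW // => /(_ isT); lra.
by rewrite dQ hornerN horner_comp hornerN hornerX opprK P'0 oppr0.
Qed.

Lemma lobatto_weight_sqr_le i : (0 < i < N)%N ->
  w i ^+ 2 * n <= 512 * (1 - xi`_i ^+ 2).
Proof.
move=> hi; have h := legendre_node_ge hi; have n2 := lobatto_eig_ge2 R N_gt0.
have n0 : 0 < n by lra.
have P0 : P.[xi`_i] != 0.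
  by apply/eqP => P0; move: h; rewrite P0 expr0n /= mulr0; lra.
have e : w i ^+ 2 * n ^+ 2 * P.[xi`_i] ^+ 4 = 4.
  by rewrite /w; field; rewrite P0 gt_eqF.
have h2 : w i ^+ 2 * n ^+ 2 <= 512 * n * (1 - xi`_i ^+ 2).
  have := ler_wpM2l (_ : 0 <= w i ^+ 2 * n ^+ 2) h => /(_ _)/le_trans.
  rewrite mulr1; apply; first by rewrite mulr_ge0 ?sqr_ge0.
  rewrite le_eqVlt; apply/orP; left; apply/eqP.
  transitivity (128 * n * (1 - xi`_i ^+ 2) * (w i ^+ 2 * n ^+ 2 * P.[xi`_i] ^+ 4)); first by ring.
  by rewrite e; ring.
by rewrite -(ler_pM2r n0); move: h2; rewrite !expr2; lra.
Qed.

(** [w^2 n <= 512 (1 - b^2)] and [1 - b^2 <= h^2 n] give [w^2 <= 512 h^2], and [512 < 23^2]. *)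
Lemma lobatto_weight_le i : (i.+1 < N)%N -> w i.+1 <= 23 * (xi`_i.+1 - xi`_i).
Proof.
move=> iN; have h := @lobatto_weight_sqr_le i.+1 iN; have n2 := lobatto_eig_ge2 R N_gt0.
have h2 := cell_ge N_gt0 hxi iN; have h0 := node_lt hxi (ltnSn i) (ltnW iN).
have n0 : 0 < n by lra.
have := lobatto_weight_ge0 i.+1.
set d := xi`_i.+1 - xi`_i in h2 *; have d0 : 0 < d by rewrite /d subr_gt0.
have : w i.+1 ^+ 2 <= 512 * d ^+ 2 by rewrite -(ler_pM2r n0); lra.
nra.
Qed.

(** Product of [lobatto_weight_sqr_le] and [cell_le], with [512 * 360 < 430^2]. *)
Lemma lobatto_weight_width_le i : (i.+1 < N)%N ->
  n * (w i.+1 * (xi`_i.+1 - xi`_i)) <= 430 * (1 - xi`_i.+1 ^+ 2).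
Proof.
move=> iN; have h := @lobatto_weight_sqr_le i.+1 iN; have n2 := lobatto_eig_ge2 R N_gt0.
have h2 := cell_le N_gt0 hxi iN; have h0 := node_lt hxi (ltnSn i) (ltnW iN).
have b1 := node_lt1 hxi iN; have b0 := node_ge hxi (ltnW iN).
have w0 := lobatto_weight_ge0 i.+1.
set d := xi`_i.+1 - xi`_i in h2 *; have d0 : 0 < d by rewrite /d subr_gt0.
have s0 : 0 <= 1 - xi`_i.+1 ^+ 2 by nra.
set s := 1 - _ in h h2 s0 *.
have h3 : (w i.+1 ^+ 2 * n) * (d ^+ 2 * n) <= (512 * s) * (360 * s).
  by apply: ler_pM => //; apply: mulr_ge0; rewrite ?sqr_ge0 //; lra.
have : (n * (w i.+1 * d)) ^+ 2 <= (430 * s) ^+ 2.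
  have := sqr_ge0 s; move: h3; rewrite !expr2; lra.
rewrite ler_pXn2r // nnegrE; first by apply: mulr_ge0; [lra|apply: mulr_ge0 => //; exact: ltW].
by apply: mulr_ge0; lra.
Qed.

End Quadrature.

(** [(x - a) G^2] vanishes at [a], and its derivative [G^2 + 2 (x - a) G G'] is at most
    [2 G^2 + (x - a)^2 G'^2]. *)
Lemma endpoint_sampling (R : rcfType) (a b : R) (G : {poly R}) : a <= b ->
  (b - a) * G.[b] ^+ 2 <=
  2 * pint a b (G ^+ 2) + (b - a) ^+ 2 * pint a b (G^`() ^+ 2).
Proof.
move=> ab; have h := pint_deriv a b (('X - a%:P) * G ^+ 2).
have -> : (b - a) * G.[b] ^+ 2 = pint a b (('X - a%:P) * G ^+ 2)^`().
  by rewrite h !hE; ring.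
rewrite -!pintZ -pintD; apply: pint_le => // x /andP[ax xb].
rewrite !expr2 !(derivM, derivB, derivX, derivC) !hE.
set g := G.[x]; set g' := G^`().[x].
have : 0 <= (g - (x - a) * g') ^+ 2 by exact: sqr_ge0.
have : 0 <= ((b - a) ^+ 2 - (x - a) ^+ 2) * g' ^+ 2.
  by apply: mulr_ge0 (sqr_ge0 _); rewrite subr_ge0 ler_pXn2r ?nnegrE //; lra.
rewrite !expr2; lra.
Qed.

(** * Stability of histopolation *)

(** [A] preserves the degree [m] when [lam m] is nonzero, that is for [m >= 1]; constants are
    covered by [0 < N]. *)
Lemma jacobi_op_size_inv (R : rcfType) (al be : R) N (y : {poly R}) :
  (0 < N)%N -> 0 <= be -> (size (jacobi_op al be y) <= N)%N -> (size y <= N)%N.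
Proof.
move=> N0 be0 sA; rewrite leqNgt; apply/negP => Ny.
have sy : (size y <= (size y).-1.+1)%N by exact: leqSpred.
have := jacobi_op_lead al be sy; set m := (size y).-1.
have mN : (N <= m)%N by rewrite /m -ltnS prednK // (leq_ltn_trans _ Ny).
move=> /leq_sizeP/(_ m (leqnn m)); rewrite coefB coefCM nth_default; last exact: leq_trans mN.
move/eqP; rewrite sub0r oppr_eq0 mulf_eq0 => /orP[/eqP|].
  have m1 : 1 <= m%:R :> R by rewrite ler1n (leq_trans N0).
  by rewrite /jacobi_eig; nra.
rewrite -/(lead_coef y) lead_coef_eq0 => /eqP y0.
by move: Ny; rewrite y0 size_poly0.
Qed.

Section Cells.
Variables (R : realType) (N : nat) (xi : N.+1.-tuple R).
Hypothesis N_gt0 : (0 < N)%N.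
Hypothesis hxi : gauss_lobatto xi.
Implicit Types (p q r s t g F : {poly R}) (i j : nat).

Lemma pint_nodes F m : (m <= N)%N ->
  \sum_(0 <= j < m) pint xi`_j xi`_j.+1 F = pint (-1) xi`_m F.
Proof.
elim: m => [|m IH] mN; first by rewrite big_geq // (node0 hxi) pintxx.
by rewrite big_nat_recr //= IH 1?ltnW // pint_cat.
Qed.

Lemma pint_node_eq F G i : (i <= N)%N ->
  (forall j, (j < N)%N -> pint xi`_j xi`_j.+1 F = pint xi`_j xi`_j.+1 G) ->
  pint (-1) xi`_i F = pint (-1) xi`_i G.
Proof.
move=> iN h; rewrite -!pint_nodes // !big_nat; apply: eq_bigr => j /andP[_ ji].
by apply: h; apply: leq_trans iN.
Qed.

(** Each interior node is charged to the cell on its left, so every cell pays at most once and the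
    last one not at all; the two endpoints are treated apart. *)
Lemma sum_interior_le (t : nat -> R) F T : t 0%N = 0 -> t N <= T ->
  (forall x, -1 <= x <= 1 -> 0 <= F.[x]) ->
  (forall j, (j.+1 < N)%N -> t j.+1 <= pint xi`_j xi`_j.+1 F) ->
  \sum_(0 <= i < N.+1) t i <= pint (-1) 1 F + T.
Proof.
move=> t0 tN F0 h; rewrite big_nat_recr //= lerD //.
have NE : N = N.-1.+1 by rewrite prednK.
rewrite {1}NE big_nat_recl // t0 add0r.
apply: (@le_trans _ _ (pint (-1) xi`_N.-1 F)).
  rewrite -pint_nodes ?leq_pred // big_nat [X in _ <= X]big_nat.
  by apply: ler_sum => j /andP[_ jN]; apply: h; rewrite NE.
by apply: pint_sub => //; [apply: node_ge | apply: node_le1]; rewrite // leq_pred.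
Qed.

End Cells.

(** The scalar end of the nodal estimate, with [a = W(b)], [s = 1 - b^2] and local energies [f1],
    [f2]. After multiplication by [n w], the term in [f1] is absorbed by [w <= 23 h] and the one in
    [f2] by [n w h <= 430 s]: [18400 = 23 * 800] and [8600 = 430 * 20]. *)
Lemma interior_scaling (R : realFieldType) (n h w a s T f1 f2 : R) :
  0 < h -> 0 < a -> 0 < s -> 0 <= f1 -> 0 <= f2 -> 0 <= w -> 0 < n ->
  w <= 23 * h -> n * (w * h) <= 430 * s ->
  h * T * (a * s) <= 800 * (a * s) * f1 + h ^+ 2 * (20 * a * f2) ->
  n * (w * T) <= 18400 * n * f1 + 8600 * f2.
Proof.
move=> h0 a0 s0 f10 f20 w0 n0 w1 w2 e.
have {}e : h * T * s <= 800 * s * f1 + h ^+ 2 * (20 * f2).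
  by rewrite -(ler_pM2r a0); move: e; rewrite !expr2; lra.
have {}e := ler_wpM2l (mulr_ge0 (ltW n0) w0) e.
have e1 : 0 <= (23 * h - w) * (800 * n * s * f1).
  apply: mulr_ge0; first by rewrite subr_ge0.
  apply: mulr_ge0 f10; apply: mulr_ge0 (ltW s0); apply: mulr_ge0 (ltW n0); exact: ler0n.
have e2 : 0 <= (430 * s - n * (w * h)) * (20 * h * f2).
  apply: mulr_ge0; first by rewrite subr_ge0.
  apply: mulr_ge0 f20; apply: mulr_ge0 (ltW h0); exact: ler0n.
rewrite -(ler_pM2r (mulr_gt0 h0 s0)).
by move: e e1 e2; rewrite !expr2; lra.
Qed.

Section MainInequality.
Variables (R : realType) (N : nat) (xi : N.+1.-tuple R).
Hypothesis N_gt0 : (0 < N)%N.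
Hypothesis hxi : gauss_lobatto xi.
Implicit Types (p q r s t g F : {poly R}) (i j : nat).
Local Notation n := (lobatto_eig R N).
Local Notation w := (lobatto_weight xi).

Variables (W : {poly R}) (al be : R).
Hypothesis W_ge0 : forall x, -1 <= x <= 1 -> 0 <= W.[x].
Hypothesis W_deriv : W^`() * (1 - 'X ^+ 2) = - (W * (al%:P + be%:P * 'X)).
Hypothesis be01 : 0 <= be <= 1.
Hypothesis W_gt0 : forall x, -1 < x < 1 -> 0 < W.[x].
Hypothesis W_size : (size W <= 2)%N.
Hypothesis W_ratio : forall x b, -1 < b < 1 -> -1 <= x -> 1 - x <= 20 * (1 - b) ->
  W.[x] <= 20 * W.[b].
Hypothesis W_div : forall p q, p^`() = W * q -> p.[-1] = 0 -> p.[1] = 0 ->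
  exists k, p = W * (1 - 'X ^+ 2) * k.

Local Notation A := (jacobi_op al be).
Local Notation B := (jacobi_energy W).
Local Notation lam := (jacobi_eig be).

Lemma W_neq0 : W != 0.
Proof. by apply/eqP => W0; have := @W_gt0 0; rewrite W0 horner0; lra. Qed.

(** With [eig_ge], this places [n] between the eigenvalues of degrees [N - 1] and [N], so that the
    same [n] serves both spectral bounds. *)
Lemma eig_pred_le : lam N.-1 <= n.
Proof.
have NE : N%:R = N.-1%:R + 1 :> R by rewrite natr1 prednK.
rewrite /jacobi_eig /lobatto_eig NE; have := ler0n R N.-1.
by move/andP: be01 => [? ?]; nra.
Qed.

Lemma eig_ge : n <= lam N.
Proof.
by rewrite /jacobi_eig /lobatto_eig; have := ler0n R N; move/andP: be01 => [? ?]; nra.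
Qed.

(** [ip W d 1 = 0] is the solvability condition of [A y = d]: it makes the primitive of [W d] from
    [-1] vanish at [1] too, and [W_div] then allows the division. *)
Lemma potential_ex d : ip W d 1 = 0 -> exists y, A y = d /\
  forall x, pint (-1) x (W * d) = - (W * (1 - 'X^2) * y^`()).[x].
Proof.
move=> d1; pose p := prim (W * d) - ((prim (W * d)).[-1])%:P.
have dp : p^`() = W * d by rewrite /p derivB deriv_prim derivC subr0.
have pE x : p.[x] = pint (-1) x (W * d) by rewrite /p !hE.
have [k pk] : exists k, p = W * (1 - 'X^2) * k.
  apply: W_div dp _ _; first by rewrite pE pintxx.
  by rewrite pE; move: d1; rewrite /ip mulr1.
exists (- prim k).
have dy : (- prim k)^`() = - k by rewrite derivN deriv_prim.
split; last by move=> x; rewrite dy -pE pk mulrN hornerN opprK.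
apply: (mulfI W_neq0); apply: oppr_inj.
by rewrite -(deriv_energy W_deriv) dy mulrN derivN -pk dp.
Qed.

(** The nodal term depends on [y] only through [W (1 - x^2) y'], which agrees at the node with its
    analogue [G] for [k]. As [G' = - W A k], sampling bounds [G] by integrals of [k] over the cell
    on the left, where [W] and [1 - x^2] are at most [20] times their values at the node. *)
Lemma interior_node_le y k j : (j.+1 < N)%N ->
  (W * (1 - 'X^2) * y^`()).[xi`_j.+1] = (W * (1 - 'X^2) * k^`()).[xi`_j.+1] ->
  n * (w j.+1 * (W * (1 - 'X^2) * y^`() * y^`()).[xi`_j.+1]) <=
  pint xi`_j xi`_j.+1 ((18400 * n)%:P * (W * (1 - 'X^2) * k^`() * k^`())
     + 8600%:P * (W * A k * A k)).
Proof.
move=> jN; have b1 := node_lt1 hxi jN.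
have b0 : -1 < xi`_j.+1 by apply: (node_gtm1 hxi); exact: ltnW.
have ab := node_lt hxi (ltnSn j) (ltnW jN).
have a0 := node_ge hxi (ltnW (ltnW jN)).
have ratio := cell_ratio N_gt0 hxi jN.
have w1 := lobatto_weight_le N_gt0 hxi jN.
have w2 := lobatto_weight_width_le N_gt0 hxi jN.
have w0 := lobatto_weight_ge0 xi N_gt0 j.+1.
have n2 := lobatto_eig_ge2 R N_gt0.
move: w0 w1 w2 ratio b1 b0 ab a0; set a := xi`_j; set b := xi`_j.+1; set wb := w j.+1.
move=> w0 w1 w2 ratio b1 b0 ab a0.
have Wb : 0 < W.[b] by apply: W_gt0; rewrite b0.
have s0 : 0 < 1 - b ^+ 2 by nra.
set s := 1 - b ^+ 2 in s0 w2 *.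
set h := b - a in w1 w2 *; have h0 : 0 < h by rewrite /h subr_gt0.
pose G := W * (1 - 'X^2) * k^`().
have -> : (W * (1 - 'X^2) * y^`() * y^`()).[b] = W.[b] * s * y^`().[b] ^+ 2.
  by rewrite !hE /s; ring.
rewrite -/G => yk.
have yk' : W.[b] * s * y^`().[b] = G.[b] by rewrite -yk !hE /s; ring.
have := endpoint_sampling G (ltW ab); rewrite -/h.
have dG : G^`() = - (W * A k) by rewrite /G (deriv_energy W_deriv).
pose F1 := W * (1 - 'X^2) * k^`() * k^`(); pose F2 := W * A k * A k.
have F2E x : F2.[x] = W.[x] * (A k).[x] ^+ 2.
  by rewrite /F2; move: (A k) => q; rewrite !hE; ring.
have Wx x : a <= x <= b -> W.[x] <= 20 * W.[b].
  by move=> /andP[ax xb]; apply: W_ratio; rewrite ?b0 //; lra.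
have Wx0 x : a <= x <= b -> 0 <= W.[x].
  by move=> /andP[ax xb]; apply: W_ge0; lra.
have h1 : pint a b (G ^+ 2) <= (400 * (W.[b] * s)) * pint a b F1.
  rewrite -pintZ; apply: pint_le (ltW ab) _ => x hx.
  have W1 := Wx _ hx; have W0 := Wx0 _ hx; move/andP: hx => [ax xb].
  have x2 : 0 <= 1 - x ^+ 2 by nra.
  have sx : 1 - x ^+ 2 <= 20 * s.
    have : (1 - x) * (1 + x) <= (20 * (1 - b)) * (1 + b) by apply: ler_pM; lra.
    by rewrite /s !expr2; lra.
  have -> : (G ^+ 2).[x] = (W.[x] * (1 - x ^+ 2)) * F1.[x] by rewrite /G /F1 !hE; ring.
  rewrite (hornerM _%:P) hornerC; apply: ler_wpM2r.
    have -> : F1.[x] = W.[x] * (1 - x ^+ 2) * k^`().[x] ^+ 2 by rewrite /F1 !hE; ring.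
    by apply: mulr_ge0 (sqr_ge0 _); apply: mulr_ge0.
  have -> : 400 * (W.[b] * s) = (20 * W.[b]) * (20 * s) by ring.
  exact: ler_pM.
have h2 : pint a b (G^`() ^+ 2) <= (20 * W.[b]) * pint a b F2.
  rewrite -pintZ; apply: pint_le (ltW ab) _ => x hx.
  have W1 := Wx _ hx; have W0 := Wx0 _ hx.
  have -> : (G^`() ^+ 2).[x] = W.[x] * F2.[x].
    by rewrite F2E dG; move: (A k) => q; rewrite !hE; ring.
  rewrite (hornerM _%:P) hornerC; apply: ler_wpM2r => //.
  rewrite F2E.
  exact: mulr_ge0 (sqr_ge0 _).
have F10 : 0 <= pint a b F1.
  apply: pint_ge0 (ltW ab) _ => x hx; have W0 := Wx0 _ hx; move/andP: hx => [ax xb].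
  have -> : F1.[x] = W.[x] * (1 - x ^+ 2) * k^`().[x] ^+ 2 by rewrite /F1 !hE; ring.
  by apply: mulr_ge0 (sqr_ge0 _); apply: mulr_ge0 => //; nra.
have F20 : 0 <= pint a b F2.
  apply: pint_ge0 (ltW ab) _ => x hx; have W0 := Wx0 _ hx.
  rewrite F2E.
  exact: mulr_ge0 (sqr_ge0 _).
rewrite pintD !pintZ -/F1 -/F2 -yk'.
move: h1 h2 F10 F20 Wb; move: (pint a b F1) (pint a b F2) (W.[b]) y^`().[b].
move=> f1 f2 Wb yb h1 h2 F10 F20 Wb0 hs.
have {h1 h2} {}hs :
    h * (Wb * s * yb ^+ 2) * (Wb * s) <= 800 * (Wb * s) * f1 + h ^+ 2 * (20 * Wb * f2).
  have : h ^+ 2 * pint a b (G^`() ^+ 2) <= h ^+ 2 * (20 * Wb * f2).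
    by apply: ler_wpM2l; rewrite ?sqr_ge0.
  by move: hs; rewrite !expr2; lra.
apply: interior_scaling h0 Wb0 s0 F10 F20 w0 _ w1 w2 hs; lra.
Qed.

Lemma quadrature_size (y : {poly R}) : (size y <= N)%N ->
  (size (W * (1 - 'X^2) * y^`() * y^`())%R <= 2 * N)%N.
Proof.
move=> sy; have s' : (size y^`() <= N.-1)%N.
  apply/leq_sizeP => j Nj; rewrite coef_deriv nth_default ?mul0rn //.
  by apply: (leq_trans sy); rewrite -ltnS prednK in Nj.
have s3 : (size (1 - 'X^2 : {poly R})%R <= 3)%N.
  by rewrite (leq_trans (size_polyD _ _)) // geq_max size_polyN size_polyXn size_poly1.
have -> : W * (1 - 'X^2) * y^`() * y^`() = y^`() * (W * ((1 - 'X^2) * y^`())) by ring.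
(* For [N = 1] the derivative [y'] is zero; otherwise the product has degree at most
   [1 + 2 + 2 (N - 2) = 2 N - 1]. *)
case: (posnP N.-1) => [N1|N1].
  move: s'; rewrite N1 leqn0 size_poly_eq0 => /eqP ->.
  by rewrite mul0r size_poly0.
have sy' : (size y^`() <= N.-2.+1)%N by rewrite prednK.
apply: leq_trans (size_mul_lt sy' (size_mul_lt W_size (size_mul_lt s3 s'))) _.
by move: N1; lia.
Qed.

(** [10^5] leaves room over [2 (18400 + 8600)], the factor [2] coming from the recombination
    [q = d + r]. *)
Theorem histopolation_stable (q v : {poly R}) : (size q <= N)%N ->
  (forall j, (j < N)%N -> pint xi`_j xi`_j.+1 (W * q) = pint xi`_j xi`_j.+1 (W * v)) ->
  ip W q q <= 10 ^+ 5 * ip W v v.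
Proof.
move=> sq hqv; have [r sr oe] := ip_proj W_ge0 N v.
have n2 := lobatto_eig_ge2 R N_gt0.
have [be0 be1] := andP be01.
have s1 : (size (1 : {poly R})%R <= N)%N by rewrite size_poly1.
have node_eq i (iN : (i <= N)%N) := pint_node_eq hxi iN hqv.
have [d qr] : exists d, d = q - r by exists (q - r).
have [e vr] : exists e, e = v - r by exists (v - r).
rewrite -vr in oe.
have sd : (size d <= N)%N.
  by rewrite qr (leq_trans (size_polyD _ _)) // geq_max sq size_polyN.
have node_de i : (i <= N)%N -> pint (-1) xi`_i (W * d) = pint (-1) xi`_i (W * e).
  by move=> iN; rewrite qr vr !mulrBr !pintB node_eq.
have e1 : ip W e 1 = 0 by apply: oe.
have d1 : ip W d 1 = 0.
  move: e1; rewrite /ip !mulr1 => <-.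
  by have := node_de N (leqnn N); rewrite (nodeN hxi).
have [y [Ay ypot]] := potential_ex d1.
have [k [Ak kpot]] := potential_ex e1.
have sy : (size y <= N)%N by apply: (@jacobi_op_size_inv _ al be) => //; rewrite Ay.
have yk i : (i <= N)%N -> (W * (1 - 'X^2) * y^`()).[xi`_i] = (W * (1 - 'X^2) * k^`()).[xi`_i].
  by move=> iN; apply: oppr_inj; rewrite -ypot -kpot; apply: node_de.
have hd : ip W d d <= n * B y y.
  have := op_norm_le W_ge0 W_deriv be0 (_ : (size y <= N.-1.+1)%N).
  rewrite prednK // Ay => /(_ sy)/le_trans; apply.
  by apply: ler_wpM2r; [apply: energy_ge0 | apply: eig_pred_le].
have he : n * B k k <= ip W e e.
  have := energy_orth_le W_ge0 W_deriv be0 (_ : orth W N (A k)).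
  rewrite Ak => /(_ oe) h; apply: le_trans h.
  by apply: ler_wpM2r; [apply: energy_ge0 | apply: eig_ge].
have hy : n * B y y <= 18400 * n * B k k + 8600 * ip W e e.
  rewrite {1}/jacobi_energy (lobatto_quadrature N_gt0 hxi (quadrature_size sy)) mulr_sumr.
  rewrite -[X in _ <= X]addr0.
  have -> : 18400 * n * B k k + 8600 * ip W e e = pint (-1) 1
     ((18400 * n)%:P * (W * (1 - 'X^2) * k^`() * k^`()) + 8600%:P * (W * A k * A k)).
    by rewrite pintD !pintZ Ak.
  apply: (sum_interior_le N_gt0 hxi).
  - by rewrite (node0 hxi) !hE; ring.
  - rewrite (nodeN hxi) !hE le_eqVlt; apply/orP; left; apply/eqP; ring.
  - move=> x hx; have W0 := W_ge0 hx; move/andP: hx => [x0 x1].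
    rewrite Ak !hE; apply: addr_ge0.
      apply: mulr_ge0; first by apply: mulr_ge0; lra.
      rewrite -mulrA; apply: mulr_ge0; last exact: sqr_ge0.
      by apply: mulr_ge0 => //; nra.
    apply: mulr_ge0; first exact: ler0n.
    by rewrite -mulrA; apply: mulr_ge0 => //; exact: sqr_ge0.
  - by move=> j jN; apply: interior_node_le => //; apply: yk; exact: ltnW.
have er : ip W e r = 0 by apply: oe.
have ev : ip W v v = ip W e e + ip W r r.
  have -> : v = e + r by rewrite vr subrK.
  by rewrite (ipDl W e) !(ipDr W e r) (ipC W r e) er; ring.
have qq : ip W q q <= 2 * ip W d d + 2 * ip W r r.
  have -> : q = d + r by rewrite qr subrK.
  exact: ip_sum_le W_ge0 _ _.
have e0 := ip_ge0 W_ge0 e; have r0 := ip_ge0 W_ge0 r.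
by rewrite ev; lra.
Qed.

End MainInequality.

(** * Stability for unweighted data in the norm weighted by 1 - x *)

Lemma interior_scaling_right (R : realFieldType) (n h w s T f1 f2 : R) :
  0 < h -> 0 < s -> 0 <= f1 -> 0 <= f2 -> 0 <= w -> 0 < n ->
  w <= 23 * h -> n * (w * h) <= 430 * s ->
  h * s * T <= 2 * s * f1 + h ^+ 2 * f2 ->
  n * (w * T) <= 46 * n * f1 + 430 * f2.
Proof.
move=> h0 s0 f10 f20 w0 n0 w1 w2 e.
have {}e := ler_wpM2l (mulr_ge0 (ltW n0) w0) e.
have e1 : 0 <= (23 * h - w) * (2 * n * s * f1).
  apply: mulr_ge0; first by rewrite subr_ge0.
  apply: mulr_ge0 f10; apply: mulr_ge0 (ltW s0); apply: mulr_ge0 (ltW n0); exact: ler0n.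
have e2 : 0 <= (430 * s - n * (w * h)) * (h * f2).
  apply: mulr_ge0; first by rewrite subr_ge0.
  by apply: mulr_ge0 f20; exact: ltW.
rewrite -(ler_pM2r (mulr_gt0 h0 s0)).
by move: e e1 e2; rewrite !expr2; lra.
Qed.

Section RightWeight.
Variables (R : realType) (N : nat) (xi : N.+1.-tuple R).
Hypothesis N_gt0 : (0 < N)%N.
Hypothesis hxi : gauss_lobatto xi.
Implicit Types (p q r s t g F : {poly R}) (i j : nat).
Local Notation n := (lobatto_eig R N).
Local Notation w := (lobatto_weight xi).

Local Notation W := (1 - 'X : {poly R}).
Local Notation V := (1 + 'X : {poly R}).

Lemma deriv1 : (1 : {poly R})^`() = 0. Proof. by rewrite derivC. Qed.

Lemma right_weight_ge0 x : -1 <= x <= 1 -> 0 <= W.[x].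
Proof. by rewrite !hE => /andP[_]; rewrite subr_ge0. Qed.
Lemma left_weight_ge0 x : -1 <= x <= 1 -> 0 <= V.[x].
Proof. by rewrite !hE => /andP[x0 _]; lra. Qed.
Lemma right_weight_deriv : W^`() * (1 - 'X ^+ 2) = - (W * (1%:P + 1%:P * 'X)).
Proof. rewrite derivB deriv1 derivX polyC1; ring. Qed.
Lemma left_weight_deriv : V^`() * (1 - 'X ^+ 2) = - (V * ((-1)%:P + 1%:P * 'X)).
Proof. rewrite derivD deriv1 derivX polyCN polyC1; ring. Qed.

Lemma pint_right_weight x : pint x 1 W = (1 - x) ^+ 2 / 2.
Proof.
rewrite (@pintE _ _ _ _ ('X - (2^-1)%:P * ('X * 'X))); last first.
  have h2 : (2^-1)%:P * 2%:R = 1 :> {poly R}.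
    by rewrite -(rmorph_nat polyC) -polyCM mulVf // pnatr_eq0.
  rewrite !(derivM, derivB, derivC, derivX).
  by transitivity (1 - (2^-1)%:P * 2%:R * 'X : {poly R}); [ring | rewrite h2 mul1r].
by rewrite !hE; field.
Qed.

(** As [1 / (1 - x)] is not integrable, Cauchy-Schwarz alone cannot give this. The degree of [u] is
    used through [|A u| <= n |u|], and the factor [n] is compensated by the width of the last cell,
    at most [36 / n]. *)
Lemma last_cell_integral_le (u : {poly R}) : (size u <= N)%N ->
  pint xi`_N.-1 1 u ^+ 2 <= 1300 * ip W u u.
Proof.
move=> su; have n2 := lobatto_eig_ge2 R N_gt0.
have a1 : xi`_N.-1 < 1 by apply: (node_lt1 hxi); rewrite ltn_predL.
have am1 : -1 <= xi`_N.-1 by apply: (node_ge hxi); rewrite leq_pred.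
have hn := last_cell_le N_gt0 hxi; have hn0 := last_cell_ge N_gt0 hxi.
pose f := jacobi_op 1 1 u; pose Lf := ip W f f; pose U := ip W u u.
have U0 : 0 <= U := ip_ge0 right_weight_ge0 u.
have L0 : 0 <= Lf := ip_ge0 right_weight_ge0 f.
have LU : Lf <= n ^+ 2 * U.
  have su' : (size u <= N.-1.+1)%N by rewrite prednK.
  have l0 := jacobi_eig_ge0 (@ler01 R) N.-1.
  have ln : jacobi_eig 1 N.-1 <= n by apply: eig_pred_le; rewrite // ler01 lexx.
  have h1 := op_norm_le right_weight_ge0 right_weight_deriv (@ler01 R) su'.
  have h2 := energy_le right_weight_ge0 right_weight_deriv (@ler01 R) su'.
  apply: (le_trans h1); apply: (@le_trans _ _ (n * (n * U))); last by rewrite expr2 mulrA.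
  apply: ler_pM => //; first exact: energy_ge0 right_weight_ge0 _.
  by apply: (le_trans h2); apply: ler_wpM2r.
have ptw x : xi`_N.-1 <= x <= 1 -> ((1 - x) * u^`().[x]) ^+ 2 <= Lf / 2.
  move=> /andP[ax x1]; have [N1|N1] := ltnP 1 N; last first.
    have -> : u^`() = 0.
      apply/eqP; rewrite -size_poly_leq0; apply/leq_sizeP => j _.
      by rewrite coef_deriv nth_default ?mul0rn // (leq_trans su) // (leq_trans N1).
    by rewrite horner0 mulr0 expr0n /= divr_ge0.
  have x0 : 0 <= x by apply: le_trans ax; apply: (last_node_ge0 N_gt0 hxi).
  move: x1; rewrite le_eqVlt => /predU1P[->|x1].
    by rewrite subrr mul0r expr0n /= divr_ge0.
  have dE := deriv_energy right_weight_deriv u; rewrite -/f in dE.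
  have e1 : pint x 1 (W * 1 * f) = (1 - x) * (1 - x ^+ 2) * u^`().[x].
    rewrite mulr1 -[W * f]opprK -dE pintN pint_deriv !hE; ring.
  have Wz z : x <= z <= 1 -> 0 <= W.[z].
    by move=> /andP[xz z1]; apply: right_weight_ge0; lra.
  have cs := pint_CS 1 f (ltW x1) Wz; rewrite e1 in cs.
  have e2 : pint x 1 (W * 1 ^+ 2) = (1 - x) ^+ 2 / 2.
    by rewrite expr1n mulr1 pint_right_weight.
  have e3 : pint x 1 (W * f ^+ 2) <= Lf.
    rewrite /Lf /ip -mulrA -expr2; apply: pint_sub; rewrite ?lexx ?(ltW x1) //; first by lra.
    by move=> z hz; rewrite hornerM horner_exp mulr_ge0 ?sqr_ge0 ?right_weight_ge0.
  have {}cs : ((1 - x) * (1 - x ^+ 2) * u^`().[x]) ^+ 2 <= (1 - x) ^+ 2 / 2 * Lf.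
    by apply: (le_trans cs); rewrite e2; apply: ler_wpM2l => //; rewrite divr_ge0 ?sqr_ge0.
  have d0 : 0 < (1 - x) ^+ 2 by rewrite exprn_gt0 // subr_gt0.
  rewrite -(ler_pM2l d0); apply: le_trans (_ : _ <= (1 - x) ^+ 2 / 2 * Lf) _; last first.
    by rewrite mulrCA mulrA [_ * Lf]mulrC mulrA [Lf * _]mulrC.
  apply: le_trans cs.
  have -> : ((1 - x) * (1 - x ^+ 2) * u^`().[x]) ^+ 2 =
      (1 + x) ^+ 2 * ((1 - x) ^+ 2 * ((1 - x) * u^`().[x]) ^+ 2).
    by ring.
  rewrite ler_peMl //; first by rewrite mulr_ge0 ?sqr_ge0.
  by rewrite exprn_ege1 //; lra.
set a := xi`_N.-1 in a1 am1 hn hn0 ptw *.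
have h0 : 0 < 1 - a by rewrite subr_gt0.
pose h := 1 - a; rewrite -/h in h0 hn hn0.
(* A bump vanishing at both ends of the last cell, with [c' = 2 W / h - 1]. It writes [u] as a term
   carrying the weight, fit for Cauchy-Schwarz, minus [c' u], whose integration by parts has no
   boundary term and produces [W u']. *)
pose c : {poly R} := W * (1 - (h^-1)%:P * W).
have cE x : c.[x] = (1 - x) * (1 - h^-1 * (1 - x)) by rewrite /c !hE.
have hh : h^-1 * h = 1 by rewrite mulVf ?gt_eqF.
have split_u : u = (2 / h)%:P * (W * u) - c^`() * u.
  have -> : c^`() = (2 / h)%:P * W - 1.
    rewrite /c !(derivM, derivB, deriv1, derivC, derivX).
    by rewrite polyCM (rmorph_nat polyC) ; ring.
  ring.
have i1 : pint a 1 (W * u) ^+ 2 <= h ^+ 2 / 2 * U.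
  have := @pint_CS _ a 1 W 1 u (ltW a1) _; rewrite mulr1 => /(_ _)/le_trans; apply.
    by move=> z /andP[? ?]; apply: right_weight_ge0; lra.
  have -> : pint a 1 (W * 1 ^+ 2) = h ^+ 2 / 2.
    by rewrite expr1n mulr1 pint_right_weight.
  apply: ler_wpM2l; first by rewrite divr_ge0 ?sqr_ge0.
  rewrite /U /ip -mulrA -expr2; apply: pint_sub; rewrite ?lexx ?(ltW a1) //.
  by move=> z hz; rewrite hornerM horner_exp mulr_ge0 ?sqr_ge0 ?right_weight_ge0.
have i2 : pint a 1 (c^`() * u) ^+ 2 <= h ^+ 2 * (Lf / 2).
  have -> : pint a 1 (c^`() * u) = - pint a 1 ((1 - (h^-1)%:P * W) * (W * u^`())).
    have := pint_parts a 1 c u; rewrite !cE subrr mul0r mul0r -/h hh subrr mulr0 mul0r subrr.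
    rewrite sub0r => e; rewrite -[LHS]opprK -e; congr (- pint _ _ _); rewrite /c; ring.
  rewrite sqrrN; apply: (le_trans (pint_CS1 _ _ (ltW a1))).
  have -> : h ^+ 2 * (Lf / 2) = h * (h * (Lf / 2)) by ring.
  apply: ler_pM.
  - by apply: pint_ge0 (ltW a1) _ => z _; rewrite horner_exp sqr_ge0.
  - by apply: pint_ge0 (ltW a1) _ => z _; rewrite horner_exp sqr_ge0.
  - apply: (@le_trans _ _ (pint a 1 1%:P)); last by rewrite pint_const mul1r.
    apply: pint_le (ltW a1) _ => z /andP[az z1].
    rewrite hornerC horner_exp !hE expr_le1 //.
      by rewrite lerBlDr lerDl mulr_ge0 ?invr_ge0 ?(ltW h0) // subr_ge0.
    by rewrite subr_ge0 mulrC ler_pdivrMr // mul1r /h; lra.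
  - apply: (@le_trans _ _ (pint a 1 (Lf / 2)%:P)); last by rewrite pint_const mulrC.
    apply: pint_le (ltW a1) _ => z hz.
    by rewrite hornerC horner_exp hornerM !hE; apply: ptw.
rewrite {1}split_u pintB pintZ.
move: i1 i2; move: (pint a 1 _) (pint a 1 _) => y x i1 i2.
have j1 : (2 / h * x) ^+ 2 <= 2 * U.
  have -> : 2 * U = (2 / h) ^+ 2 * (h ^+ 2 / 2 * U) by field; rewrite gt_eqF.
  by rewrite exprMn; apply: ler_wpM2l => //; exact: sqr_ge0.
(* [648 = 36^2 / 2], from [last_cell_le]; in the end [1300 = 2 (2 + 648)]. *)
have j2 : h ^+ 2 * (Lf / 2) <= 648 * U.
  have : h ^+ 2 * Lf <= h ^+ 2 * (n ^+ 2 * U) by apply: ler_wpM2l; rewrite ?sqr_ge0.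
  have : (h * n) ^+ 2 <= 36 ^+ 2.
    by rewrite ler_pXn2r // nnegrE ?ler0n // mulr_ge0 ?(ltW h0) //; lra.
  move=> /(ler_wpM2r U0); rewrite !expr2; lra.
have := sqr_ge0 (2 / h * x + y); rewrite -/U; move: i2 j1 j2; rewrite !expr2; lra.
Qed.

(** The two sides differ by the integral of [((1 - x^2) t r)']. So [r |-> ((1 + x) r)'] carries the
    form [ip V] plus energy to [ip W]; the eigenvalues at play are [1 + k (k + 2) = (k + 1)^2], and
    [N^2 <= n <= (N + 1)^2]. *)
Lemma cross_energy t r :
  ip W (V * t)^`() (V * r)^`() = ip V t r + jacobi_energy V t r.
Proof.
have h := pint_deriv (-1) 1 ((1 - 'X ^+ 2) * (t * r)).
have h0 : pint (-1) 1 ((1 - 'X ^+ 2) * (t * r))^`() = 0 by rewrite h !hE; ring.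
rewrite /ip /jacobi_energy -pintD -[RHS]addr0 -h0 -pintD; congr pint.
rewrite expr2 !(derivM, derivB, derivD, deriv1, derivX); ring.
Qed.

(** Tested against [(V s)'] with [s] of degree below [N], the hypothesis says that [r] is orthogonal
    to [s] for the form [ip V] plus energy. The high part of [r] does not contribute, so the low
    part [r0] is orthogonal to itself and has norm zero. *)
Lemma cross_orth (e r : {poly R}) : (V * r)^`() = e -> orth W N e -> orth V N r.
Proof.
move=> re oe t st; have [r0 sr0 or0] := ip_proj left_weight_ge0 N r.
have be0 : 0 <= (1 : R) by [].
have split_r : r = r0 + (r - r0) by rewrite addrC subrK.
have h s : (size s <= N)%N -> ip V r0 s + jacobi_energy V r0 s = 0.
  move=> ss; have sV : (size (V * s)^`() <= N)%N.
    apply/leq_sizeP => j Nj; rewrite coef_deriv nth_default ?mul0rn //.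
    rewrite mulrDl mul1r (leq_trans (size_polyD _ _)) // geq_max (leq_trans ss (leqW Nj)) /=.
    rewrite mulrC; have [->|s0] := eqVneq s 0; first by rewrite mul0r size_poly0.
    by rewrite size_mulX // ltnS (leq_trans ss).
  have e0 := oe _ sV; rewrite -re cross_energy in e0.
  have o1 : ip V (r - r0) s = 0 by apply: or0.
  have o2 : jacobi_energy V (r - r0) s = 0.
    rewrite energyC -(energyE left_weight_deriv) ipC; apply: or0.
    exact: jacobi_op_size.
  move: o1 o2; rewrite ipBl -!(energyE left_weight_deriv) jacobi_opB ipBl.
  by move: e0; rewrite -(energyE left_weight_deriv); lra.
have r00 : ip V r0 r0 = 0.
  have := h _ sr0; have := ip_ge0 left_weight_ge0 r0.
  have := energy_ge0 left_weight_ge0 r0; lra.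
by rewrite split_r ipDl or0 // addr0; apply: (ip_eq0 left_weight_ge0).
Qed.

Lemma primitive_div (e : {poly R}) : exists r, (V * r)^`() = e /\
  (forall x, pint (-1) x e = (1 + x) * r.[x]).
Proof.
pose p := prim e - ((prim e).[-1])%:P.
have : root p (-1) by apply/rootP; rewrite /p !hE subrr.
move=> /factor_theorem[r pr]; exists r.
have pV : V * r = p by rewrite pr polyCN opprK mulrC polyC1 addrC.
split; first by rewrite pV /p derivB deriv_prim derivC subr0.
move=> x; transitivity (V * r).[x]; last by rewrite !hE.
by rewrite pV /p /pint hornerD hornerN hornerC.
Qed.

Lemma primitive_div_size (e r : {poly R}) : (size e <= N)%N -> (V * r)^`() = e -> (size r <= N)%N.
Proof.
move=> se re; have [->|r0] := eqVneq r 0; first by rewrite size_poly0.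
have sV : size (V * r) = (size r).+1.
  have -> : V = 'X - (-1)%:P by rewrite polyCN opprK polyC1 addrC.
  by rewrite mulrC size_mul ?polyXsubC_eq0 // size_XsubC addn2.
by rewrite -[size r]/((size r).+1.-1) -sV -size_deriv re.
Qed.

(** Sampling of [(1 + x) r] at the right end [b] of the cell, multiplied by [1 - b], which is at
    most [W] on the cell. *)
Lemma node_trace (r e : {poly R}) j : (j.+1 < N)%N -> (V * r)^`() = e ->
  (xi`_j.+1 - xi`_j) * (1 - xi`_j.+1) * ((1 + xi`_j.+1) * r.[xi`_j.+1]) ^+ 2 <=
  2 * (1 - xi`_j.+1 ^+ 2) * pint xi`_j xi`_j.+1 (V * r * r) +
  (xi`_j.+1 - xi`_j) ^+ 2 * pint xi`_j xi`_j.+1 (W * e * e).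
Proof.
move=> jN re; have b1 := node_lt1 hxi jN.
have ab := node_lt hxi (ltnSn j) (ltnW jN).
have a0 := node_ge hxi (ltnW (ltnW jN)).
have := endpoint_sampling (V * r) (ltW ab); rewrite re.
have h1 : pint xi`_j xi`_j.+1 ((V * r) ^+ 2) <= (1 + xi`_j.+1) * pint xi`_j xi`_j.+1 (V * r * r).
  rewrite -pintZ; apply: pint_le (ltW ab) _ => x /andP[ax xb].
  have -> : ((V * r) ^+ 2).[x] = (1 + x) * ((1 + x) * r.[x] ^+ 2) by rewrite !hE; ring.
  have -> : ((1 + xi`_j.+1)%:P * (V * r * r)).[x] = (1 + xi`_j.+1) * ((1 + x) * r.[x] ^+ 2).
    by rewrite !hE; ring.
  by apply: ler_wpM2r; [apply: mulr_ge0 (sqr_ge0 _); lra | lra].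
have h2 : (1 - xi`_j.+1) * pint xi`_j xi`_j.+1 (e ^+ 2) <= pint xi`_j xi`_j.+1 (W * e * e).
  rewrite -pintZ; apply: pint_le (ltW ab) _ => x /andP[ax xb].
  have -> : (W * e * e).[x] = (1 - x) * (e ^+ 2).[x] by rewrite !hE; ring.
  rewrite hornerM hornerC; apply: ler_wpM2r; last by lra.
  by rewrite horner_exp sqr_ge0.
have -> : (V * r).[xi`_j.+1] = (1 + xi`_j.+1) * r.[xi`_j.+1] by rewrite !hE; ring.
move: b1 ab h1 h2.
move: (pint _ _ (V * r * r)) (pint _ _ (W * e * e)) (pint _ _ (e ^+ 2)) (pint _ _ _).
move: (xi`_j.+1) (xi`_j) => b a f1 f2 e2 g2 b1 ab h1 h2 h3.
have b3 : 0 < 1 - b by lra.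
have := ler_wpM2l (ltW b3) h3; have := ler_wpM2l (ltW b3) h1.
have := ler_wpM2l (sqr_ge0 (b - a)) h2.
by rewrite !expr2; lra.
Qed.

Lemma left_weight_sqr_ge0 (r : {poly R}) x : -1 <= x <= 1 -> 0 <= (V * r * r).[x].
Proof.
move=> /andP[x0 x1]; rewrite !hE -mulrA.
by apply: mulr_ge0 (sqr_ge0 _); lra.
Qed.

Lemma right_weight_sqr_ge0 (r : {poly R}) x : -1 <= x <= 1 -> 0 <= (W * r * r).[x].
Proof.
move=> /andP[x0 x1]; rewrite !hE -mulrA.
by apply: mulr_ge0 (sqr_ge0 _); lra.
Qed.

Lemma interior_node_le_right (s r e : {poly R}) j : (j.+1 < N)%N -> (V * r)^`() = e ->
  s.[xi`_j.+1] = r.[xi`_j.+1] ->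
  n * (w j.+1 * (V * s * s).[xi`_j.+1]) <=
  pint xi`_j xi`_j.+1 ((46 * n)%:P * (V * r * r) + 430%:P * (W * e * e)).
Proof.
move=> jN re sr; have b1 := node_lt1 hxi jN.
have b0 : -1 < xi`_j.+1 by apply: (node_gtm1 hxi); exact: ltnW.
have ab := node_lt hxi (ltnSn j) (ltnW jN).
have a0 := node_ge hxi (ltnW (ltnW jN)).
have w1 := lobatto_weight_le N_gt0 hxi jN.
have w2 := lobatto_weight_width_le N_gt0 hxi jN.
have w0 := lobatto_weight_ge0 xi N_gt0 j.+1.
have n2 := lobatto_eig_ge2 R N_gt0.
have -> : (V * s * s).[xi`_j.+1] = (1 + xi`_j.+1) * r.[xi`_j.+1] ^+ 2.
  by rewrite !hE sr; ring.
rewrite pintD !pintZ.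
have h0 : 0 < xi`_j.+1 - xi`_j by rewrite subr_gt0.
have s0 : 0 < 1 - xi`_j.+1 ^+ 2.
  have -> : 1 - xi`_j.+1 ^+ 2 = (1 - xi`_j.+1) * (1 + xi`_j.+1) by ring.
  by apply: mulr_gt0; lra.
have sub x : xi`_j <= x <= xi`_j.+1 -> -1 <= x <= 1 by move=> /andP[? ?]; lra.
apply: interior_scaling_right h0 s0 _ _ w0 _ w1 w2 _.
- by apply: pint_ge0 (ltW ab) _ => x /sub; apply: left_weight_sqr_ge0.
- by apply: pint_ge0 (ltW ab) _ => x /sub; apply: right_weight_sqr_ge0.
- by lra.
apply: le_trans (node_trace jN re).
by rewrite le_eqVlt; apply/orP; left; apply/eqP; ring.
Qed.

(** The primitive of [e] need not vanish at [1], so the endpoint contributes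
    [n w_N 2 r(1)^2 = (2 r(1))^2]. Here [2 r(1)] is the integral of [e = v - q] over [[-1, 1]]; its
    part over the last cell brings in the extra term of the bound, and [last_cell_integral_le] for
    [q]. *)
Theorem histopolation_stable_right (u v : {poly R}) : (size u <= N)%N ->
  (forall j, (j < N)%N -> pint xi`_j xi`_j.+1 u = pint xi`_j xi`_j.+1 v) ->
  ip W u u <= 10 ^+ 5 * (ip W v v + pint xi`_N.-1 1 v ^+ 2).
Proof.
move=> su huv; have [q sq oe] := ip_proj right_weight_ge0 N v.
have n2 := lobatto_eig_ge2 R N_gt0.
have node_eq i (iN : (i <= N)%N) := pint_node_eq hxi iN huv.
have [d uq] : exists d, d = u - q by exists (u - q).
have [e vq] : exists e, e = v - q by exists (v - q).
rewrite -vq in oe.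
have sd : (size d <= N)%N.
  by rewrite uq (leq_trans (size_polyD _ _)) // geq_max su size_polyN.
have node_de i : (i <= N)%N -> pint (-1) xi`_i d = pint (-1) xi`_i e.
  by move=> iN; rewrite uq vq !pintB node_eq.
have [s [sd' spot]] := primitive_div d.
have [r [re rpot]] := primitive_div e.
have ss := primitive_div_size sd sd'.
have or := cross_orth re oe.
have sr i : (0 < i <= N)%N -> s.[xi`_i] = r.[xi`_i].
  move=> /andP[i0 iN]; have h : 1 + xi`_i != 0.
    by have := @node_gtm1 _ _ _ hxi i; rewrite i0 iN => /(_ isT); lra.
  by apply: (mulfI h); rewrite -spot -rpot node_de.
have eE : ip W e e = ip V r r + jacobi_energy V r r by rewrite -re cross_energy.
have dE : ip W d d = ip V s s + jacobi_energy V s s by rewrite -sd' cross_energy.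
have be0 : 0 <= (1 : R) by [].
have rr0 := ip_ge0 left_weight_ge0 r.
have ss0 := ip_ge0 left_weight_ge0 s.
have dd : ip W d d <= n * ip V s s.
  have ss' : (size s <= N.-1.+1)%N by rewrite prednK.
  have := energy_le left_weight_ge0 left_weight_deriv be0 ss'.
  rewrite dE; set x := ip V s s; set b := jacobi_energy _ _ _ => h.
  apply: (le_trans (lerD (lexx x) h)).
  rewrite -[X in X + _]mul1r -mulrDl; apply: ler_wpM2r => //.
  have NE : N%:R = N.-1%:R + 1 :> R by rewrite natr1 prednK.
  by rewrite /jacobi_eig /lobatto_eig NE; have := ler0n R N.-1; lra.
have ee : n * ip V r r <= ip W e e.
  have := energy_ge left_weight_ge0 left_weight_deriv be0 or.
  rewrite eE => h; apply: (@le_trans _ _ (ip V r r + jacobi_eig 1 N * ip V r r)).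
    2: by rewrite lerD2l.
  have -> : ip V r r + jacobi_eig 1 N * ip V r r = (1 + jacobi_eig 1 N) * ip V r r by ring.
  apply: ler_wpM2r => //.
  by rewrite /jacobi_eig /lobatto_eig; have := ler0n R N; lra.
have e0 := ip_ge0 right_weight_ge0 e.
have q0 := ip_ge0 right_weight_ge0 q.
(* Sampling and [cell_ge] give [(1 - b) g <= 3 h |e|^2], and [h <= 19 (1 - b)] by [cell_ratio]:
   [57 = 3 * 19]. With a single cell the left end is [-1] and the term vanishes. *)
have gb : ((1 + xi`_N.-1) * r.[xi`_N.-1]) ^+ 2 <= 57 * ip W e e.
  case EN: N.-1 => [|j]; first by rewrite (node0 hxi) subrr mul0r expr0n /= mulr_ge0.
  have jN : (j.+1 < N)%N by rewrite -EN ltn_predL.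
  have b1 := node_lt1 hxi jN; have ab := node_lt hxi (ltnSn j) (ltnW jN).
  have a0 := node_ge hxi (ltnW (ltnW jN)).
  have b1' := node_le1 hxi (ltnW jN).
  have h1 := node_trace jN re; have h2 := cell_ge N_gt0 hxi jN.
  have h3 := cell_ratio N_gt0 hxi jN.
  have f1 : pint xi`_j xi`_j.+1 (V * r * r) <= ip V r r.
    by apply: pint_sub; rewrite ?(ltW ab) //; exact: left_weight_sqr_ge0.
  have f2 : pint xi`_j xi`_j.+1 (W * e * e) <= ip W e e.
    by apply: pint_sub; rewrite ?(ltW ab) //; exact: right_weight_sqr_ge0.
  have f10 : 0 <= pint xi`_j xi`_j.+1 (V * r * r).
    apply: pint_ge0 (ltW ab) _ => x /andP[? ?]; apply: left_weight_sqr_ge0; lra.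
  move: b1 ab h1 h2 h3 f1 f2 f10 ee.
  move: (pint xi`_j xi`_j.+1 (V * r * r)) (pint xi`_j xi`_j.+1 (W * e * e)).
  move: (xi`_j.+1) (xi`_j) (r.[_]) (ip V r r) (ip W e e) => b a y rr E f1 f2.
  move=> b1 ab h1 h2 h3 f1r f2E f10 ee.
  set g := ((1 + b) * y) ^+ 2 in h1 *.
  have hb : 0 < (b - a) * (1 - b) by apply: mulr_gt0; lra.
  have E1 : n * f1 <= E by apply: le_trans ee; apply: ler_wpM2l => //; lra.
  have g0 : 0 <= g by exact: sqr_ge0.
  have k1 := ler_wpM2r f10 h2.
  have k2 := ler_wpM2l (sqr_ge0 (b - a)) E1.
  have k3 := ler_wpM2l (sqr_ge0 (b - a)) f2E.
  have E0 : 0 <= E by apply: le_trans E1; apply: mulr_ge0 => //; lra.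
  have k4 : 0 <= (19 * (1 - b) - (b - a)) * ((b - a) * E).
    by apply: mulr_ge0; [lra | apply: mulr_ge0 => //; lra].
  by rewrite -(ler_pM2l hb); move: h1 k1 k2 k3 k4; rewrite !expr2; lra.
have g1 : (2 * r.[1]) ^+ 2 <= 3 * (57 * ip W e e + pint xi`_N.-1 1 v ^+ 2 + 1300 * ip W q q).
  have := last_cell_integral_le sq.
  have -> : 2 * r.[1] = (1 + xi`_N.-1) * r.[xi`_N.-1] + (pint xi`_N.-1 1 v - pint xi`_N.-1 1 q).
    by rewrite -(rpot xi`_N.-1) -pintB -vq pint_cat rpot.
  move: gb; move: (_ * r.[_]) (pint _ _ v) (pint _ _ q) => x y z gb hz.
  have := sqr_ge0 (x - y); have := sqr_ge0 (x + z); have := sqr_ge0 (y + z).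
  move: gb hz; rewrite !expr2; lra.
have hs : n * ip V s s <= 46 * n * ip V r r + 430 * ip W e e + (2 * r.[1]) ^+ 2.
  have size_q : (size (V * s * s)%R <= 2 * N)%N.
    have sV : (size (V : {poly R}) <= 2)%N.
      by rewrite (leq_trans (size_polyD _ _)) // geq_max size_polyX size_poly1.
    have -> : V * s * s = s * (V * s) by ring.
    have ss' : (size s <= N.-1.+1)%N by rewrite prednK.
    apply: leq_trans (size_mul_lt ss' (size_mul_lt sV ss)) _.
    by rewrite add1n addnS -addSn prednK // mul2n addnn.
  rewrite {1}/ip (lobatto_quadrature N_gt0 hxi size_q) mulr_sumr.
  have -> : 46 * n * ip V r r + 430 * ip W e e = pint (-1) 1
     ((46 * n)%:P * (V * r * r) + 430%:P * (W * e * e)) by rewrite pintD !pintZ.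
  apply: (sum_interior_le N_gt0 hxi).
  - by rewrite (node0 hxi) !hE; ring.
  - rewrite (lobatto_weight_last hxi) (nodeN hxi) !hE.
    have -> : s.[1] = r.[1] by have := sr N; rewrite N_gt0 leqnn (nodeN hxi); apply.
    rewrite le_eqVlt; apply/orP; left; apply/eqP; field; lra.
  - move=> x /andP[x0 x1]; rewrite !hE; apply: addr_ge0.
      apply: mulr_ge0; first by apply: mulr_ge0; lra.
      by rewrite -mulrA; apply: mulr_ge0 (sqr_ge0 _); lra.
    apply: mulr_ge0; first exact: ler0n.
    by rewrite -mulrA; apply: mulr_ge0 (sqr_ge0 _); lra.
  - move=> j jN; apply: interior_node_le_right => //; apply: sr; exact: ltnW.
have er : ip W e q = 0 by apply: oe.
have ev : ip W v v = ip W e e + ip W q q.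
  have -> : v = e + q by rewrite vq subrK.
  by rewrite (ipDl W e) !(ipDr W e q) (ipC W q e) er; ring.
have uu : ip W u u <= 2 * ip W d d + 2 * ip W q q.
  have -> : u = d + q by rewrite uq subrK.
  exact: ip_sum_le right_weight_ge0 _ _.
have f0 := sqr_ge0 (pint xi`_N.-1 1 v).
by rewrite ev; lra.
Qed.

End RightWeight.

(** * Polynomial approximation of step functions *)

Section Density.
Variable R : realType.
Implicit Types (v H : {poly R}).

(* Iterates of [s |-> s (3 - s^2) / 2], which converge to [sgn] on [-1, 1]. *)
Fixpoint sign_poly k : {poly R} :=
  if k is k'.+1 then (2^-1)%:P * sign_poly k' * (3%:P - sign_poly k' ^+ 2) else 'X.

Lemma sign_polyS k x : (sign_poly k.+1).[x] =
  2^-1 * (sign_poly k).[x] * (3 - (sign_poly k).[x] ^+ 2).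
Proof. by rewrite /= !hE. Qed.

Lemma sign_polyN k x : (sign_poly k).[- x] = - (sign_poly k).[x].
Proof. by elim: k => [|k IH]; rewrite ?hornerX // !sign_polyS IH; ring. Qed.

(** One iteration multiplies the error [1 - s] by [1 - s / 2 - s^2 / 2], and [s >= x] throughout.
    The rate degenerates at [0], but its integral is of order [1 / k], which suffices for
    convergence in L2. *)
Lemma sign_poly_bound k x : 0 <= x <= 1 ->
  [/\ x <= (sign_poly k).[x], (sign_poly k).[x] <= 1 &
      1 - (sign_poly k).[x] <= (1 - x / 2) ^+ k].
Proof.
move=> /andP[x0 x1]; elim: k => [|k [xs s1 IH]].
  by rewrite hornerX expr0; split=> //; lra.
rewrite sign_polyS; move: xs s1 IH; move: (sign_poly k).[x] => s xs s1 IH.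
have e : 1 - 2^-1 * s * (3 - s ^+ 2) = (1 - s) * ((1 - s) * (2 + s) / 2) by field.
have h0 : 0 <= (1 - s) * (2 + s) / 2 by rewrite divr_ge0 // mulr_ge0 //; lra.
split.
- have : 0 <= s * (1 - s) * (1 + s) by apply: mulr_ge0; [apply: mulr_ge0; lra | lra].
  by rewrite !expr2; lra.
- by rewrite -subr_ge0 e mulr_ge0 // subr_ge0.
- rewrite e exprSr; apply: ler_pM => //; first by rewrite subr_ge0.
  have : 0 <= s ^+ 2 by exact: sqr_ge0.
  by rewrite !expr2; lra.
Qed.

Lemma pint_pow_le (a b c : R) k : 0 < c -> a <= b -> 0 <= 1 - c * (b - a) ->
  pint a b ((1 - c%:P * ('X - a%:P)) ^+ k) <= (c * k.+1%:R)^-1.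
Proof.
move=> c0 ab h; have k0 : 0 < (k.+1%:R : R) by rewrite ltr0n.
have ck : c * k.+1%:R != 0 by rewrite mulf_neq0 ?gt_eqF.
set L := 1 - c%:P * _; have dL : L^`() = - c%:P.
  by rewrite /L !(derivM, derivB, derivC, derivX); ring.
rewrite (@pintE _ _ _ _ ((- (c * k.+1%:R)^-1)%:P * L ^+ k.+1)); last first.
  rewrite derivZ_C deriv_exp dL /=.
  have e : (- (c * k.+1%:R)^-1)%:P * - c%:P * (k.+1%:R)%:P = 1 :> {poly R}.
    rewrite -polyCN -!polyCM -polyC1; congr polyC.
    by rewrite mulrNN -mulrA mulVf.
  transitivity ((- (c * k.+1%:R)^-1)%:P * - c%:P * (k.+1%:R)%:P * L ^+ k).
    by rewrite rmorph_nat; ring.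
  by rewrite e mul1r.
have La : L.[a] = 1 by rewrite /L !hE subrr mulr0 subr0.
have Lb : L.[b] = 1 - c * (b - a) by rewrite /L !hE.
rewrite !(hornerM _%:P) !hornerC !horner_exp La Lb expr1n.
have : 0 <= (c * k.+1%:R)^-1 * (1 - c * (b - a)) ^+ k.+1.
  by rewrite mulr_ge0 ?exprn_ge0 // invr_ge0 mulr_ge0 // ltW.
by move: (_^-1) (_ ^+ k.+1) => A X; lra.
Qed.

Lemma pint_opp (a b : R) (p : {poly R}) : pint (- b) (- a) (p \Po (- 'X)) = pint a b p.
Proof.
rewrite (@pintE _ _ _ _ (- (prim p \Po (- 'X)))).
  by rewrite !hornerN !horner_comp !hornerN !hornerX !opprK /pint; ring.
by rewrite derivN deriv_comp deriv_prim derivN derivX; ring.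
Qed.

Lemma heaviside_approx (a e : R) : -1 <= a <= 1 -> 0 < e ->
  exists H, pint (-1) a (H ^+ 2) <= e /\ pint a 1 ((H - 1) ^+ 2) <= e.
Proof.
move=> /andP[a0 a1] e0.
have [k hk] : exists k : nat, 4 / e < k%:R.
  by exists (Num.truncn (4 / e)).+1; rewrite truncnS_gt.
have ek : (4^-1 * k.+1%:R)^-1 <= e.
  rewrite invfM invrK ler_pdivrMr ?ltr0n // mulrC -ler_pdivrMr //.
  by rewrite -natr1; lra.
(* Halving [x - a] keeps the argument in [[-1, 1]]. *)
pose H := (2^-1)%:P * (1 + (sign_poly k \Po ((2^-1)%:P * ('X - a%:P)))).
have HE x : H.[x] = 2^-1 * (1 + (sign_poly k).[2^-1 * (x - a)]).
  by rewrite /H !hE horner_comp !hE.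
exists H; split.
  rewrite -pint_opp.
  apply: le_trans (_ : _ <= pint (- a) (- (-1)) ((1 - (4^-1)%:P * ('X - (- a)%:P)) ^+ k)) _.
    apply: pint_le => [|x /andP[ax x1]]; first by lra.
    have hy : 0 <= 2^-1 * (x + a) <= 1 by apply/andP; split; lra.
    have [xs s1 b] := sign_poly_bound k hy.
    rewrite horner_comp hornerN hornerX (horner_exp H) HE !hE.
    have -> : 2^-1 * (- x - a) = - (2^-1 * (x + a)) by ring.
    rewrite sign_polyN.
    have -> : 1 - 4^-1 * (x - - a) = 1 - 2^-1 * (x + a) / 2 by field.
    apply: le_trans b; move: xs s1; move: (sign_poly k).[_] => s xs s1; nra.
  by apply: le_trans (pint_pow_le _ _ _ _) ek => //; lra.
apply: le_trans (_ : _ <= pint a 1 ((1 - (4^-1)%:P * ('X - a%:P)) ^+ k)) _.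
  apply: pint_le => // x /andP[ax x1].
  have hy : 0 <= 2^-1 * (x - a) <= 1 by apply/andP; split; lra.
  have [xs s1 b] := sign_poly_bound k hy.
  rewrite (horner_exp (H - 1)) (hornerD H) HE !hE.
  have -> : 1 - 4^-1 * (x - a) = 1 - 2^-1 * (x - a) / 2 by field.
  apply: le_trans b; move: xs s1; move: (sign_poly k).[_] => s xs s1; nra.
by apply: le_trans (pint_pow_le _ _ _ _) ek => //; lra.
Qed.

Lemma pint_sqrD_le (a b : R) (p q : {poly R}) : a <= b ->
  pint a b ((p + q) ^+ 2) <= 2 * pint a b (p ^+ 2) + 2 * pint a b (q ^+ 2).
Proof.
move=> ab; rewrite -!pintZ -pintD; apply: pint_le => // x _.
by rewrite !hE; have := sqr_ge0 (p.[x] - q.[x]); rewrite !expr2; lra.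
Qed.

Lemma pint_sqr_ge0 (a b : R) (p : {poly R}) : a <= b -> 0 <= pint a b (p ^+ 2).
Proof. by move=> ab; apply: pint_ge0 => // x _; rewrite horner_exp sqr_ge0. Qed.

Lemma step_approx (N : nat) (xi : nat -> R) (c : nat -> R) :
  (forall i, (i < N)%N -> xi i <= xi i.+1) -> xi 0%N = -1 -> xi N = 1 ->
  forall e, 0 < e -> exists v, forall i, (i < N)%N ->
    pint (xi i) (xi i.+1) ((v - (c i)%:P) ^+ 2) <= e.
Proof.
move=> mono x0 xN.
have mono2 i j : (i <= j)%N -> (j <= N)%N -> xi i <= xi j.
  elim: j => [|j IH]; first by rewrite leqn0 => /eqP ->.
  rewrite leq_eqVlt => /predU1P[-> //|ij] jN.
  by apply: le_trans (IH ij (ltnW jN)) (mono _ jN).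
(* For the induction [v] must also be close to [c m] on all of [[xi m, 1]]; the next jump is then
   added as a multiple of a smoothed Heaviside function. The value [c N] only concerns a degenerate
   interval. *)
suff h m : (m <= N)%N -> forall e, 0 < e -> exists v, (forall i, (i < m)%N ->
    pint (xi i) (xi i.+1) ((v - (c i)%:P) ^+ 2) <= e) /\
    pint (xi m) 1 ((v - (c m)%:P) ^+ 2) <= e.
  by move=> e e0; have [v [hv _]] := h N (leqnn N) e e0; exists v.
elim: m => [|m IH] mN e e0.
  by exists (c 0%N)%:P; split=> //; rewrite subrr expr0n /= pint0 ltW.
pose d := c m.+1 - c m.
have e4 : 0 < e / 4 by lra.
have d1 : 0 < 4 * (d ^+ 2 + 1) by have := sqr_ge0 d; lra.
have ed : 0 < e / (4 * (d ^+ 2 + 1)) by rewrite divr_gt0.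
have ed' : d ^+ 2 * (e / (4 * (d ^+ 2 + 1))) <= e / 4.
  rewrite mulrA ler_pdivrMr //; have := sqr_ge0 d; nra.
have [v [hv hv1]] := IH (ltnW mN) _ e4.
have xm1 : -1 <= xi m.+1 <= 1 by rewrite -x0 -xN !mono2.
have [H [H0 H1]] := heaviside_approx xm1 ed.
have [xm1a xm1b] := andP xm1.
have key a b (p q : {poly R}) : a <= b -> pint a b (p ^+ 2) <= e / 4 ->
    pint a b (q ^+ 2) <= e / (4 * (d ^+ 2 + 1)) ->
    pint a b ((p + d%:P * q) ^+ 2) <= e.
  move=> ab h1 h2; apply: (le_trans (pint_sqrD_le _ _ ab)).
  rewrite exprMn -polyC_exp pintZ.
  have := ler_wpM2l (sqr_ge0 d) h2; lra.
have sub_l i : (i <= m)%N -> pint (xi i) (xi i.+1) (H ^+ 2) <= e / (4 * (d ^+ 2 + 1)).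
  move=> im; apply: le_trans H0; rewrite -x0; apply: pint_sub; rewrite ?mono2 //.
  - exact: leq_trans im (ltnW mN).
  - exact: leq_ltn_trans mN.
  - by move=> x _; rewrite horner_exp sqr_ge0.
exists (v + d%:P * H); split=> [i|].
  rewrite ltnS => im; rewrite addrAC; apply: key; last exact: sub_l.
    by apply: mono; apply: leq_ltn_trans mN.
  move: im; rewrite leq_eqVlt => /predU1P[->|im]; last exact: hv.
  by apply: le_trans hv1; apply: pint_sub; rewrite ?mono // => x _; rewrite horner_exp sqr_ge0.
have -> : v + d%:P * H - (c m.+1)%:P = (v - (c m)%:P) + d%:P * (H - 1).
  by rewrite /d polyCB; ring.
apply: key => //; apply: le_trans hv1.
by apply: pint_sub; rewrite ?mono // => x _; rewrite horner_exp sqr_ge0.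
Qed.

End Density.

(** * Norm equivalence on polynomials *)

Section Interpolation.
Variables (R : realType) (N : nat) (xi : N.+1.-tuple R).
Hypothesis N_gt0 : (0 < N)%N.
Hypothesis hxi : gauss_lobatto xi.
Implicit Types (p q v : {poly R}) (i j : nat).
Local Notation cell i := (pint xi`_i xi`_i.+1).

Lemma cell_itv i x : (i < N)%N -> xi`_i <= x <= xi`_i.+1 -> -1 <= x <= 1.
Proof.
move=> iN /andP[ix xi1]; have := node_ge hxi (ltnW iN); have := node_le1 hxi iN.
by move=> ? ?; apply/andP; split; lra.
Qed.

Lemma cell_itvoo i x : (i < N)%N -> xi`_i < x < xi`_i.+1 -> -1 < x < 1.
Proof.
move=> iN /andP[ix xi1]; have := node_ge hxi (ltnW iN); have := node_le1 hxi iN.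
by move=> ? ?; apply/andP; split; lra.
Qed.

Lemma cell_lt i : (i < N)%N -> xi`_i < xi`_i.+1.
Proof. by move=> iN; apply: (node_lt hxi). Qed.

Lemma sum_cells F : \sum_(0 <= i < N) cell i F = pint (-1) 1 F.
Proof. by rewrite (pint_nodes hxi) // (nodeN hxi). Qed.

Variable (Wd : {poly R}).
Hypothesis Wd_gt0 : forall x, -1 < x < 1 -> 0 < Wd.[x].

(** The mean value theorem puts a zero of [q] inside each of the [N] cells, one more than its degree
    allows. *)
Lemma histopolant_eq0 q : (size q <= N)%N ->
  (forall i, (i < N)%N -> cell i (Wd * q) = 0) -> q = 0.
Proof.
move=> sq hq; apply/eqP/negPn/negP => q0.
have /choice[z hz] : forall i, exists z, (i < N)%N -> xi`_i < z < xi`_i.+1 /\ q.[z] = 0.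
  move=> i.
  have [iN|iN] := ltnP i N; last by exists 0.
  have [c [hc]] := pint_mvt (Wd * q) (cell_lt iN); rewrite hq //.
  move=> /esym/eqP; rewrite mulf_eq0 subr_eq0 (gt_eqF (cell_lt iN)) orbF hornerM mulf_eq0.
  rewrite gt_eqF ?Wd_gt0 ?(cell_itvoo iN hc) //= => /eqP qc.
  by exists c.
have zlt i j : (i < j)%N -> (j < N)%N -> z i < z j.
  move=> ij jN; have [/andP[_ h1] _] := hz _ (ltn_trans ij jN).
  have [/andP[h2 _] _] := hz _ jN.
  by apply: lt_trans h1 (le_lt_trans _ h2); apply: (node_le hxi) => //; exact: ltnW.
have : (size [seq z i | i <- iota 0 N] < size q)%N.
  apply: max_poly_roots => //.
    apply/allP => _ /mapP[i + ->]; rewrite mem_iota add0n => /andP[_ iN].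
    by apply/rootP; case: (hz _ iN).
  rewrite map_inj_in_uniq ?iota_uniq // => i j; rewrite !mem_iota !add0n /= => iN jN zij.
  have [ij|ij|//] := ltngtP i j.
    by have := zlt _ _ ij jN; rewrite zij ltxx.
  by have := zlt _ _ ij iN; rewrite zij ltxx.
by rewrite size_map size_iota ltnNge sq.
Qed.

Lemma histopolant_ex (f : 'I_N -> R) :
  exists2 q : {poly R}, (size q <= N)%N & forall i : 'I_N, cell i (Wd * q) = f i.
Proof.
pose M : 'M[R]_N := \matrix_(i, j) cell j (Wd * 'X^i).
have act (a : 'rV[R]_N) (j : 'I_N) : cell j (Wd * rVpoly a) = (a *m M) 0 j.
  rewrite mxE; have -> : rVpoly a = \sum_(i < N) (a 0 i)%:P * 'X^i.
    rewrite /rVpoly poly_def; apply: eq_bigr => i _.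
    by rewrite valK mul_polyC.
  rewrite mulr_sumr pint_sum; apply: eq_bigr => i _.
  by rewrite mxE mulrCA pintZ.
have Mfree : M \in unitmx.
  rewrite -row_free_unit; apply: inj_row_free => a aM.
  have : rVpoly a = 0.
    apply: histopolant_eq0 => [|i iN]; first exact: size_poly.
    by rewrite (act a (Ordinal iN)) aM mxE.
  by move=> h; rewrite -(rVpolyK a) h linear0.
exists (rVpoly ((\row_i f i) *m invmx M)); first exact: size_poly.
by move=> i; rewrite act mulmxKV // mxE.
Qed.

End Interpolation.

Section NormEquivalence.
Variables (R : realType) (N : nat) (xi : N.+1.-tuple R).
Hypothesis N_gt0 : (0 < N)%N.
Hypothesis hxi : gauss_lobatto xi.
Implicit Types (p q v : {poly R}) (i j : nat).
Local Notation cell i := (pint xi`_i xi`_i.+1).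

Variables (W Wd : {poly R}).
Hypothesis W_bound : forall x, -1 <= x <= 1 -> 0 <= W.[x] <= 2.
Hypothesis Wd_bound : forall x, -1 <= x <= 1 -> 0 <= Wd.[x] <= 2.
Hypothesis Wd_gt0 : forall x, -1 < x < 1 -> 0 < Wd.[x].

Let W_ge0 x : -1 <= x <= 1 -> 0 <= W.[x].
Proof. by move=> /W_bound/andP[]. Qed.

(** [K] depends on the nodes, hence on [N]; this is harmless because it only multiplies an
    approximation error that is made arbitrarily small. *)
Lemma small_data_poly : exists2 K : R, 0 <= K & forall (d : 'I_N -> R) (e : R),
  (forall i : 'I_N, d i ^+ 2 <= e) -> exists q : {poly R},
    [/\ (size q <= N)%N, forall i : 'I_N, cell i (Wd * q) = d i & ip W q q <= K * e].
Proof.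
have /choice[b hb] : forall i : 'I_N, exists b : {poly R}, (size b <= N)%N /\
    forall j : 'I_N, cell j (Wd * b) = (i == j)%:R.
  move=> i.
  by have [q sq hq] := histopolant_ex hxi Wd_gt0 (fun j : 'I_N => (i == j)%:R); exists q.
have [K K0 hK] : exists2 K : R, 0 <= K & forall (d : 'I_N -> R) (e : R),
    (forall i : 'I_N, d i ^+ 2 <= e) ->
    ip W (\sum_(i < N) (d i)%:P * b i) (\sum_(i < N) (d i)%:P * b i) <= K * e.
  elim: (index_enum _) => [|i s [K K0 IH]].
    by exists 0 => // d e _; rewrite !big_nil /ip mulr0 pint0 mul0r.
  exists (2 * ip W (b i) (b i) + 2 * K).
    by apply: addr_ge0; apply: mulr_ge0 => //; exact: ip_ge0.
  move=> d e hd; rewrite !big_cons; apply: (le_trans (ip_sum_le W_ge0 _ _)).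
  rewrite ipZl ipZr; have := IH d e hd; have := ip_ge0 W_ge0 (b i).
  have := hd i; set x := ip W (b i) _; set y := ip W _ _ => h1 h2 h3.
  by have := ler_wpM2r h2 h1; rewrite !expr2; lra.
exists K => // d e hd; exists (\sum_(i < N) (d i)%:P * b i); split; last exact: hK.
  apply: (leq_trans (size_sum _ _ _)); apply/bigmax_leqP => i _.
  by rewrite mul_polyC (leq_trans (size_scale_leq _ _)) //; case: (hb i).
move=> j; rewrite mulr_sumr pint_sum (bigD1 j) //= mulrCA pintZ.
have [_ ->] := hb j; rewrite eqxx mulr1 big1 ?addr0 // => i ij.
by rewrite mulrCA pintZ; have [_ ->] := hb i; rewrite (negPf ij) mulr0.
Qed.

Variables (C : R).
Hypothesis C_ge0 : 0 <= C.
Hypothesis stable : forall q v, (size q <= N)%N ->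
  (forall j, (j < N)%N -> cell j (Wd * q) = cell j (Wd * v)) ->
  ip W q q <= C * (ip W v v + pint xi`_N.-1 1 (Wd * v) ^+ 2).

Lemma cell_pos i : (i < N)%N -> 0 < pint xi`_i xi`_i.+1 Wd.
Proof.
move=> iN; have [c [hc ->]] := pint_mvt Wd (cell_lt hxi iN).
by rewrite mulr_gt0 ?subr_gt0 ?cell_lt // Wd_gt0 // (cell_itvoo hxi iN).
Qed.

(* The step function with values [c i] is an L2 limit of polynomials [v], to
   which [stable] applies after a small correction of [q]. *)
Lemma histopolant_le (q : {poly R}) (c : nat -> R) : (size q <= N)%N ->
  (forall i, (i < N)%N -> cell i (Wd * q) = c i * cell i Wd) ->
  pint xi`_N.-1 1 (Wd * q) ^+ 2 <= 4 * (\sum_(0 <= i < N) c i ^+ 2 * cell i W) ->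
  ip W q q <= 20 * C * (\sum_(0 <= i < N) c i ^+ 2 * cell i W).
Proof.
set S := \sum_(0 <= i < N) _ => sq hq last.
have [K K0 hK] := small_data_poly.
(* [D] collects everything that multiplies the error [e]; it may depend on the nodes since [e] is
   arbitrary. The factor [20] of [C * S] is [2 (2 + 8)], from [vle] and [flast]. *)
pose D : R := 2 * C * (4 * N%:R + 16) + 16 * K.
have D0 : 0 <= D by have := C_ge0; have := mulr_ge0 C_ge0 (ler0n R N); rewrite /D; lra.
suff h e : 0 < e -> ip W q q <= 20 * C * S + D * e.
  rewrite leNgt; apply/negP => lt.
  have [t t0 tE] : exists2 t, 0 < t & 2 * (D + 1) * t = ip W q q - 20 * C * S.
    exists ((ip W q q - 20 * C * S) / (2 * (D + 1))).
      by rewrite divr_gt0 ?subr_gt0 //; lra.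
    by field; lra.
  have := h _ t0; have := mulr_ge0 D0 (ltW t0); lra.
move=> e0.
have mono i : (i < N)%N -> xi`_i <= xi`_i.+1 by move=> iN; apply/ltW/(cell_lt hxi).
have [v hv] := step_approx c mono (node0 hxi) (nodeN hxi) e0.
have NN : (N.-1 < N)%N by rewrite ltn_predL.
have dE i : (i < N)%N -> c i * cell i Wd - cell i (Wd * v) = - cell i (Wd * (v - (c i)%:P)).
  by move=> iN; rewrite (mulrBr Wd) pintB [Wd * _%:P]mulrC pintZ; ring.
have dle i : (i < N)%N -> (c i * cell i Wd - cell i (Wd * v)) ^+ 2 <= 8 * e.
  move=> iN; rewrite dE // sqrrN; apply: (le_trans (pint_CS1 _ _ (mono _ iN))).
  apply: ler_pM; rewrite ?pint_sqr_ge0 ?mono ?hv //.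
  apply: (@le_trans _ _ (pint xi`_i xi`_i.+1 4%:P)).
    apply: pint_le (mono _ iN) _ => x /(cell_itv hxi iN)/Wd_bound/andP[w0 w2].
    by rewrite hornerC horner_exp; nra.
  rewrite pint_const; have := node_ge hxi (ltnW iN); have := node_le1 hxi iN; lra.
have [q2 [sq2 hq2 q2le]] := hK (fun i : 'I_N => c i * cell i Wd - cell i (Wd * v)) _
  (fun i : 'I_N => dle i (ltn_ord i)).
have [q1 qq] : exists q1, q1 = q - q2 by exists (q - q2).
have sq1 : (size q1 <= N)%N.
  by rewrite qq (leq_trans (size_polyD _ _)) // geq_max sq size_polyN.
have hq1 j : (j < N)%N -> cell j (Wd * q1) = cell j (Wd * v).
  move=> jN; rewrite qq (mulrBr Wd) pintB hq // (hq2 (Ordinal jN)) /=; ring.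
have := stable sq1 hq1.
have vle : ip W v v <= 4 * N%:R * e + 2 * S.
  rewrite /ip -(sum_cells hxi) /S mulr_sumr.
  have -> : 4 * N%:R * e = \sum_(0 <= i < N) 4 * e.
    by rewrite big_const_nat subn0 iter_addr_0 -mulr_natr; ring.
  rewrite -big_split /= !big_nat; apply: ler_sum => i /andP[_ iN].
  have -> : 4 * e + 2 * (c i ^+ 2 * cell i W) = 4 * e + cell i ((2 * c i ^+ 2)%:P * W).
    by rewrite pintZ; ring.
  have := ler_wpM2l (ler0n R 4) (hv _ iN); rewrite -pintZ => h.
  apply: le_trans (_ : _ <= cell i (4%:P * (v - (c i)%:P) ^+ 2 + (2 * c i ^+ 2)%:P * W)) _.
    apply: pint_le (mono _ iN) _ => x /(cell_itv hxi iN)/W_bound/andP[w0 w2].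
    rewrite !hE; move: (v.[x]) (W.[x]) (c i) w0 w2 => y z k w0 w2.
    have : 0 <= z * (y - 2 * k) ^+ 2 by apply: mulr_ge0 => //; exact: sqr_ge0.
    have : 0 <= (2 - z) * (y - k) ^+ 2 by apply: mulr_ge0; [lra | exact: sqr_ge0].
    by rewrite !expr2; lra.
  by rewrite pintD; lra.
have flast : pint xi`_N.-1 1 (Wd * v) ^+ 2 <= 8 * S + 16 * e.
  have := dle _ NN; rewrite -hq // prednK // (nodeN hxi).
  move: last; move: (pint _ _ (Wd * q)) (pint _ _ (Wd * v)) => x y hx hxy.
  have : 0 <= (2 * x - y) ^+ 2 by exact: sqr_ge0.
  by move: hx hxy; rewrite !expr2; lra.
have qle : ip W q q <= 2 * ip W q1 q1 + 2 * ip W q2 q2.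
  have -> : q = q1 + q2 by rewrite qq subrK.
  exact: ip_sum_le W_ge0 _ _.
have cc := ler_wpM2l C_ge0 (lerD vle flast) => h.
have := le_trans h cc.
rewrite /D; lra.
Qed.

End NormEquivalence.

(** * The weights 1 and 1 - x *)

Section Instances.
Variables (R : realType) (N : nat) (xi : N.+1.-tuple R).
Hypothesis N_gt0 : (0 < N)%N.
Hypothesis hxi : gauss_lobatto xi.
Implicit Types (p q v : {poly R}) (i j : nat).
Local Notation cell i := (pint xi`_i xi`_i.+1).
Local Notation W := (1 - 'X : {poly R}).

Lemma vanish_div p : p.[-1] = 0 -> p.[1] = 0 -> exists k, p = (1 - 'X ^+ 2) * k.
Proof.
move=> /rootP/factor_theorem[r ->]; rewrite !hE => h.
have : root r 1.
  apply/rootP; move/eqP: h; rewrite mulf_eq0 => /orP[/eqP //|/eqP]; lra.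
move=> /factor_theorem[s ->]; exists (- s); rewrite polyCN polyC1; ring.
Qed.

(** Evaluating [p' = W q] at [1] shows that [p] has a double root there. *)
Lemma vanish_div_right p q : p^`() = W * q -> p.[-1] = 0 -> p.[1] = 0 ->
  exists k, p = W * (1 - 'X ^+ 2) * k.
Proof.
move=> dp pm p1; have [k pk] := vanish_div pm p1.
have : root k 1.
  apply/rootP; have := congr1 (fun r => r.[1]) dp.
  by rewrite pk expr2 !(derivM, derivB, deriv1, derivX) !hE; lra.
move=> /factor_theorem[s ks]; exists (- s); rewrite pk ks polyC1; ring.
Qed.

Lemma one_deriv : (1 : {poly R})^`() * (1 - 'X ^+ 2) = - (1 * (0%:P + 0%:P * 'X)).
Proof. by rewrite deriv1 !polyC0; ring. Qed.

Lemma stable_one q v : (size q <= N)%N ->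
  (forall j, (j < N)%N -> cell j (1 * q) = cell j (1 * v)) ->
  ip 1 q q <= 10 ^+ 5 * (ip 1 v v + pint xi`_N.-1 1 (1 * v) ^+ 2).
Proof.
move=> sq h.
apply: (@le_trans _ _ (10 ^+ 5 * ip 1 v v)); last first.
  by apply: ler_wpM2l; [rewrite exprn_ge0 | rewrite lerDl sqr_ge0].
apply: (histopolation_stable N_gt0 hxi _ one_deriv _ _ _ _ _ sq h).
- by move=> x _; rewrite hornerC.
- by rewrite lexx ler01.
- by move=> x _; rewrite hornerC.
- by rewrite size_poly1.
- by move=> x b _ _ _; rewrite !hornerC; lra.
- by move=> p r _ pm p1; have [k ->] := vanish_div pm p1; exists k; rewrite mul1r.
Qed.

Lemma stable_right q v : (size q <= N)%N ->
  (forall j, (j < N)%N -> cell j (W * q) = cell j (W * v)) ->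
  ip W q q <= 10 ^+ 5 * (ip W v v + pint xi`_N.-1 1 (W * v) ^+ 2).
Proof.
move=> sq h.
have v0 := ip_ge0 (@right_weight_ge0 R) v.
apply: (@le_trans _ _ (10 ^+ 5 * ip W v v)); last first.
  by apply: ler_wpM2l; [rewrite exprn_ge0 | rewrite lerDl sqr_ge0].
apply: (histopolation_stable N_gt0 hxi _ (right_weight_deriv R) _ _ _ _ _ sq h).
- exact: right_weight_ge0.
- by rewrite ler01 lexx.
- by move=> x /andP[_ x1]; rewrite !hE subr_gt0.
- by rewrite (leq_trans (size_polyD _ _)) // geq_max size_polyN size_polyX size_poly1.
- by move=> x b _ _; rewrite !hE.
- exact: vanish_div_right.
Qed.

Lemma bound_one x : -1 <= x <= 1 -> 0 <= (1 : {poly R}).[x] <= 2.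
Proof. by move=> _; rewrite hornerC; apply/andP; split; lra. Qed.
Lemma bound_right x : -1 <= x <= 1 -> 0 <= W.[x] <= 2.
Proof. by move=> /andP[? ?]; rewrite !hE; apply/andP; split; lra. Qed.
Lemma pos_one x : -1 < x < 1 -> 0 < (1 : {poly R}).[x].
Proof. by move=> _; rewrite hornerC. Qed.
Lemma pos_right x : -1 < x < 1 -> 0 < W.[x].
Proof. by move=> /andP[_ ?]; rewrite !hE subr_gt0. Qed.

Section SameWeight.
Variable V : {poly R}.
Hypothesis V_bound : forall x, -1 <= x <= 1 -> 0 <= V.[x] <= 2.
Hypothesis V_gt0 : forall x, -1 < x < 1 -> 0 < V.[x].
Hypothesis V_stable : forall q v, (size q <= N)%N ->
  (forall j, (j < N)%N -> cell j (V * q) = cell j (V * v)) ->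
  ip V q q <= 10 ^+ 5 * (ip V v v + pint xi`_N.-1 1 (V * v) ^+ 2).

Lemma same_weight_equiv q : (size q <= N)%N ->
  \sum_(0 <= i < N) cell i (V * q) ^+ 2 / cell i V <= ip V q q /\
  ip V q q <= 20 * 10 ^+ 5 * \sum_(0 <= i < N) cell i (V * q) ^+ 2 / cell i V.
Proof.
move=> sq; have mono i : (i < N)%N -> xi`_i <= xi`_i.+1.
  by move=> iN; apply/ltW/(cell_lt hxi).
have pos i (iN : (i < N)%N) := cell_pos hxi V_gt0 iN.
have cs i : (i < N)%N -> cell i (V * q) ^+ 2 <= cell i V * cell i (V * q * q).
  move=> iN; have V0 x : xi`_i <= x <= xi`_i.+1 -> 0 <= V.[x].
    by move=> /(cell_itv hxi iN)/V_bound/andP[].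
  have := pint_CS 1 q (mono _ iN) V0.
  by rewrite !mulr1 expr1n mulr1 expr2 [in X in _ <= _ * X]mulrA.
split.
  rewrite /ip -(sum_cells hxi) !big_nat; apply: ler_sum => i /andP[_ iN].
  by rewrite ler_pdivrMr ?pos //; apply: le_trans (cs _ iN) _; rewrite [X in X <= _]mulrC.
have -> : \sum_(0 <= i < N) cell i (V * q) ^+ 2 / cell i V =
   \sum_(0 <= i < N) (cell i (V * q) / cell i V) ^+ 2 * cell i V.
  rewrite !big_nat; apply: eq_bigr => i /andP[_ iN].
  by field; rewrite gt_eqF ?pos.
apply: (histopolant_le N_gt0 hxi V_bound V_bound V_gt0 _ V_stable sq).
- by rewrite exprn_ge0.
- by move=> i iN; rewrite divfK // gt_eqF ?pos.
have NN : (N.-1 < N)%N by rewrite ltn_predL.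
rewrite -{3}(prednK N_gt0) big_nat_recr //= mulrDr.
apply: ler_wpDl.
  apply: mulr_ge0 => //; rewrite big_nat; apply: sumr_ge0 => i /andP[_ iN].
  by rewrite mulr_ge0 ?sqr_ge0 // ltW // pos // (ltn_trans iN).
(* The last term of the sum suffices: [V <= 2] on a cell of length at most [2]. *)
have P := pos _ NN; have V4 : cell N.-1 V <= 4.
  apply: (@le_trans _ _ (cell N.-1 2%:P)).
    by apply: pint_le (mono _ NN) _ => x /(cell_itv hxi NN)/V_bound/andP[_]; rewrite hornerC.
  rewrite pint_const; have := node_ge hxi (ltnW NN); have := node_le1 hxi NN; lra.
move: P V4; rewrite prednK // (nodeN hxi); move: (pint _ _ V) (pint _ _ (V * q)) => A B A0 A4.
have -> : 4 * ((B / A) ^+ 2 * A) = B ^+ 2 * (4 / A) by field; rewrite gt_eqF.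
by rewrite ler_peMr ?sqr_ge0 // ler_pdivlMr // mul1r.
Qed.
End SameWeight.

Lemma equiv_one q : (size q <= N)%N ->
  let S := \sum_(0 <= i < N) cell i q ^+ 2 / (xi`_i.+1 - xi`_i) in
  S <= pint (-1) 1 (q ^+ 2) /\ pint (-1) 1 (q ^+ 2) <= 20 * 10 ^+ 5 * S.
Proof.
move=> sq /=; have := same_weight_equiv bound_one pos_one stable_one sq.
rewrite /ip mul1r -expr2.
have -> // : \sum_(0 <= i < N) cell i q ^+ 2 / cell i 1 =
  \sum_(0 <= i < N) cell i q ^+ 2 / (xi`_i.+1 - xi`_i).
by apply: eq_bigr => i _; rewrite -polyC1 pint_const mul1r.
Qed.

Lemma equiv_right q : (size q <= N)%N ->
  let S := \sum_(0 <= i < N) cell i (W * q) ^+ 2 / cell i W in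
  S <= ip W q q /\ ip W q q <= 20 * 10 ^+ 5 * S.
Proof. by move=> sq; apply: (same_weight_equiv bound_right pos_right stable_right sq). Qed.

(** Outside the last cell [1 - x] varies by a factor at most [20] on each cell, and Cauchy-Schwarz
    applies cell by cell. The last term of [S] is half the squared integral of [u], which requires
    the inverse inequality: [670 = 20 + 1300 / 2]. *)
Lemma equiv_mixed (u : {poly R}) : (size u <= N)%N ->
  let S := \sum_(0 <= i < N) (cell i u / (xi`_i.+1 - xi`_i)) ^+ 2 * cell i W in
  S <= 670 * ip W u u /\ ip W u u <= 20 * 10 ^+ 5 * S.
Proof.
move=> su S; have mono i : (i < N)%N -> xi`_i <= xi`_i.+1.
  by move=> iN; apply/ltW/(cell_lt hxi).
have NN : (N.-1 < N)%N by rewrite ltn_predL.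
have h0 i : (i < N)%N -> 0 < xi`_i.+1 - xi`_i by move=> iN; rewrite subr_gt0 cell_lt.
have W0 i x : (i < N)%N -> xi`_i <= x <= xi`_i.+1 -> 0 <= W.[x].
  by move=> iN /(cell_itv hxi iN)/bound_right/andP[].
have cW0 i : (i < N)%N -> 0 <= cell i W.
  by move=> iN; apply: pint_ge0 (mono _ iN) _ => x; apply: W0.
have lastW : cell N.-1 W = (xi`_N - xi`_N.-1) ^+ 2 / 2.
  by rewrite prednK // (nodeN hxi) pint_right_weight.
have hN := h0 _ NN; rewrite prednK // in hN.
have SE : S = \sum_(0 <= i < N.-1) (cell i u / (xi`_i.+1 - xi`_i)) ^+ 2 * cell i W
    + pint xi`_N.-1 1 u ^+ 2 / 2.
  rewrite /S -{1}(prednK N_gt0) big_nat_recr //= lastW prednK //; congr (_ + _).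
  by rewrite (nodeN hxi) in hN *; field; rewrite gt_eqF.
split.
  have l := last_cell_integral_le N_gt0 hxi su.
  have -> : 670 * ip W u u = 20 * ip W u u + 650 * ip W u u.
    by move: (ip _ _ _) => z; ring.
  rewrite SE; apply: lerD; last by lra.
  apply: (@le_trans _ _ (\sum_(0 <= i < N.-1) 20 * cell i (W * u * u))).
    rewrite !big_nat; apply: ler_sum => i /andP[_ iN1].
    have iN : (i < N)%N by apply: ltn_trans NN.
    have iN' : (i.+1 < N)%N by rewrite -(prednK N_gt0) ltnS.
    have hi := h0 _ iN; have r := cell_ratio N_gt0 hxi iN'.
    have b1 := node_lt1 hxi iN'.
    have k1 : cell i u ^+ 2 <= (xi`_i.+1 - xi`_i) * cell i (u ^+ 2).
      have := pint_CS1 1 u (mono _ iN); rewrite mul1r expr1n -{1}polyC1 pint_const mul1r.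
      exact.
    have k2 : (1 - xi`_i.+1) * cell i (u ^+ 2) <= cell i (W * u * u).
      rewrite -pintZ; apply: pint_le (mono _ iN) _ => x /andP[ax xb].
      have -> : (W * u * u).[x] = (1 - x) * (u ^+ 2).[x] by rewrite !hE; ring.
      rewrite hornerM hornerC; apply: ler_wpM2r; last by lra.
      by rewrite horner_exp sqr_ge0.
    have k3 : cell i W <= (xi`_i.+1 - xi`_i) * (20 * (1 - xi`_i.+1)).
      rewrite [X in _ <= X]mulrC -pint_const; apply: pint_le (mono _ iN) _ => x /andP[ax xb].
      by rewrite hornerC !hE; lra.
    have u0 := pint_sqr_ge0 u (mono _ iN).
    move: k1 k2 k3 hi b1 u0 (cW0 _ iN); rewrite /=.
    move: (xi`_i.+1 - xi`_i) (1 - xi`_i.+1) (cell i u) (cell i (u ^+ 2))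
      (cell i (W * u * u)) (cell i W).
    move=> h b f U E w k1 k2 k3 hi b1 u0 w0.
    have -> : (f / h) ^+ 2 * w = f ^+ 2 * w / h ^+ 2 by field; rewrite gt_eqF.
    rewrite ler_pdivrMr ?exprn_gt0 //.
    apply: (@le_trans _ _ ((h * U) * (h * (20 * b)))).
      by apply: ler_pM; rewrite ?sqr_ge0.
    have := ler_wpM2l (sqr_ge0 h) k2; rewrite !expr2; lra.
  rewrite -mulr_sumr; apply: ler_wpM2l => //.
  rewrite (pint_nodes hxi) ?leq_pred //; apply: pint_sub.
  - exact: lexx.
  - by apply: (node_ge hxi); rewrite leq_pred.
  - by apply: (node_le1 hxi); rewrite leq_pred.
  - exact: right_weight_sqr_ge0.
apply: (@histopolant_le _ _ _ N_gt0 hxi W 1 bound_right bound_one pos_one (10 ^+ 5)) => //.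
- move=> q v sq h; rewrite mul1r; apply: (histopolation_stable_right N_gt0 hxi sq).
  by move=> j jN; have := h j jN; rewrite !mul1r.
- by move=> i iN; rewrite mul1r -polyC1 pint_const mul1r divfK // gt_eqF ?h0.
rewrite -/S SE mul1r mulrDr; apply: ler_wpDl; last first.
  by have := sqr_ge0 (pint xi`_N.-1 1 u); lra.
apply: mulr_ge0 => //; rewrite big_nat; apply: sumr_ge0 => i /andP[_ iN].
by rewrite mulr_ge0 ?sqr_ge0 // cW0 // (ltn_trans iN).
Qed.

End Instances.

(** * Lebesgue integrals and L2 norms *)

Import numFieldNormedType.Exports.
Local Open Scope classical_set_scope.
Local Open Scope ring_scope.

Section Measure.
Variable R : realType.
Local Notation mu := (@lebesgue_measure R).

Lemma integral_horner_cc (a b : R) (p : {poly R}) : a < b ->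
  (\int[mu]_(x in `[a, b]) (p.[x])%:E)%E = (pint a b p)%:E.
Proof.
move=> ab; rewrite (@continuous_FTC2 _ (horner p) (horner (prim p)) a b) //.
- by apply: continuous_subspaceT => x; exact: continuous_horner.
- split.
  + by move=> x _; exact: derivable_horner.
  + by apply: cvg_at_right_filter; exact: continuous_horner.
  + by apply: cvg_at_left_filter; exact: continuous_horner.
- by move=> x _; rewrite -derivE deriv_prim.
Qed.

Lemma integral_horner (a b : R) (p : {poly R}) : a < b ->
  (\int[mu]_(x in `]a, b[) (p.[x])%:E)%E = (pint a b p)%:E.
Proof.
move=> ab; rewrite -integral_horner_cc // [RHS]integral_itv_bndoo //.
by apply/measurable_EFinP; apply: measurable_poly.
Qed.

Lemma cell_integral_oo (xi : seq R) (i : nat) (f : R -> R) :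
  measurable_fun `]xi`_i, xi`_i.+1[ f ->
  cell_integral xi i f = \int[mu]_(x in `]xi`_i, xi`_i.+1[) f x.
Proof.
move=> mf; rewrite /cell_integral /Rintegral; congr fine.
by apply: integral_itv_bndoo; exact/measurable_EFinP.
Qed.

Lemma cell_integral_poly (xi : seq R) (i : nat) (f : R -> R) (p : {poly R}) :
  xi`_i < xi`_i.+1 -> (forall x, xi`_i < x < xi`_i.+1 -> f x = p.[x]) ->
  cell_integral xi i f = pint xi`_i xi`_i.+1 p.
Proof.
move=> ab fp.
have fp' : {in `]xi`_i, xi`_i.+1[, horner p =1 f}.
  by move=> x; rewrite in_itv /= => /fp ->.
rewrite cell_integral_oo; last first.
  apply: (@eq_measurable_fun _ _ _ _ _ (horner p)); last by apply: measurable_poly.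
  by move=> x; rewrite inE /= => /fp' ->.
rewrite /Rintegral; have <- : fine (pint xi`_i xi`_i.+1 p)%:E = pint xi`_i xi`_i.+1 p by [].
rewrite -integral_horner //; congr fine; apply: eq_integral => x.
by rewrite inE /= => /fp' ->.
Qed.

Lemma L2norm_sqr (f : R -> R) :
  (L2norm f ^+ 2)%E = (\int[mu]_(x in `](-1)%R, 1%R[) ((f x) ^+ 2)%:E)%E.
Proof.
rewrite /L2norm unlock /=.
have -> : (\int[mu]_x ((`|(f \_ `](-1)%R, 1%R[) x| `^ 2)%R)%:E)%E =
  (\int[mu]_(x in `](-1)%R, 1%R[) ((f x) ^+ 2)%:E)%E.
  rewrite [RHS]integral_mkcond; apply: eq_integral => x _.
  rewrite !patchE; case: ifPn => _ /=.
    by rewrite powR_mulrn // real_normK ?num_real.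
  by rewrite normr0 powR0.
set I := (\int[_]_(_ in _) _)%E.
have I0 : (0 <= I)%E by apply: integral_ge0 => x _; rewrite lee_fin sqr_ge0.
by rewrite poweR12_sqrt //; exact: sqr_sqrte.
Qed.

(** Half-open intervals make the cells a disjoint cover, while the hypotheses bear on open cells
    because the histograms are unconstrained at the nodes. Order and measurability are carried along
    for the induction. *)
Lemma integral_cells (m : nat) (x : nat -> R) (F : R -> \bar R) :
  (forall i, (i < m)%N -> x i < x i.+1) -> (forall t, (0 <= F t)%E) ->
  (forall i, (i < m)%N -> measurable_fun `]x i, x i.+1[ F) ->
  [/\ x 0%N <= x m, measurable_fun `[x 0%N, x m[ F &
  (\int[mu]_(t in `[x 0%N, x m[) F t =
    \sum_(0 <= i < m) \int[mu]_(t in `]x i, x i.+1[) F t)%E].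
Proof.
move=> xlt F0; elim: m xlt => [|m IH] xlt mF.
  rewrite big_geq // set_itvco0 integral_set0; split=> //.
  exact: measurable_fun_set0.
have [i im|i im|x0m mF' iF] := IH; first by apply: xlt; exact: ltnW.
  by apply: mF; exact: ltnW.
have xm := xlt m (ltnSn m).
have mFm : measurable_fun `[x m, x m.+1[ F.
  by apply/emeasurable_fun_itv_obnd_cbndP; apply: mF.
have E : [set` `[x 0%N, x m.+1[] = [set` `[x 0%N, x m[] `|` [set` `[x m, x m.+1[].
  by apply: itv_bndbnd_setU; rewrite bnd_simp // ltW.
have mU : measurable_fun (`[x 0%N, x m[ `|` `[x m, x m.+1[) F by apply/measurable_funU.
split; [by rewrite (le_trans x0m) // ltW | by rewrite E |].
rewrite E ge0_integral_setU //.
  by rewrite iF big_nat_recr //= integral_itv_bndoo //; apply: mF.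
apply/disj_setPS => z [/=]; rewrite !in_itv /= => /andP[_ zm] /andP[mz _].
by move: zm; rewrite ltNge mz.
Qed.

Lemma L2norm_sqr_cells (m : nat) (x : nat -> R) (f : R -> R) :
  x 0%N = -1 -> x m = 1 ->
  (forall i, (i < m)%N -> x i < x i.+1) ->
  (forall i, (i < m)%N -> measurable_fun `]x i, x i.+1[ f) ->
  (L2norm f ^+ 2 =
    \sum_(0 <= i < m) \int[mu]_(t in `]x i, x i.+1[) ((f t) ^+ 2)%:E)%E.
Proof.
move=> x0 xm xlt mf; have F0 t : (0 <= ((f t) ^+ 2)%:E)%E by rewrite lee_fin sqr_ge0.
have [|_ mF <-] := @integral_cells m x (fun t => ((f t) ^+ 2)%:E) xlt F0.
  by move=> i im; apply/measurable_EFinP; apply: measurable_funX; apply: mf.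
rewrite L2norm_sqr x0 xm [RHS]integral_itv_bndoo // -x0 -xm.
by apply: measurable_funS mF => //; apply: subset_itvr; rewrite bnd_simp.
Qed.

Lemma measurable_right_weight (p : R) (A : set R) (f : R -> R) :
  measurable_fun A f -> measurable_fun A (fun t => (1 - t) `^ p * f t).
Proof.
move=> mf; apply: measurable_funM => //.
apply: measurable_funTS; apply: (measurableT_comp (measurable_powR p)).
exact: measurable_funB.
Qed.

Lemma sqr_half_weight (t y : R) : t < 1 -> ((1 - t) `^ (2^-1) * y) ^+ 2 = (1 - t) * y ^+ 2.
Proof.
move=> t1; have h : 0 <= 1 - t by lra.
by rewrite exprMn powR12_sqrt // sqr_sqrtr.
Qed.

Lemma sqr_minus_half_weight (t y : R) : t < 1 ->
  ((1 - t) `^ (- 2^-1) * y) ^+ 2 = (1 - t)^-1 * y ^+ 2.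
Proof.
move=> t1; have h : 0 <= 1 - t by lra.
by rewrite exprMn powRN powR12_sqrt // exprVn sqr_sqrtr.
Qed.

Lemma L2norm_sqr_poly (f : R -> R) (p : {poly R}) :
  (forall t, -1 < t < 1 -> (f t) ^+ 2 = p.[t]) ->
  (L2norm f ^+ 2)%E = (pint (-1) 1 p)%:E.
Proof.
move=> fp; rewrite L2norm_sqr -integral_horner; last by lra.
by apply: eq_integral => t; rewrite inE /= in_itv /= => /fp ->.
Qed.

End Measure.

Lemma two_sided_bound_EFin (R : realType) (C a b : R) : 0 < C -> b <= C * a -> a <= C * b ->
  two_sided_bound C a%:E b%:E.
Proof.
by move=> C0 ba ab; rewrite /two_sided_bound -!EFinM !lee_fin ler_pdivrMl.
Qed.

(** * Comparison with the piecewise functions *)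

Section Corollary.
Variables (R : realType) (N : nat) (xi : N.+1.-tuple R).
Hypothesis N_gt0 : (0 < N)%N.
Hypothesis hxi : gauss_lobatto xi.
Implicit Types (p q : {poly R}) (u z : R -> R) (i j : nat).
Variable f : 'I_N -> R.
Local Notation mu := (@lebesgue_measure R).
Local Notation cell i := (pint xi`_i xi`_i.+1).
Local Notation W := (1 - 'X : {poly R}).
Local Notation h i := (xi`_i.+1 - xi`_i).

Let hlt i : (i < N)%N -> xi`_i < xi`_i.+1. Proof. exact: cell_lt. Qed.

Lemma cell_integral_horner p i : (i < N)%N -> cell_integral xi i (horner p) = cell i p.
Proof. by move=> iN; apply: cell_integral_poly => //; exact: hlt. Qed.

Lemma poly_cells_eq0 (V : {poly R}) q : (forall x, -1 < x < 1 -> 0 < V.[x]) ->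
  (size q <= N)%N -> (forall i : 'I_N, cell i (V * q) = 0) -> q = 0.
Proof.
move=> V0 sq hq; apply: (histopolant_eq0 hxi V0 sq) => i iN.
exact: hq (Ordinal iN).
Qed.

Lemma uN_ex_unique : exists! p : {poly R}, is_uN xi f p.
Proof.
have [q sq hq] := histopolant_ex hxi (@pos_one R) f.
exists q; split=> [|p [sp hp]].
  by split=> // i; rewrite cell_integral_horner // -hq mul1r.
apply/eqP; rewrite -subr_eq0; apply/eqP; apply: (poly_cells_eq0 (@pos_one R)).
  by rewrite (leq_trans (size_polyD _ _)) // geq_max sq size_polyN.
move=> i; have := hq i; have := hp i; rewrite cell_integral_horner // !mul1r pintB => -> ->.
exact: subrr.
Qed.

Lemma zN_ex_unique : exists! p : {poly R}, is_zN xi f p.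
Proof.
have [q sq hq] := histopolant_ex hxi (@pos_right R) f.
exists (W * q); split=> [|p [[r sr ->] hp]].
  split; first by exists q.
  by move=> i; rewrite cell_integral_horner // hq.
congr (_ * _); apply/eqP; rewrite -subr_eq0; apply/eqP.
apply: (poly_cells_eq0 (@pos_right R)).
  by rewrite (leq_trans (size_polyD _ _)) // geq_max sq size_polyN.
move=> i; have := hq i; have := hp i; rewrite cell_integral_horner // (mulrBr W) pintB => -> ->.
exact: subrr.
Qed.

Lemma measurable_cell u i p : (i < N)%N ->
  (forall x, xi`_i < x < xi`_i.+1 -> u x = p.[x]) -> measurable_fun `]xi`_i, xi`_i.+1[ u.
Proof.
move=> iN up; apply: (@eq_measurable_fun _ _ _ _ _ (horner p)); last by apply: measurable_poly.
by move=> x; rewrite inE /= in_itv /= => /up ->.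
Qed.

Lemma integral_cell_poly u i p : (i < N)%N ->
  (forall x, xi`_i < x < xi`_i.+1 -> u x = p.[x]) ->
  (\int[mu]_(t in `]xi`_i, xi`_i.+1[) (u t)%:E = (cell i p)%:E)%E.
Proof.
move=> iN up; rewrite -integral_horner ?hlt //; apply: eq_integral => t.
by rewrite inE /= in_itv /= => /up ->.
Qed.

Lemma cell_lt1 i x : (i < N)%N -> xi`_i < x < xi`_i.+1 -> x < 1.
Proof. by move=> iN /(cell_itvoo hxi iN)/andP[]. Qed.

Section ConstantHistogram.
Variables (p : {poly R}) (u : R -> R).
Hypothesis hp : is_uN xi f p.
Hypothesis hu : is_uh xi f u.

Let fE i (iN : (i < N)%N) : f (Ordinal iN) = cell i p.
Proof. by case: hp => _ /(_ (Ordinal iN)) <-; rewrite cell_integral_horner. Qed.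

Let uE i x : (i < N)%N -> xi`_i < x < xi`_i.+1 -> u x = (cell i p / h i)%:P.[x].
Proof. by move=> iN hx; rewrite (hu (i := Ordinal iN) hx) fE hornerC mulrC. Qed.

Lemma uh_cell_integral (i : 'I_N) : cell_integral xi i u = f i.
Proof.
rewrite (@cell_integral_poly _ xi i u (cell i p / h i)%:P) ?hlt //; last first.
  by move=> x hx; apply: uE.
rewrite pint_const divfK ?subr_eq0 ?gt_eqF ?hlt // -fE.
by congr f; apply: val_inj.
Qed.

Lemma uN_uh_bound : two_sided_bound (10 ^+ 8) (L2norm (horner p) ^+ 2)%E (L2norm u ^+ 2)%E.
Proof.
have sp : (size p <= N)%N by case: hp.
have [lo up] := equiv_one N_gt0 hxi sp.
rewrite (@L2norm_sqr_poly _ _ (p ^+ 2)); last by move=> t _; rewrite horner_exp.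
have mu_ i : (i < N)%N -> measurable_fun `]xi`_i, xi`_i.+1[ u.
  by move=> iN; apply: (measurable_cell iN) => x; apply: uE.
rewrite (L2norm_sqr_cells (node0 hxi) (nodeN hxi) hlt mu_).
rewrite big_nat.
under eq_bigr => i /andP[_ iN].
  rewrite (@integral_cell_poly _ _ ((cell i p / h i) ^+ 2)%:P iN); last first.
    by move=> x hx; rewrite (uE iN hx) !hornerC.
  rewrite pint_const.
  have -> : (cell i p / h i) ^+ 2 * h i = cell i p ^+ 2 / h i.
    by field; rewrite subr_eq0 gt_eqF ?hlt.
  over.
rewrite -big_nat sumEFin; set S := \sum_(0 <= i < N) _ in lo up *.
have p0 : 0 <= pint (-1) 1 (p ^+ 2) by apply: pint_sqr_ge0; lra.
have S0 : 0 <= S by nra.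
by apply: two_sided_bound_EFin; lra.
Qed.

Lemma weighted_uN_uh_bound : two_sided_bound (10 ^+ 8)
  (L2norm (fun x => (1 - x) `^ (2^-1) * p.[x])%R ^+ 2)%E
  (L2norm (fun x => (1 - x) `^ (2^-1) * u x)%R ^+ 2)%E.
Proof.
have sp : (size p <= N)%N by case: hp.
have [lo up] := equiv_mixed N_gt0 hxi sp.
rewrite (@L2norm_sqr_poly _ _ (W * p * p)); last first.
  by move=> t /andP[_ t1]; rewrite sqr_half_weight // !hE; ring.
have mu_ i : (i < N)%N -> measurable_fun `]xi`_i, xi`_i.+1[ (fun x => (1 - x) `^ (2^-1) * u x).
  move=> iN; apply: measurable_right_weight.
  by apply: (measurable_cell iN) => x; apply: uE.
rewrite (L2norm_sqr_cells (node0 hxi) (nodeN hxi) hlt mu_).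
rewrite big_nat.
under eq_bigr => i /andP[_ iN].
  rewrite (@integral_cell_poly _ _ (((cell i p / h i) ^+ 2)%:P * W) iN); last first.
    move=> x hx; rewrite (uE iN hx) sqr_half_weight ?(cell_lt1 iN hx) //.
    by rewrite !hE; ring.
  rewrite pintZ; over.
rewrite -big_nat sumEFin; set S := \sum_(0 <= i < N) _ in lo up *.
have p0 := ip_ge0 (@right_weight_ge0 R) p; rewrite /ip in lo up p0.
have S0 : 0 <= S by lra.
by apply: two_sided_bound_EFin; lra.
Qed.

End ConstantHistogram.

Section LinearHistogram.

Lemma zh_ex : exists z : R -> R, is_zh xi f z.
Proof.
pose pz (i : 'I_N) : {poly R} :=
  if (i < N.-1)%N then (f i / h i)%:P else (f i / cell i W)%:P * W.
pose z x := \sum_(i < N) (if xi`_i < x < xi`_i.+1 then (pz i).[x] else 0).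
have zE (i : 'I_N) x : xi`_i < x < xi`_i.+1 -> z x = (pz i).[x].
  move=> hx; rewrite /z (bigD1 i) //= hx big1 ?addr0 // => j ji.
  case: ifPn => // /andP[jx xj1]; move/andP: hx => [ix xi1].
  have [ij|ij|/val_inj ij] := ltngtP (val i) (val j); last by rewrite ij eqxx in ji.
    by have := node_le hxi ij (ltnW (ltn_ord j)); lra.
  by have := node_le hxi ij (ltnW (ltn_ord i)); lra.
have NN : (N.-1 < N)%N by rewrite ltn_predL.
exists z; split.
- move=> i iN1; have iN : (i < N)%N by apply: ltn_trans NN.
  exists (f (Ordinal iN) / h i) => x hx.
  by rewrite (zE (Ordinal iN) x hx) /pz iN1 hornerC.
- exists (f (Ordinal NN) / cell N.-1 W) => x hx.
  have hx' : xi`_(Ordinal NN) < x < xi`_(Ordinal NN).+1 by rewrite /= prednK.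
  by rewrite (zE _ _ hx') /pz ltnn !hE.
- move=> i; rewrite (cell_integral_poly (hlt (ltn_ord i)) (zE i)) /pz.
  case: ifPn => _.
    by rewrite pint_const divfK // subr_eq0 gt_eqF ?hlt.
  by rewrite pintZ divfK // gt_eqF // (cell_pos hxi (@pos_right R)).
Qed.

Lemma weight_cell_bound i : (i.+1 < N)%N ->
  h i * (1 - xi`_i.+1) <= cell i W <= h i * (1 - xi`_i).
Proof.
move=> iN; have lt := hlt (ltnW iN); rewrite ![h i * _]mulrC -!pint_const.
by apply/andP; split; apply: pint_le (ltW lt) _ => x /andP[ax xb]; rewrite hornerC !hE; lra.
Qed.

Variables (q : {poly R}) (z : R -> R).
Hypothesis sq : (size q <= N)%N.
Hypothesis hq : forall i : 'I_N, cell_integral xi i (horner (W * q)) = f i.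
Hypothesis hz : is_zh xi f z.

Let g x := (1 - x) `^ (- 2^-1) * z x.
Let T i := cell i (W * q) ^+ 2 / cell i W.

Let fE i (iN : (i < N)%N) : f (Ordinal iN) = cell i (W * q).
Proof. by rewrite -hq cell_integral_horner. Qed.

Let zE i : (i.+1 < N)%N -> forall x, xi`_i < x < xi`_i.+1 ->
  z x = (cell i (W * q) / h i)%:P.[x].
Proof.
move=> iN; have iN' := ltnW iN; case: hz => hc _ hi.
have [|c zc] := hc i; first by rewrite -ltnS prednK.
have zc' x : xi`_i < x < xi`_i.+1 -> z x = c%:P.[x] by move=> /zc ->; rewrite hornerC.
have := hi (Ordinal iN'); rewrite (cell_integral_poly (hlt iN') zc') pint_const fE => <-.
by move=> x /zc ->; rewrite hornerC mulfK // subr_eq0 gt_eqF ?hlt.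
Qed.

Let zNE x : xi`_N.-1 < x < xi`_N ->
  z x = ((cell N.-1 (W * q) / cell N.-1 W)%:P * W).[x].
Proof.
have NN : (N.-1 < N)%N by rewrite ltn_predL.
case: hz => _ [c zc] hi.
have zc' t : xi`_N.-1 < t < xi`_N.-1.+1 -> z t = (c%:P * W).[t].
  by rewrite prednK // => /zc ->; rewrite !hE.
have := hi (Ordinal NN); rewrite (cell_integral_poly (hlt NN) zc') pintZ fE => <-.
move=> /zc ->; rewrite !hE mulfK // gt_eqF //.
exact: (cell_pos hxi (@pos_right R)).
Qed.

Let zmeas i : (i < N)%N -> measurable_fun `]xi`_i, xi`_i.+1[ g.
Proof.
move=> iN; apply: measurable_right_weight; have [iN'|iN'] := ltnP i.+1 N.
  by apply: (measurable_cell iN) => x; apply: zE.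
have -> : i = N.-1 by lia.
apply: (measurable_cell (p := (cell N.-1 (W * q) / cell N.-1 W)%:P * W)) => [|x hx].
  by rewrite ltn_predL.
by apply: zNE; move: hx; rewrite (prednK N_gt0).
Qed.

(** On the last cell [(1 - x)^-1 z^2] is a constant times [1 - x] and its integral is exactly [T i].
    On the others [z] is constant, and by [cell_ratio] the factor [(1 - x)^-1] stays within a factor
    [20] of [h i / cell i W], the inverse mean of the weight. *)
Lemma zh_cell_bound i : (i < N)%N ->
  ((T i / 20)%:E <= \int[mu]_(t in `]xi`_i, xi`_i.+1[) ((g t) ^+ 2)%:E)%E /\
  (\int[mu]_(t in `]xi`_i, xi`_i.+1[) ((g t) ^+ 2)%:E <= (20 * T i)%:E)%E.
Proof.
move=> iN; have W0 := cell_pos hxi (@pos_right R) iN.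
have T0 : 0 <= T i by rewrite /T divr_ge0 ?sqr_ge0 // ltW.
have [iN'|iN'] := ltnP i.+1 N; last first.
  have iE : i = N.-1 by lia.
  have -> : (\int[mu]_(t in `]xi`_i, xi`_i.+1[) ((g t) ^+ 2)%:E)%E = (T i)%:E.
    rewrite (@integral_cell_poly _ i (((cell i (W * q) / cell i W) ^+ 2)%:P * W)) //.
      by rewrite pintZ /T; congr (_%:E); field; rewrite gt_eqF.
    move=> x hx; have x1 := cell_lt1 iN hx.
    rewrite /g sqr_minus_half_weight // zNE -?iE; last by move: hx; rewrite iE prednK.
    by rewrite !hE; field; lra.
  by rewrite !lee_fin; lra.
have lt := hlt iN; have h0 : 0 < h i by rewrite subr_gt0.
have b1 := node_lt1 hxi iN'; have r := cell_ratio N_gt0 hxi iN'.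
have /andP[wl wu] := weight_cell_bound iN'.
pose c := cell i (W * q) / h i.
have gE x : xi`_i < x < xi`_i.+1 -> g x ^+ 2 = (1 - x)^-1 * c ^+ 2.
  move=> hx; rewrite /g sqr_minus_half_weight ?(cell_lt1 iN hx) //.
  by rewrite (zE iN' hx) hornerC.
have mg : measurable_fun `]xi`_i, xi`_i.+1[ (fun t => ((g t) ^+ 2)%:E).
  by apply/measurable_EFinP; apply: measurable_funX; apply: zmeas.
have mc (k : R) : measurable_fun `]xi`_i, xi`_i.+1[ (fun _ : R => k%:E).
  exact: measurable_cst.
have intc (k : R) : (\int[mu]_(t in `]xi`_i, xi`_i.+1[) k%:E = (k * h i)%:E)%E.
  rewrite -pint_const -(@integral_cell_poly (fun _ => k) i k%:P iN) // => x _.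
  by rewrite hornerC.
have c20 : 0 <= c ^+ 2 by exact: sqr_ge0.
have TE : T i = c ^+ 2 * h i * (h i / cell i W).
  by rewrite /T /c; field; rewrite !gt_eqF.
split.
  apply: (@le_trans _ _ (((1 - xi`_i)^-1 * c ^+ 2) * h i)%:E).
    rewrite lee_fin TE ler_pdivrMr //.
    have -> : (1 - xi`_i)^-1 * c ^+ 2 * h i * 20 = c ^+ 2 * h i * (20 / (1 - xi`_i)) by field; lra.
    apply: ler_wpM2l; first by rewrite mulr_ge0 // ltW.
    rewrite ler_pdivrMr // mulrAC ler_pdivlMr ?subr_gt0 //; last by lra.
    by apply: (le_trans (ler_wpM2l (ltW h0) r)); have := wl; lra.
  rewrite -intc; apply: ge0_le_integral => //.
  - by move=> x _; rewrite lee_fin mulr_ge0 // invr_ge0; lra.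
  - move=> x; rewrite /= in_itv /= => hx; rewrite lee_fin gE //.
    by move/andP: hx => [ax xb]; apply: ler_wpM2r => //; rewrite lef_pV2 ?posrE; lra.
apply: (@le_trans _ _ (((1 - xi`_i.+1)^-1 * c ^+ 2) * h i)%:E).
  rewrite -intc; apply: ge0_le_integral => //.
  - by move=> x _; rewrite lee_fin sqr_ge0.
  - move=> x; rewrite /= in_itv /= => hx; rewrite lee_fin gE //.
    by move/andP: hx => [ax xb]; apply: ler_wpM2r => //; rewrite lef_pV2 ?posrE; lra.
rewrite lee_fin TE.
have -> : (1 - xi`_i.+1)^-1 * c ^+ 2 * h i = c ^+ 2 * h i * (1 - xi`_i.+1)^-1 by ring.
have -> : 20 * (c ^+ 2 * h i * (h i / cell i W)) = c ^+ 2 * h i * (20 * h i / cell i W).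
  by field; rewrite gt_eqF.
apply: ler_wpM2l; first by rewrite mulr_ge0 // ltW.
rewrite ler_pdivlMr // mulrC ler_pdivrMr ?subr_gt0 //.
by apply: (le_trans wu); have := ler_wpM2l (ltW h0) r; lra.
Qed.

(** Since [(1 - x)^-1 (W q)^2 = W q^2], the norm and the data of [q] carry the same weight [W]. *)
Lemma zN_zh_bound : two_sided_bound (10 ^+ 8)
  (L2norm (fun x => (1 - x) `^ (- 2^-1) * (W * q).[x])%R ^+ 2)%E
  (L2norm g ^+ 2)%E.
Proof.
have [lo up] := equiv_right N_gt0 hxi sq.
rewrite (@L2norm_sqr_poly _ _ (W * q * q)); last first.
  move=> t /andP[_ t1]; rewrite sqr_minus_half_weight // !hE; field; lra.
rewrite (L2norm_sqr_cells (node0 hxi) (nodeN hxi) hlt zmeas) big_nat.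
set S := \sum_(0 <= i < N) _ in lo up; rewrite -/(ip W q q).
have lo2 : ((S / 20)%:E <=
    \sum_(0 <= i < N | (0 <= i < N)%N) \int[mu]_(t in `]xi`_i, xi`_i.+1[) ((g t) ^+ 2)%:E)%E.
  rewrite /S big_nat mulr_suml -sumEFin; apply: lee_sum => i /andP[_ iN].
  by have [] := zh_cell_bound iN.
have up2 : (\sum_(0 <= i < N | (0 <= i < N)%N)
    \int[mu]_(t in `]xi`_i, xi`_i.+1[) ((g t) ^+ 2)%:E <= (20 * S)%:E)%E.
  rewrite /S big_nat mulr_sumr -sumEFin; apply: lee_sum => i /andP[_ iN].
  by have [] := zh_cell_bound iN.
have q0 := ip_ge0 (@right_weight_ge0 R) q.
have S0 : 0 <= S by lra.
split.
  apply: le_trans (lee_wpmul2l _ up2) _; first by rewrite lee_fin invr_ge0 exprn_ge0.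
  by rewrite -EFinM lee_fin ler_pdivrMl ?exprn_gt0 //; lra.
apply: le_trans (lee_wpmul2l _ lo2); last by rewrite lee_fin exprn_ge0.
by rewrite -EFinM lee_fin; lra.
Qed.

End LinearHistogram.

End Corollary.

Theorem corollary1 (R : realType) :
  exists2 C : R, 0 < C &
  forall (N : nat) (hN : (1 <= N)%N) (xi : N.+1.-tuple R)
    (hxi : gauss_lobatto xi) (f : 'I_N -> R),
  [/\ (exists! uN : {poly R}, is_uN xi f uN),
      (forall (uN : {poly R}) (uh : R -> R), is_uN xi f uN -> is_uh xi f uh ->
        [/\ forall i : 'I_N, cell_integral xi i uh = f i,
            two_sided_bound C (L2norm (horner uN) ^+ 2)%E (L2norm uh ^+ 2)%E
          & two_sided_bound C
              (L2norm (fun x => (1 - x) `^ (2^-1) * uN.[x])%R ^+ 2)%E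
              (L2norm (fun x => (1 - x) `^ (2^-1) * uh x)%R ^+ 2)%E]),
      (exists! zN : {poly R}, is_zN xi f zN),
      (exists zh : R -> R, is_zh xi f zh)
    & (forall (zN : {poly R}) (zh : R -> R), is_zN xi f zN -> is_zh xi f zh ->
        two_sided_bound C
          (L2norm (fun x => (1 - x) `^ (- 2^-1) * zN.[x])%R ^+ 2)%E
          (L2norm (fun x => (1 - x) `^ (- 2^-1) * zh x)%R ^+ 2)%E)].
Proof.
(* The third equivalence is the most demanding: [20 * 10^5] from the polynomial estimate times [20]
   from [zh_cell_bound]. *)
exists (10 ^+ 8); first by rewrite exprn_gt0.
move=> N hN xi hxi f; split.
- exact: uN_ex_unique.
- move=> uN uh hu hh; split; first by move=> i; exact: uh_cell_integral hu hh i.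
    exact: (uN_uh_bound hN hxi hu hh).
  exact: (weighted_uN_uh_bound hN hxi hu hh).
- exact: zN_ex_unique.
- exact: zh_ex.
- by move=> _ zh [[q sq ->] hq] hz; exact: zN_zh_bound hz.
Qed.
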